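(* Let $D_{\beta_i}(t)$, $i=1,2,\ldots,n$, be $n$ independent $\beta_i$-stable subordinators, $0<\beta_i<1$, with corresponding density functions $$f_{\beta_i}(x_i,t)=\frac{1}{\beta_i t^{1/\beta_i}}\mathrm{H}^{0,1}_{1,1}\left[\frac{x_i}{t^{1/\beta_i}}\,\middle|\,\begin{matrix}(1-1/\beta_i,1/\beta_i)\\(0,1)\end{matrix}\right],\qquad x_i>0.$$ Then the probability density function of (i) $X(t)=aD_{\beta_i}(t)$, $a>0$, $1\le i\le n$, is given by $$f(x,t)=\frac{1}{a\beta_i t^{1/\beta_i}}\mathrm{H}^{0,1}_{1,1}\left[\frac{x}{at^{1/\beta_i}}\,\middle|\,\begin{matrix}(1-1/\beta_i,1/\beta_i)\\(0,1)\end{matrix}\right],\qquad x>0;$$ (ii) $Y(t)=\prod_{i=1}^nD_{\beta_i}(t)$ is given by $$f(y,t)=\left(\prod_{i=1}^n\frac{1}{\beta_i t^{1/\beta_i}}\right)\mathrm{H}^{0,n}_{n,n}\left[\frac{y}{t^{\sum_{i=1}^n1/\beta_i}}\,\middle|\,\begin{matrix}(1-1/\beta_i,1/\beta_i)_{1,n}\\(0,1)_{1,n}\end{matrix}\right],\qquad y>0;$$ (iii) $W(t)=D_{\beta_i}^r(t)$ (the $r$-th power of $D_{\beta_i}(t)$), $1\le i\le n$, for $r$ rational, is given by $$f(w,t)=\frac{1}{\beta_i t^{r/\beta_i}}\mathrm{H}^{0,1}_{1,1}\left[\frac{w}{t^{r/\beta_i}}\,\middle|\,\begin{matrix}(1-r/\beta_i,r/\beta_i)\\(1-r,r)\end{matrix}\right],\qquad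 w>0,$$ when $r>0$, and for $r<0$ by $$f(w,t)=\frac{1}{\beta_i t^{r/\beta_i}}\mathrm{H}^{1,0}_{1,1}\left[\frac{w}{t^{r/\beta_i}}\,\middle|\,\begin{matrix}(r,-r)\\(r/\beta_i,-r/\beta_i)\end{matrix}\right],\qquad w>0;$$ (iv) $Z(t)=D_{\beta_i}(t)/D_{\beta_j}(t)$, $1\le i,j\le n$ and $i\ne j$, is given by $$f(z,t)=\frac{1}{\beta_i\beta_jt^{1/\beta_i+1/\beta_j}}\mathrm{H}^{1,1}_{2,2}\left[\frac{z}{t^{1/\beta_i+1/\beta_j}}\,\middle|\,\begin{matrix}(1-1/\beta_i,1/\beta_i)&(-1,1)\\(-1/\beta_j,1/\beta_j)&(0,1)\end{matrix}\right],\qquad z>0.$$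
   Context: Stable subordinator: for $0<\beta<1$, $D_\beta(t)$ is the one-dimensional Lévy process with non-decreasing sample paths, zero drift and Lévy measure $\frac{\beta}{\Gamma(1-\beta)x^{1+\beta}}\mathbb{I}_{(0,\infty)}(x)\,dx$; equivalently $\mathbb{E}(e^{-sD_\beta(t)})=e^{-ts^\beta}$ for $s>0$. Here $t>0$ is the time variable, and $f_\beta(\cdot,t)$ denotes the probability density of $D_\beta(t)$ on $(0,\infty)$. Fox $H$-function: for integers $0\le m\le q$, $0\le n\le p$, complex numbers $a_k,b_l$, reals $A_k,B_l>0$ ($k=1,\ldots,p$, $l=1,\ldots,q$) and $z\neq 0$, $$\mathrm{H}^{m,n}_{p,q}\left[z\,\middle|\,\begin{matrix}(a_k,A_k)_{1,p}\\(b_l,B_l)_{1,q}\end{matrix}\right]=\frac{1}{2\pi i}\int_{c-i\infty}^{c+i\infty}\chi(s)z^{-s}\,ds,\qquad \chi(s)=\frac{\prod_{k=1}^{n}\Gamma(1-a_k-A_ks)\prod_{l=1}^{m}\Gamma(b_l+B_ls)}{\prod_{k=n+1}^{p}\Gamma(a_k+A_ks)\prod_{l=m+1}^{q}\Gamma(1-b_l-B_ls)},$$ where in this formula $i=\sqrt{-1}$, $z^{-s}=\exp\{-s(\ln|z|+i\arg z)\}$ with $\arg z$ not necessarily the principal value, empty products equal $1$, and $c$ is a real number such that the singularities of $\Gamma(b_l+B_ls)$, $1\le l\le m$, lie entirely to the left of the path of integration and those of $\Gamma(1-a_k-A_ks)$, $1\le k\le n$, lie entirely to the right. The upper row lists the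 pairs $(a_k,A_k)$ in order and the lower row the pairs $(b_l,B_l)$ in order; $(a_k,A_k)_{1,p}$ abbreviates $(a_1,A_1),\ldots,(a_p,A_p)$, and $(0,1)_{1,n}$ is the pair $(0,1)$ repeated $n$ times.
   Formalization: In (iv) the power of t is 1/β_i − 1/β_j instead of the printed sum, which is false for t ≠ 1; and since both numerator Gammas are singular at s = 1, so no separating c exists, that removable singularity of χ is disregarded when choosing the contour. *)

(* Defs.v *)
From HB Require Import structures.
From mathcomp Require Export all_boot all_order all_algebra.
From mathcomp Require Export all_classical all_reals all_analysis.
From mathcomp Require Export complex.
Export Order.TTheory GRing.Theory Num.Theory.
Export numFieldNormedType.Exports.

Set Implicit Arguments.
Unset Strict Implicit.
Unset Printing Implicit Defensive.

#[export] Set Implicit Arguments.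
#[export] Unset Strict Implicit.
#[export] Unset Printing Implicit Defensive.

Global Open Scope classical_set_scope.
Global Open Scope complex_scope.
Global Open Scope ring_scope.

Section ComplexAnalysis.
Context {R : realType}.

Definition expC (z : R[i]) : R[i] :=
  (expR (complex.Re z))%:C * (cos (complex.Im z) +i* sin (complex.Im z)).

Definition integralC (D : set R) (f : R -> R[i]) : R[i] :=
  (\int[lebesgue_measure]_(x in D) complex.Re (f x)) +i*
  (\int[lebesgue_measure]_(x in D) complex.Im (f x)).

(* (2 pi i)^-1 times the integral of f along the vertical line Re s = c,
   parametrized by s = c + i y, ds = i dy. *)
Definition vertical_integral (c : R) (f : R[i] -> R[i]) : R[i] :=
  (2 * pi%:C * 'i)^-1 * ('i * integralC setT (fun y => f (c +i* y))).

Definition Gamma_integral (z : R[i]) : R[i] :=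
  integralC `]0, +oo[ (fun x => expC ((z - 1) * (ln x)%:C) * (expR (- x))%:C).

(* The continuation of Euler's integral to the whole plane by
   Gamma z = Gamma (z + N) / (z (z + 1) ... (z + N - 1)), with N chosen so that
   Re z + N > 0.  At the poles 0, -1, -2, ... the denominator vanishes and
   Gamma z = 0; so (Gamma z)^-1 is there the right value 0 of the entire
   function 1 / Gamma. *)
Definition Gamma (z : R[i]) : R[i] :=
  let N := (Num.truncn `|complex.Re z|).+1 in
  Gamma_integral (z + N%:R) / \prod_(k < N) (z + k%:R).

Definition Gamma_pole (z : R[i]) : Prop := exists k : nat, z = - k%:R.

End ComplexAnalysis.

Section FoxH.
Context {R : realType}.
(* aA is the upper row (a_k, A_k)_{1,p}, bB the lower row (b_l, B_l)_{1,q};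
   p and q are their sizes. *)
Variables (m n : nat) (aA bB : seq (R[i] * R)).

Definition right_args (s : R[i]) := [seq 1 - u.1 - u.2%:C * s | u <- take n aA].
Definition left_args (s : R[i]) := [seq u.1 + u.2%:C * s | u <- take m bB].
Definition den_args (s : R[i]) :=
  [seq u.1 + u.2%:C * s | u <- drop n aA] ++
  [seq 1 - u.1 - u.2%:C * s | u <- drop m bB].

Definition chi (s : R[i]) : R[i] :=
  (\prod_(w <- right_args s) Gamma w * \prod_(w <- left_args s) Gamma w) /
  \prod_(w <- den_args s) Gamma w.

Definition left_singularity (s : R[i]) : Prop :=
  exists2 w, w \in left_args s & Gamma_pole w.
Definition right_singularity (s : R[i]) : Prop :=
  exists2 w, w \in right_args s & Gamma_pole w.

(* A point in both families of singularities can be separated from itself by no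
   path.  It is disregarded when it is a removable singularity of chi: Gamma has
   simple poles and no zeros, so this means that at least as many Gamma factors
   of the denominator as of the numerator have a pole there.  When the two
   families are disjoint, nothing is disregarded. *)
Definition cancelled (s : R[i]) : Prop :=
  [/\ left_singularity s, right_singularity s &
      (count (fun w => `[< Gamma_pole w >]) (right_args s ++ left_args s) <=
       count (fun w => `[< Gamma_pole w >]) (den_args s))%N].

Definition separates (c : R) : Prop := forall s : R[i], ~ cancelled s ->
  (left_singularity s -> complex.Re s < c) /\
  (right_singularity s -> c < complex.Re s).

(* The value at z = rho e^{i theta}, with rho = |z| > 0 and theta the chosen
   determination of arg z.  The abscissa is any separating c. *)
Definition foxH (rho theta : R) : R[i] :=
  vertical_integral (xget 0 [set c | separates c])
    (fun s => chi s * expC (- s * (ln rho +i* theta))).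

End FoxH.

Section Probability.
Context d (T : measurableType d) {R : realType} (P : probability T R).

(* F is complex-valued, as Fox H-functions are; being a density on (0, +oo)
   includes that its values there are real and nonnegative.  With B = setT the
   last clause says that the total mass is 1. *)
Definition has_pdf (X : T -> R) (F : R -> R[i]) : Prop :=
  measurable_fun setT X /\
  exists f : R -> R,
    [/\ measurable_fun (`]0, +oo[ : set R) f,
        forall x, 0 < x -> 0 <= f x,
        forall x, 0 < x -> F x = (f x)%:C &
        forall B : set R, measurable B ->
          P (X @^-1` B) =
            (\int[lebesgue_measure]_(x in B `&` `]0%R, +oo[) (f x)%:E)%E].

(* Mutual independence of a finite family of classes of events; each class is
   assumed to contain setT, so the product rule for subfamilies is included. *)
Definition independent_classes (I : finType) (G : I -> set (set T)) : Prop :=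
  forall A : I -> set T, (forall i, G i (A i)) ->
    fine (P (\bigcap_(i in [set: I]) A i)) = \prod_(i : I) fine (P (A i)).

Definition rv_sigma (X : T -> R) : set (set T) :=
  [set X @^-1` B | B in measurable].

(* The sigma-algebra generated by the process (X t)_{t >= 0}. *)
Definition process_sigma (X : R -> T -> R) : set (set T) :=
  <<s [set A | exists2 t, 0 <= t & rv_sigma (X t) A] >>.

Definition independent_processes (I : finType) (X : I -> R -> T -> R) : Prop :=
  independent_classes (fun i => process_sigma (X i)).

(* A process indexed by t >= 0: the values at negative t are irrelevant. *)
Record stable_subordinator (beta : R) (X : R -> {RV P >-> R}) : Prop := {
  subordinator_start : {ae P, forall w, X 0 w = 0};
  subordinator_nondecreasing :
    {ae P, forall w, forall s t, 0 <= s -> s <= t -> X s w <= X t w};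
  subordinator_right_continuous :
    {ae P, forall w, forall t, 0 <= t -> X u w @[u --> t^'+] --> X t w};
  subordinator_independent_increments :
    forall (k : nat) (t : nat -> R), 0 <= t 0 -> nondecreasing_seq t ->
      independent_classes
        (fun j : 'I_k => rv_sigma (fun w => X (t j.+1) w - X (t j) w));
  subordinator_stationary_increments :
    forall s t (B : set R), 0 <= s -> s <= t -> measurable B ->
      P ((fun w => X t w - X s w) @^-1` B) = P (X (t - s) @^-1` B);
  subordinator_laplace : forall t s, 0 < t -> 0 < s ->
    (\int[P]_w (expR (- s * X t w))%:E)%E = (expR (- t * s `^ beta))%:E
}.

End Probability.

(* Main.v *)
Require Import Defs.
From HB Require Import structures.
From mathcomp Require Import ring lra measurable_realfun.

(* All five densities are instances of one Mellin inversion.  If D is the value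
   at time t of a b-stable subordinator and E is an independent exponential
   variable, the Laplace transform of D shows that E / D and (E / t)^(1/b) have
   the same law; hence, for Re u > -b,
     E[D^(-u)] = t^(-u/b) Gamma(1 + u/b) / Gamma(1 + u),
   which, by Gauss's product for Gamma, is O(1 / (1 + y^2)) on vertical lines.
   By independence, the Mellin transform E[X^(s-1)] of each transform X of the
   subordinators is a product of such moments, namely the function chi of the
   stated H-function up to a factor A tau^s.  A variable whose Mellin transform
   decays quadratically on a line has the inverse Mellin integral as density,
   which is seen by inserting Abel's factor expR (- eps |y|): this convolves the
   law of ln X with a Poisson kernel. *)

(** The equality in law comes from comparing tails: P(E / D > s) is the Laplace transform of D at s,
    that is exp(- t s^b), and this is P(E > t s^b). It gives moments of every complex order in a
    half-plane at once, without differentiating the Laplace transform or continuing it analytically.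
    [foxH] selects an arbitrary separating abscissa, so inversion must work on whatever line is
    selected. No contour is shifted: separation itself forces the line into the half-plane or strip
    where the moments exist. Stirling's formula would give exponential decay of Gamma(1 + u/b) /
    Gamma(1 + u). Order two is enough for absolute integrability, and it follows from comparing the
    Gauss products factor by factor. For a ratio of subordinators the selected line may pass through
    s = 1, where the poles of chi cancel but [Gamma] returns 0. Moments are therefore kept in terms
    of Gamma(1 + u) and Gamma(1 + u/b), regular at u = 0, and compared with chi off one point of the
    line. *)

Section density.
Local Open Scope ereal_scope.
Context d (T : measurableType d) (R : realType).
Variables (mu : {measure set T -> \bar R}) (k : T -> R).
Hypotheses (mk : measurable_fun setT k) (k0 : forall x, (0 <= k x)%R).

(** Serves twice: for the exponential law, and for the law of a variable tilted by a power weight in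
    the Mellin inversion. *)
Lemma density_measure_ex : exists m : {measure set T -> \bar R},
  forall A, measurable A -> m A = \int[mu]_(x in A) (k x)%:E.
Proof.
pose f A := \int[mu]_(x in A) (k x)%:E.
have f0 : f set0 = 0 by rewrite /f integral_set0.
have fge0 A : 0 <= f A by apply: integral_ge0 => x _; rewrite lee_fin.
have fadd : semi_sigma_additive f.
  move=> F mF tF mUF; rewrite /f ge0_integral_bigcup//; last 2 first.
  - by apply: measurable_funTS; exact/measurable_EFinP.
  - by move=> x _; rewrite lee_fin.
  by apply/is_cvg_nneseries => n _ _; exact: fge0.
pose H := isMeasure.Build d T R f f0 fge0 fadd.
pose m : {measure set T -> \bar R} := HB.pack f H.
by exists m.
Qed.

Variable m : {measure set T -> \bar R}.
Hypothesis mE : forall A, measurable A -> m A = \int[mu]_(x in A) (k x)%:E.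

Import HBNNSimple.

(** For indicators this is [mE]; simple functions follow by linearity, and monotone convergence
    along [nnsfun_approx] does the rest. *)
Lemma ge0_integral_density (f : T -> \bar R) : measurable_fun setT f ->
  (forall x, 0 <= f x) -> \int[m]_x f x = \int[mu]_x (f x * (k x)%:E).
Proof.
move=> mf f0.
pose f_ := nnsfun_approx measurableT mf.
transitivity (limn (fun n => \int[m]_x (f_ n x)%:E)).
  rewrite -monotone_convergence//.
  - apply: eq_integral => y _; apply/esym/cvg_lim => //.
    exact: cvg_nnsfun_approx.
  - by move=> n; exact/measurable_EFinP/measurable_funP.
  - by move=> n y _; rewrite lee_fin.
  - by move=> y _ a b ab; rewrite lee_fin; exact/lefP/nd_nnsfun_approx.
rewrite [X in limn X](_ : _ =
    (fun n => \int[mu]_x ((f_ n x)%:E * (k x)%:E))).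
  rewrite -monotone_convergence//; last 3 first.
    - move=> n; apply: emeasurable_funM; first exact/measurable_EFinP/measurable_funP.
      exact/measurable_EFinP.
    - by move=> n x _; rewrite mule_ge0 ?lee_fin.
    - by move=> x _ a b ab; rewrite lee_wpmul2r ?lee_fin//; exact/lefP/nd_nnsfun_approx.
  apply: eq_integral => x _; apply/cvg_lim => //.
  apply: cvgeZr => //.
  exact: cvg_nnsfun_approx.
apply/funext => n.
transitivity (\sum_(r \in range (f_ n))
    \int[mu]_x ((r * \1_(f_ n @^-1` [set r]) x)%:E * (k x)%:E)).
  under eq_integral do rewrite fimfunE -fsumEFin//.
  rewrite ge0_integral_fsum//; last 2 first.
  - by move=> y; exact/measurable_EFinP/measurable_funM.
  - by move=> y x _; rewrite nnfun_muleindic_ge0.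
  apply: eq_fsbigr => r; rewrite inE => -[z _ rE].
  rewrite integralZl_indic_nnsfun// integral_indic//= setIT mE//.
  rewrite -[RHS](_ : \int[mu]_x (r%:E * (((k \_ (f_ n @^-1` [set r]))%R x)%:E)) = _).
    rewrite integral_mkcond ge0_integralZl_EFin//.
    - by congr (_ * _); apply: eq_integral => x _; rewrite restrict_EFin.
    - by move=> x _; rewrite lee_fin patchE; case: ifP.
    - by apply/measurable_EFinP; apply/(measurable_restrictT _ _).1 => //;
        exact: measurable_funTS.
    - by rewrite -rE.
  apply: eq_integral => x _; rewrite -!EFinM patchE indicE.
  by case: ifP; rewrite ?(mulr1,mulr0,mul0r).
rewrite -ge0_integral_fsum//.
- by apply: eq_integral => x _; rewrite [in RHS]fimfunE -fsumEFin// ge0_mule_fsuml// => r;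
    rewrite nnfun_muleindic_ge0.
- move=> r; apply: emeasurable_funM; last exact/measurable_EFinP.
  exact/measurable_EFinP/measurable_funM.
- by move=> r x _; rewrite mule_ge0 ?nnfun_muleindic_ge0 ?lee_fin.
Qed.

Lemma integral_density (f : T -> R) : measurable_fun setT f ->
  \int[m]_x (f x)%:E = \int[mu]_x (f x * k x)%:E.
Proof.
move=> mf; rewrite integralE [RHS]integralE.
have mF : measurable_fun setT (EFin \o f) by exact/measurable_EFinP.
rewrite !ge0_integral_density//; [|exact: measurable_funeneg|exact: measurable_funepos].
congr (_ - _); apply: eq_integral => x _.
  rewrite !funeposE /= -!EFin_max -EFinM; congr EFin.
  by rewrite maxr_pMl// mul0r.
rewrite !funenegE /= -!EFin_max -EFinM; congr EFin.
by rewrite maxr_pMl// mul0r mulNr.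
Qed.

End density.

(** * Dominated convergence for real-valued integrals *)

Section convergence.
Context d (T : measurableType d) (R : realType) (mu : {measure set T -> \bar R}).
Variable D : set T.
Hypothesis mD : measurable D.

Lemma integrable_dominated (f g : T -> R) : measurable_fun D f ->
  (forall x, D x -> `|f x| <= g x) ->
  mu.-integrable D (EFin \o g) -> mu.-integrable D (EFin \o f).
Proof.
move=> mf fg; apply: le_integrable => //; first exact/measurable_EFinP.
by move=> x Dx /=; rewrite lee_fin (le_trans (fg _ Dx))// ler_norm.
Qed.

Lemma Rintegral_dominated_cvg (f_ : nat -> T -> R) (f g : T -> R) :
  (forall n, measurable_fun D (f_ n)) ->
  (forall x, D x -> f_ n x @[n --> \oo] --> f x) ->
  (forall n x, D x -> `|f_ n x| <= g x) ->
  mu.-integrable D (EFin \o g) ->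
  mu.-integrable D (EFin \o f) /\
  \int[mu]_(x in D) f_ n x @[n --> \oo] --> \int[mu]_(x in D) f x.
Proof.
move=> mf_ cf fg ig.
have mf : measurable_fun D f by exact: (measurable_fun_cvg mf_).
have [|||||i _ h] := @dominated_convergence _ _ _ mu D mD (fun n => EFin \o f_ n) (EFin \o f)
  (EFin \o g).
- by move=> n; exact/measurable_EFinP.
- exact/measurable_EFinP.
- by apply: aeW => x Dx; apply: cvg_EFin; [exact: nearW|exact: cf].
- exact: ig.
- by apply: aeW => x n Dx; rewrite lee_fin; exact: fg.
split => //; apply: fine_cvg; rewrite fineK//.
exact: integrable_fin_num.
Qed.

End convergence.

(** * Complex-valued integrals *)

Section FTC.
Context {R : realType}.
Local Notation mu := (@lebesgue_measure R).
Variables (g G : R -> R) (D : set R) (p q : nat -> R) (l L : R).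
Hypotheses (pq : forall n, p n < q n)
  (nd : forall n m, (n <= m)%N -> p m <= p n /\ q n <= q m)
  (DE : forall x, D x <-> exists n, p n <= x <= q n)
  (dG : forall x, D x -> is_derive x 1 G (g x))
  (cg : forall x, D x -> {for x, continuous g})
  (Gp : G (p n) @[n --> \oo] --> l) (Gq : G (q n) @[n --> \oo] --> L).

Lemma exhaust_bigcup : D = \bigcup_n `[p n, q n]%classic.
Proof.
apply/seteqP; split=> x.
  by move=> /DE[n xn]; exists n => //=; rewrite in_itv.
by move=> [n _ /=]; rewrite in_itv/= => xn; apply/DE; exists n.
Qed.

Lemma measurable_exhaust : measurable D.
Proof. by rewrite exhaust_bigcup; exact: bigcup_measurable. Qed.

Lemma measurable_fun_exhaust : measurable_fun D g.
Proof.
rewrite exhaust_bigcup; apply/measurable_fun_bigcup => // n.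
apply: subspace_continuous_measurable_fun => //.
apply: continuous_in_subspaceT => x; rewrite inE/= in_itv/= => xn.
by apply: cg; apply/DE; exists n.
Qed.

Lemma FTC_piece n :
  (\int[mu]_(x in `[p n, q n]) (g x)%:E = (G (q n) - G (p n))%:E)%E.
Proof.
have sD x : p n <= x <= q n -> D x by move=> xn; apply/DE; exists n.
have cG x : p n <= x <= q n -> {for x, continuous G}.
  move=> /sD/dG => -[dGx _].
  by apply: differentiable_continuous; exact/derivable1_diffP.
rewrite EFinB; apply: continuous_FTC2 => //.
- apply: continuous_in_subspaceT => x; rewrite inE/= in_itv/= => xn.
  exact/cg/sD.
- split.
  + move=> x; rewrite in_itv/= => /andP[/ltW h1 /ltW h2].
    by have [] := dG (sD x (introT andP (conj h1 h2))).
  + by apply: cvg_at_right_filter; apply: cG; rewrite lexx ltW.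
  + by apply: cvg_at_left_filter; apply: cG; rewrite lexx ltW.
- move=> x; rewrite in_itv/= => /andP[/ltW h1 /ltW h2].
  rewrite derive1E.
  by have [_] := dG (sD x (introT andP (conj h1 h2))).
Qed.

(** The fundamental theorem on the compact pieces and monotone convergence. [G] need not make sense
    at the ends of [D], only its limits [l] and [L] count; integrability of [g] is a consequence
    here and not an assumption. *)
Lemma ge0_FTC_exhaust : (forall x, D x -> 0 <= g x) ->
  (\int[mu]_(x in D) (g x)%:E = (L - l)%:E)%E.
Proof.
move=> g0.
have sD n x : p n <= x <= q n -> D x by move=> xn; apply/DE; exists n.
have h1 : (\int[mu]_(x in `[p n, q n]) (g x)%:E)%E @[n --> \oo] -->
    (\int[mu]_(x in D) (g x)%:E)%E.
  rewrite exhaust_bigcup; apply: ge0_nondecreasing_set_cvg_integral => //.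
  - move=> n m nm; apply/subsetPset => x/=; rewrite !in_itv/= => /andP[a b].
    have [c e] := nd nm; lra.
  - move=> n; apply: (@measurable_funS _ _ _ _ D) => //.
    + exact: measurable_exhaust.
    + by move=> x/=; rewrite in_itv/=; exact: sD.
    + by apply/measurable_EFinP; exact: measurable_fun_exhaust.
  - by move=> n x /=; rewrite in_itv/= lee_fin => xn; apply/g0/(sD n).
have h2 : (\int[mu]_(x in `[p n, q n]) (g x)%:E)%E @[n --> \oo] --> (L - l)%:E.
  under eq_fun do rewrite FTC_piece.
  by apply: cvg_EFin; [exact: nearW|exact: cvgB].
exact: (cvg_unique _ h1 h2).
Qed.

(** For a [g] of varying sign: its restrictions to the pieces are dominated by [|g|] and at each
    point of [D] eventually equal to [g]. *)
Lemma FTC_exhaust : mu.-integrable D (EFin \o g) ->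
  \int[mu]_(x in D) g x = L - l.
Proof.
move=> ig.
have sD n x : p n <= x <= q n -> D x by move=> xn; apply/DE; exists n.
have mD := measurable_exhaust.
have h2 : \int[mu]_(x in D) (g \_ `[p n, q n]%classic) x @[n --> \oo] --> L - l.
  rewrite [X in X @ _](_ : _ = fun n => G (q n) - G (p n)); first exact: cvgB.
  apply/funext => n; rewrite -Rintegral_mkcondr setIidr.
    by rewrite /Rintegral FTC_piece.
  by move=> x/=; rewrite in_itv/=; exact: sD.
suff h1 : \int[mu]_(x in D) (g \_ `[p n, q n]%classic) x @[n --> \oo] -->
    \int[mu]_(x in D) g x by exact: (cvg_unique _ h1 h2).
refine (proj2 (@Rintegral_dominated_cvg _ _ _ mu D mD
  (fun n => g \_ `[p n, q n]%classic) g (fun x => `|g x|) _ _ _ _)).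
- move=> n; apply: measurable_funTS; apply/(measurable_restrictT _ _).1 => //.
  apply: (@measurable_funS _ _ _ _ D) => //; last exact: measurable_fun_exhaust.
  by move=> x/=; rewrite in_itv/=; exact: sD.
- move=> x /DE[n /andP[h4 h3]]; apply: cvg_near_cst; exists n => //= m /= nm.
  rewrite patchE mem_set//= in_itv/=.
  by have [c e] := nd nm; lra.
- by move=> n x Dx; rewrite patchE; case: ifP; rewrite // normr0.
- by have := integrable_abse ig.
Qed.

End FTC.

(** * Real and imaginary parts, squared modulus, complex exponential *)

Section complex_facts.
Context {R : realType}.
Implicit Types (z w : R[i]) (x y : R).

Lemma eq_complexP z w :
  complex.Re z = complex.Re w -> complex.Im z = complex.Im w -> z = w.
Proof. by case: z w => [a b] [c e] /= -> ->. Qed.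

Lemma ReD z w : complex.Re (z + w) = complex.Re z + complex.Re w.
Proof. by case: z w => [a b] [c e]. Qed.
Lemma ImD z w : complex.Im (z + w) = complex.Im z + complex.Im w.
Proof. by case: z w => [a b] [c e]. Qed.
Lemma ReN z : complex.Re (- z) = - complex.Re z.
Proof. by case: z. Qed.
Lemma ImN z : complex.Im (- z) = - complex.Im z.
Proof. by case: z. Qed.
Lemma ReM z w : complex.Re (z * w) =
  complex.Re z * complex.Re w - complex.Im z * complex.Im w.
Proof. by case: z w => [a b] [c e]. Qed.
Lemma ImM z w : complex.Im (z * w) =
  complex.Re z * complex.Im w + complex.Im z * complex.Re w.
Proof. by case: z w => [a b] [c e]. Qed.
Lemma ReC x : complex.Re x%:C = x. Proof. by []. Qed.
Lemma ImC x : complex.Im x%:C = 0. Proof. by []. Qed.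

Lemma Re_nat n : complex.Re (n%:R : R[i]) = n%:R.
Proof. by elim: n => // n IH; rewrite !mulrS ReD IH. Qed.
Lemma Im_nat n : complex.Im (n%:R : R[i]) = 0.
Proof. by elim: n => // n IH; rewrite !mulrS ImD IH addr0. Qed.

Definition complexE := (ReD, ImD, ReN, ImN, ReM, ImM, ReC, ImC, Re_nat, Im_nat).

(** The squared modulus, with values in [R] where the norm of [R[i]] has values in [R[i]]; being
    polynomial and multiplicative, it makes all estimates free of square roots. *)
Definition sqn z : R := complex.Re z ^+ 2 + complex.Im z ^+ 2.

Lemma sqn_ge0 z : 0 <= sqn z.
Proof. by rewrite addr_ge0 ?sqr_ge0. Qed.

Lemma sqn_eq0 z : (sqn z == 0) = (z == 0).
Proof. by rewrite eq_complex /sqn paddr_eq0 ?sqr_ge0// !sqrf_eq0. Qed.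

Lemma sqnM z w : sqn (z * w) = sqn z * sqn w.
Proof. rewrite /sqn !complexE; ring. Qed.

Lemma sqn1 : sqn (1 : R[i]) = 1.
Proof. by rewrite /sqn /= expr1n expr0n addr0. Qed.

Lemma sqnC x : sqn x%:C = x ^+ 2.
Proof. by rewrite /sqn /= expr0n addr0. Qed.

Lemma sqnV z : sqn z^-1 = (sqn z)^-1.
Proof.
have [->|z0] := eqVneq z 0; first by rewrite invr0 (eqP (_ : sqn 0 == 0)) ?sqn_eq0// invr0.
have n0 : sqn z != 0 by rewrite sqn_eq0.
by apply: (mulfI n0); rewrite -sqnM !mulfV// sqn1.
Qed.

Lemma sqn_prod (I : Type) (s : seq I) (P : pred I) (F : I -> R[i]) :
  sqn (\prod_(i <- s | P i) F i) = \prod_(i <- s | P i) sqn (F i).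
Proof. by apply: (big_morph sqn sqnM sqn1). Qed.

Lemma ler_Re z (k : R) : 0 <= k -> sqn z <= k ^+ 2 -> `|complex.Re z| <= k.
Proof.
move=> k0 h; rewrite -(ler_pXn2r (ltn0Sn 1))// ?nnegrE// real_normK ?num_real//.
by apply: le_trans h; rewrite lerDl sqr_ge0.
Qed.

Lemma ler_Im z (k : R) : 0 <= k -> sqn z <= k ^+ 2 -> `|complex.Im z| <= k.
Proof.
move=> k0 h; rewrite -(ler_pXn2r (ltn0Sn 1))// ?nnegrE// real_normK ?num_real//.
by apply: le_trans h; rewrite lerDr sqr_ge0.
Qed.

Lemma Re_expC z : complex.Re (expC z) = expR (complex.Re z) * cos (complex.Im z).
Proof. by rewrite /expC !complexE /=; ring. Qed.
Lemma Im_expC z : complex.Im (expC z) = expR (complex.Re z) * sin (complex.Im z).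
Proof. by rewrite /expC !complexE /=; ring. Qed.

Lemma expCD z w : expC (z + w) = expC z * expC w.
Proof.
apply: eq_complexP.
  by rewrite [RHS]ReM !(Re_expC, Im_expC) ReD ImD expRD cosD; ring.
by rewrite [RHS]ImM !(Re_expC, Im_expC) ReD ImD expRD sinD; ring.
Qed.

Lemma expC0 : expC 0 = 1 :> R[i].
Proof. by apply: eq_complexP; rewrite !(Re_expC, Im_expC) /= ?cos0 ?sin0 expR0; ring. Qed.

Lemma expC_real x : expC x%:C = (expR x)%:C.
Proof. by apply: eq_complexP; rewrite !(Re_expC, Im_expC) /= ?cos0 ?sin0; ring. Qed.

Lemma expC_sum (I : Type) (s : seq I) (P : pred I) (F : I -> R[i]) :
  expC (\sum_(i <- s | P i) F i) = \prod_(i <- s | P i) expC (F i).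
Proof. exact: (big_morph expC expCD expC0). Qed.

Lemma sqn_expC z : sqn (expC z) = expR (complex.Re z) ^+ 2.
Proof. by rewrite /sqn Re_expC Im_expC !exprMn -mulrDr cos2Dsin2 mulr1. Qed.

End complex_facts.

Section cint.
Local Open Scope ring_scope.
Context d (T : measurableType d) (R : realType) (mu : {measure set T -> \bar R}).
Implicit Types (D : set T) (f g : T -> R[i]).

(** [integralC] for an arbitrary measure; for Lebesgue measure the two are convertible, which lets
    the lemmas below apply to [Gamma_integral] and [foxH]. *)
Definition cintegral D f : R[i] :=
  (\int[mu]_(x in D) complex.Re (f x)) +i* (\int[mu]_(x in D) complex.Im (f x)).

Definition cintegrable D f :=
  mu.-integrable D (fun x => (complex.Re (f x))%:E) /\
  mu.-integrable D (fun x => (complex.Im (f x))%:E).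

Definition cmeasurable D f :=
  measurable_fun D (fun x => complex.Re (f x)) /\
  measurable_fun D (fun x => complex.Im (f x)).

Lemma cmeasurableM D f g : cmeasurable D f -> cmeasurable D g ->
  cmeasurable D (fun x => f x * g x).
Proof.
move=> [f1 f2] [g1 g2]; split.
  under eq_fun do rewrite ReM.
  by apply: measurable_funB; apply: measurable_funM.
under eq_fun do rewrite ImM.
by apply: measurable_funD; apply: measurable_funM.
Qed.

Lemma cmeasurable_expC D f : cmeasurable D f -> cmeasurable D (fun x => expC (f x)).
Proof.
move=> [f1 f2].
have mc : measurable_fun setT (@cos R).
  by apply: continuous_measurable_fun; exact: continuous_cos.
have ms : measurable_fun setT (@sin R).
  by apply: continuous_measurable_fun; exact: continuous_sin.
have me := measurableT_comp (@measurable_expR R) f1.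
split; under eq_fun do rewrite ?Re_expC ?Im_expC.
  exact: measurable_funM me (measurableT_comp mc f2).
exact: measurable_funM me (measurableT_comp ms f2).
Qed.

Lemma cmeasurable_real D (f : T -> R) : measurable_fun D f ->
  cmeasurable D (fun x => (f x)%:C).
Proof. by move=> mf; split. Qed.

Lemma cmeasurable_cst D z : cmeasurable D (fun=> z).
Proof. by split. Qed.

Lemma eq_cintegral D f g : (forall x, D x -> f x = g x) ->
  cintegral D f = cintegral D g.
Proof.
move=> fg; congr (_ +i* _); apply: eq_Rintegral => x; rewrite inE => Dx;
  by rewrite fg.
Qed.

Lemma cintegrable_dominated D f (g : T -> R) : measurable D ->
  cmeasurable D f -> (forall x, D x -> sqn (f x) <= g x ^+ 2) ->
  (forall x, D x -> 0 <= g x) -> mu.-integrable D (EFin \o g) ->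
  cintegrable D f.
Proof.
move=> mD [f1 f2] fg g0 ig; split.
  by apply: integrable_dominated ig => // x Dx; apply: ler_Re; [exact: g0|exact: fg].
by apply: integrable_dominated ig => // x Dx; apply: ler_Im; [exact: g0|exact: fg].
Qed.

Lemma cintegralZ D z f : measurable D -> cintegrable D f ->
  cintegral D (fun x => z * f x) = z * cintegral D f.
Proof.
move=> mD [f1 f2].
have i1 (r : R) : mu.-integrable D (fun x => (r * complex.Re (f x))%:E).
  by under eq_fun do rewrite EFinM; exact: integrableZl.
have i2 (r : R) : mu.-integrable D (fun x => (r * complex.Im (f x))%:E).
  by under eq_fun do rewrite EFinM; exact: integrableZl.
apply: eq_complexP; rewrite /cintegral.
  rewrite [RHS]ReM [LHS]/= -!RintegralZl// -RintegralB//; [|exact: i1|exact: i2].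
  by apply: eq_Rintegral => x _; rewrite ReM.
rewrite ImM /= -!RintegralZl// -RintegralD//; [|exact: i2|exact: i1].
by apply: eq_Rintegral => x _; rewrite ImM.
Qed.

Lemma cintegralD D f g : measurable D -> cintegrable D f -> cintegrable D g ->
  cintegral D (fun x => f x + g x) = cintegral D f + cintegral D g.
Proof.
move=> mD [f1 f2] [g1 g2].
apply: eq_complexP; rewrite /cintegral.
  rewrite [RHS]ReD [LHS]/= -RintegralD//.
  by apply: eq_Rintegral => x _; rewrite ReD.
rewrite ImD /= -RintegralD//.
by apply: eq_Rintegral => x _; rewrite ImD.
Qed.

Lemma cintegrableZ D z f : measurable D -> cintegrable D f ->
  cintegrable D (fun x => z * f x).
Proof.
move=> mD [f1 f2].
have i1 (r : R) : mu.-integrable D (fun x => (r * complex.Re (f x))%:E).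
  by under eq_fun do rewrite EFinM; exact: integrableZl.
have i2 (r : R) : mu.-integrable D (fun x => (r * complex.Im (f x))%:E).
  by under eq_fun do rewrite EFinM; exact: integrableZl.
split.
  under eq_fun do rewrite ReM EFinB.
  exact: integrableB.
under eq_fun do rewrite ImM EFinD.
exact: integrableD.
Qed.

Lemma cintegral_dominated_cvg D (f_ : nat -> T -> R[i]) f (g : T -> R) :
  measurable D ->
  (forall n, cmeasurable D (f_ n)) ->
  (forall x, D x -> complex.Re (f_ n x) @[n --> \oo] --> complex.Re (f x)) ->
  (forall x, D x -> complex.Im (f_ n x) @[n --> \oo] --> complex.Im (f x)) ->
  (forall n x, D x -> sqn (f_ n x) <= g x ^+ 2) ->
  (forall x, D x -> 0 <= g x) -> mu.-integrable D (EFin \o g) ->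
  complex.Re (cintegral D (f_ n)) @[n --> \oo] --> complex.Re (cintegral D f) /\
  complex.Im (cintegral D (f_ n)) @[n --> \oo] --> complex.Im (cintegral D f).
Proof.
move=> mD mf c1 c2 fg g0 ig; split.
  apply: (Rintegral_dominated_cvg mD _ _ _ ig).2 => [n|x Dx|n x Dx].
  - exact: (mf n).1.
  - exact: c1.
  - by apply: ler_Re; [exact: g0|exact: fg].
apply: (Rintegral_dominated_cvg mD _ _ _ ig).2 => [n|x Dx|n x Dx].
- exact: (mf n).2.
- exact: c2.
- by apply: ler_Im; [exact: g0|exact: fg].
Qed.

End cint.

(** * Complex powers of a real base *)

Section cpow.
Context {R : realType}.
Implicit Types (x : R) (z : R[i]).

(** The power x^z for x > 0. Since [ln] is 0 at nonpositive arguments, the value there is 1. *)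
Definition cpow x z : R[i] := expC (z * (ln x)%:C).

Lemma Re_cpow x z : complex.Re (cpow x z) =
  expR (complex.Re z * ln x) * cos (complex.Im z * ln x).
Proof. by rewrite Re_expC ReM ImM ReC ImC !mulr0 subr0 add0r. Qed.

Lemma Im_cpow x z : complex.Im (cpow x z) =
  expR (complex.Re z * ln x) * sin (complex.Im z * ln x).
Proof. by rewrite Im_expC ReM ImM ReC ImC !mulr0 subr0 add0r. Qed.

Lemma sqn_cpow x z : sqn (cpow x z) = expR (complex.Re z * ln x) ^+ 2.
Proof. by rewrite sqn_expC ReM ReC ImC mulr0 subr0. Qed.

Lemma cpow_real x (a : R) : cpow x a%:C = (expR (a * ln x))%:C.
Proof. by rewrite /cpow -rmorphM expC_real. Qed.

Lemma cpowS x z : 0 < x -> cpow x (z + 1) = x%:C * cpow x z.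
Proof.
move=> x0; rewrite /cpow mulrDl expCD mul1r expC_real lnK// mulrC//.
Qed.

Lemma is_derive_Re_cpow x z : 0 < x ->
  is_derive x 1 (fun t => complex.Re (cpow t z)) (complex.Re (z * cpow x (z - 1))).
Proof.
move=> x0; under eq_fun do rewrite Re_cpow.
have hl := is_derive1_ln x0.
have h1 (a : R) : is_derive x 1 (fun t => a * ln t) (a * x^-1).
  exact: (@is_deriveZ _ _ _ _ a).
have h2 := is_derive1_comp (is_derive_expR _) (h1 (complex.Re z)).
have h3 := is_derive1_comp (is_derive_cos _) (h1 (complex.Im z)).
have h4 := is_deriveM h2 h3.
apply: is_derive_eq h4 _.
rewrite ReM Re_cpow Im_cpow ReD ReN ImD ImN /= subr0 mulrBl mul1r expRB lnK//.
rewrite /GRing.scale /=. field; lra.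
Qed.

Lemma is_derive_Im_cpow x z : 0 < x ->
  is_derive x 1 (fun t => complex.Im (cpow t z)) (complex.Im (z * cpow x (z - 1))).
Proof.
move=> x0; under eq_fun do rewrite Im_cpow.
have hl := is_derive1_ln x0.
have h1 (a : R) : is_derive x 1 (fun t => a * ln t) (a * x^-1).
  exact: (@is_deriveZ _ _ _ _ a).
have h2 := is_derive1_comp (is_derive_expR _) (h1 (complex.Re z)).
have h3 := is_derive1_comp (is_derive_sin _) (h1 (complex.Im z)).
have h4 := is_deriveM h2 h3.
apply: is_derive_eq h4 _.
rewrite ImM Re_cpow Im_cpow ReD ReN ImD ImN /= subr0 mulrBl mul1r expRB lnK//.
rewrite /GRing.scale /=. field; lra.
Qed.

Lemma cpow_continuous x z w : 0 < x ->
  {for x, continuous (fun t => complex.Re (w * cpow t z))} /\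
  {for x, continuous (fun t => complex.Im (w * cpow t z))}.
Proof.
move=> x0.
have c1 : {for x, continuous (fun t => complex.Re (cpow t z))}.
  have [h _] := is_derive_Re_cpow z x0.
  by apply: differentiable_continuous; exact/derivable1_diffP.
have c2 : {for x, continuous (fun t => complex.Im (cpow t z))}.
  have [h _] := is_derive_Im_cpow z x0.
  by apply: differentiable_continuous; exact/derivable1_diffP.
split.
  suff : complex.Re (w * cpow t z) @[t --> x] --> complex.Re (w * cpow x z) by [].
  rewrite (ReM w); under eq_fun do rewrite (ReM w).
  by apply: cvgB; apply: cvgM => //; exact: cvg_cst.
suff : complex.Im (w * cpow t z) @[t --> x] --> complex.Im (w * cpow x z) by [].
rewrite (ImM w); under eq_fun do rewrite (ImM w).
by apply: cvgD; apply: cvgM => //; exact: cvg_cst.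
Qed.

Lemma cmeasurable_cpow (D : set R) z : cmeasurable D (fun x => cpow x z).
Proof.
have h : cmeasurable D (fun x : R => (ln x)%:C).
  by apply/cmeasurable_real/measurable_funTS; exact: measurable_ln.
exact: cmeasurable_expC (cmeasurableM (cmeasurable_cst D z) h).
Qed.

Lemma measurable_rpow (D : set R) (a : R) : measurable_fun D (fun x => expR (a * ln x)).
Proof.
apply: measurable_funTS; apply: measurableT_comp; first exact: measurable_expR.
by apply: measurable_funM => //; exact: measurable_ln.
Qed.

End cpow.

Section ccvg.
Context {R : realType}.
Implicit Types (u v : nat -> R[i]) (l m : R[i]).

Definition ccvg u l := complex.Re (u n) @[n --> \oo] --> complex.Re l /\
  complex.Im (u n) @[n --> \oo] --> complex.Im l.

Lemma ccvg_unique u l m : ccvg u l -> ccvg u m -> l = m.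
Proof.
move=> [l1 l2] [m1 m2]; apply: eq_complexP.
  exact: (cvg_unique _ l1 m1).
exact: (cvg_unique _ l2 m2).
Qed.

Lemma ccvg_cst l : ccvg (fun=> l) l.
Proof. by split; exact: cvg_cst. Qed.

Lemma ccvgD u v l m : ccvg u l -> ccvg v m -> ccvg (fun n => u n + v n) (l + m).
Proof.
move=> [l1 l2] [m1 m2]; split.
  by rewrite ReD; under eq_fun do rewrite ReD; exact: cvgD.
by rewrite ImD; under eq_fun do rewrite ImD; exact: cvgD.
Qed.

Lemma ccvgM u v l m : ccvg u l -> ccvg v m -> ccvg (fun n => u n * v n) (l * m).
Proof.
move=> [l1 l2] [m1 m2]; split.
  by rewrite ReM; under eq_fun do rewrite ReM; apply: cvgB; exact: cvgM.
by rewrite ImM; under eq_fun do rewrite ImM; apply: cvgD; exact: cvgM.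
Qed.

Lemma ccvg_real (u : nat -> R) (l : R) : u @ \oo --> l ->
  ccvg (fun n => (u n)%:C) l%:C.
Proof. by move=> ul; split => //=; exact: cvg_cst. Qed.

Lemma ccvg_sqn u l : ccvg u l -> sqn (u n) @[n --> \oo] --> sqn l.
Proof.
by move=> [l1 l2]; apply: cvgD; rewrite expr2; under eq_fun do rewrite expr2;
  exact: cvgM.
Qed.

End ccvg.

(** * Integrals of complex powers over []0, L]] *)

Section Gamma.
Context {R : realType}.
Local Notation mu := (@lebesgue_measure R).
Implicit Types (x y L : R) (z w : R[i]) (n : nat).

(** Left ends of the form [L * expR (- n.+1%:R)] make the logarithm affine in [n], so that x^a
    becomes a constant times a geometric sequence. *)
Lemma rpow_seq (a L : R) : 0 < a -> 0 < L ->
  expR (a * ln (L * expR (- n.+1%:R))) @[n --> \oo] --> (0 : R).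
Proof.
move=> a0 L0.
rewrite [X in X @ _](_ : _ = fun n => expR (a * ln L) * expR (- a) * expR (- a) ^+ n).
  rewrite -[X in _ --> X](mulr0 (expR (a * ln L) * expR (- a))); apply: cvgMr.
  apply: cvg_expr; rewrite ger0_norm ?expR_ge0// -expR0 ltr_expR; lra.
apply/funext => n; rewrite lnM ?posrE ?expR_gt0// expRK mulrDr expRD -mulrA; congr (_ * _).
by rewrite -exprS -expRM_natl; congr expR; ring.
Qed.

Lemma itvocP L x : `]0, L]%classic x <-> 0 < x <= L.
Proof. by rewrite /= in_itv. Qed.

Lemma itvoyP x : `]0, +oo[%classic x <-> 0 < x.
Proof. by rewrite /= in_itv/= andbT. Qed.

Lemma exhaust_itvoc L : 0 < L ->
  [/\ forall n : nat, L * expR (- n.+1%:R) < L,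
    forall n m : nat, (n <= m)%N -> L * expR (- m.+1%:R) <= L * expR (- n.+1%:R) /\ L <= L &
    forall x, `]0, L]%classic x <-> exists n : nat, L * expR (- n.+1%:R) <= x <= L].
Proof.
move=> L0; split.
- move=> n; rewrite -[ltRHS]mulr1 ltr_pM2l// -[ltRHS]expR0 ltr_expR.
- move=> n m nm; rewrite ler_pM2l// ler_expR lerN2 ler_nat ltnS nm.
  by split.
- move=> x; rewrite itvocP; split.
    move=> /andP[x0 xL].
    have [n hn] : exists n : nat, - ln (x / L) <= n%:R.
      by exists (Num.truncn `|- ln (x / L)|).+1;
        rewrite (le_trans (ler_norm _))// ltW// truncnS_gt.
    exists n; rewrite xL andbT mulrC -ler_pdivlMr//.
    rewrite -[leRHS](@lnK R) ?posrE ?divr_gt0// ler_expR lerNl (le_trans hn)//.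
    by rewrite ler_nat.
  by move=> [n /andP[h1 ->]]; rewrite andbT (lt_le_trans _ h1)// mulr_gt0// expR_gt0.
Qed.

Lemma integral_rpow (a L : R) : 0 < a -> 0 < L ->
  (\int[mu]_(x in `]0%R, L]) (expR ((a - 1) * ln x))%:E = (expR (a * ln L) / a)%:E)%E.
Proof.
move=> a0 L0; have [h1 h2 h3] := exhaust_itvoc L0.
pose G x := a^-1 * complex.Re (cpow x a%:C).
have GE x : G x = expR (a * ln x) / a by rewrite /G cpow_real /= mulrC.
have gE x : expR ((a - 1) * ln x) = a^-1 * complex.Re (a%:C * cpow x (a%:C - 1)).
  have -> : a%:C - 1 = (a - 1)%:C by rewrite rmorphB rmorph1.
  rewrite cpow_real ReM !ReC !ImC; field; lra.
rewrite -[_ / _]subr0 -GE.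
under eq_integral do rewrite gE.
apply: (@ge0_FTC_exhaust _ _ G _ _ _ _ _ h1 h2 h3).
- move=> x /itvocP /andP[x0 _].
  exact: (@is_deriveZ _ _ _ (fun t => complex.Re (cpow t a%:C)) a^-1 _ _ _ (is_derive_Re_cpow
    _ x0)).
- move=> x /itvocP /andP[x0 _]; apply: cvgM; first exact: cvg_cst.
  exact: (cpow_continuous _ _ x0).1.
- under eq_fun do rewrite GE.
  by rewrite -(mul0r a^-1); apply: cvgMl; exact: rpow_seq.
- exact: cvg_cst.
- by move=> x _; rewrite -gE expR_ge0.
Qed.

Lemma integrable_rpow (a L : R) : 0 < a -> 0 < L ->
  mu.-integrable `]0, L] (fun x => (expR ((a - 1) * ln x))%:E).
Proof.
move=> a0 L0; apply/integrableP; split.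
  by apply/measurable_EFinP; exact: measurable_rpow.
under eq_integral do rewrite /= ger0_norm ?expR_ge0//.
by rewrite integral_rpow// ltry.
Qed.

Lemma cintegrable_cpow z L : 0 < complex.Re z -> 0 < L ->
  cintegrable mu `]0, L] (fun x => cpow x (z - 1)).
Proof.
move=> z0 L0; apply: (cintegrable_dominated _ _ _ _ (integrable_rpow z0 L0)) => //.
- exact: cmeasurable_cpow.
- by move=> x _; rewrite sqn_cpow ReD ReN.
Qed.

(** The primitive is x^z. Its boundary term at 0 vanishes because the oscillating factor is bounded
    and x^(Re z) tends to 0. *)
Lemma cintegral_cpow z L : 0 < complex.Re z -> 0 < L ->
  cintegral mu `]0, L] (fun x => cpow x (z - 1)) = cpow L z / z.
Proof.
move=> z0 L0; have [h1 h2 h3] := exhaust_itvoc L0.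
have zn0 : z != 0 by apply/negP => /eqP e; move: z0; rewrite e ltxx.
apply: (mulfI zn0); rewrite mulrCA mulfV// mulr1.
rewrite -cintegralZ//; last exact: cintegrable_cpow.
have mI : measurable (`]0, L]%classic : set (measurableTypeR R)) by [].
have [i1 i2] := cintegrableZ z mI (cintegrable_cpow z0 L0).
have bnd (t : R) (u : R) : `|u| <= 1 -> `|expR t * u| <= expR t.
  by move=> u1; rewrite normrM ger0_norm ?expR_ge0// -[leRHS]mulr1 ler_pM2l ?expR_gt0.
have c1 : `|cos (complex.Im z * ln (L * expR (- n.+1%:R)))| * 0 @[n --> \oo] --> (0 : R).
  by under eq_fun do rewrite mulr0; exact: cvg_cst.
apply: eq_complexP.
  rewrite -[RHS]subr0; apply: (FTC_exhaust h1 h2 h3 _ _ _ _ i1).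
  - by move=> x /itvocP /andP[x0 _]; exact: is_derive_Re_cpow.
  - by move=> x /itvocP /andP[x0 _]; exact: (cpow_continuous _ _ x0).1.
  - under eq_fun do rewrite Re_cpow.
    apply/norm_cvg0P; apply: (squeeze_cvgr _ (cvg_cst 0) (rpow_seq z0 L0)).
    by apply: nearW => n; rewrite normr_ge0 bnd// cos_max.
  - exact: cvg_cst.
rewrite -[RHS]subr0; apply: (FTC_exhaust h1 h2 h3 _ _ _ _ i2).
- by move=> x /itvocP /andP[x0 _]; exact: is_derive_Im_cpow.
- by move=> x /itvocP /andP[x0 _]; exact: (cpow_continuous _ _ x0).2.
- under eq_fun do rewrite Im_cpow.
  apply/norm_cvg0P; apply: (squeeze_cvgr _ (cvg_cst 0) (rpow_seq z0 L0)).
  by apply: nearW => n; rewrite normr_ge0 bnd// sin_max.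
- exact: cvg_cst.
Qed.

End Gamma.

(** * Gauss's product and the Gamma function *)

Section Gauss.
Context {R : realType}.
Local Notation mu := (@lebesgue_measure R).
Implicit Types (x y L a : R) (z w : R[i]) (n : nat).

(** The rising factorial z (z + 1) ... (z + n - 1), the denominator in the definition of [Gamma]. *)
Definition rising n z : R[i] := \prod_(k < n) (z + k%:R).

Lemma risingSl n z : rising n.+1 z = z * rising n (z + 1).
Proof.
rewrite /rising big_ord_recl addr0; congr (_ * _); apply: eq_bigr => k _.
by rewrite lift0 -[in LHS]add1n natrD addrA.
Qed.

Lemma risingSr n z : rising n.+1 z = rising n z * (z + n%:R).
Proof. by rewrite /rising big_ord_recr. Qed.

Lemma neq0_Re z : 0 < complex.Re z -> z != 0.
Proof. by move=> h; apply/negP => /eqP e; move: h; rewrite e ltxx. Qed.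

Lemma rising_neq0 n z : 0 < complex.Re z -> rising n z != 0.
Proof.
move=> z0; apply/prodf_neq0 => k _; apply: neq0_Re.
by rewrite ReD Re_nat ltr_wpDr.
Qed.

(** A rescaled Beta integral. Splitting off one factor 1 - x/L expresses exponent n + 1 at z by
    exponent n at z and at z + 1, so induction replaces integration by parts. *)
Lemma cintegral_beta n z L : 0 < complex.Re z -> 0 < L ->
  cintegrable mu `]0, L] (fun x => ((1 - x / L) ^+ n)%:C * cpow x (z - 1)) /\
  cintegral mu `]0, L] (fun x => ((1 - x / L) ^+ n)%:C * cpow x (z - 1)) =
  cpow L z * (n`!)%:R / rising n.+1 z.
Proof.
move=> + L0; have mI : measurable (`]0, L]%classic : set (measurableTypeR R)) by [].
elim: n z => [|n IH] z z0.
  have -> : (fun x => ((1 - x / L) ^+ 0)%:C * cpow x (z - 1)) = cpow ^~ (z - 1).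
    by apply/funext => x; rewrite expr0 mul1r.
  split; first exact: cintegrable_cpow.
  by rewrite cintegral_cpow// mulr1 /rising big_ord_recl big_ord0 addr0 mulr1.
have z10 : 0 < complex.Re (z + 1) by rewrite ReD /=; lra.
have [i1 e1] := IH z z0; have [i2 e2] := IH (z + 1) z10.
have E x : `]0, L]%classic x -> ((1 - x / L) ^+ n.+1)%:C * cpow x (z - 1) =
   ((1 - x / L) ^+ n)%:C * cpow x (z - 1) +
   (- L^-1)%:C * (((1 - x / L) ^+ n)%:C * cpow x (z + 1 - 1)).
  move=> /itvocP /andP[x0 _].
  rewrite (addrAC z) cpowS// [in LHS]exprSr !rmorphM !rmorphN !rmorphB rmorph1 rmorphM; ring.
have i3 := cintegrableZ (- L^-1)%:C mI i2.
split.
  have [j1 j2] := i1; have [k1 k2] := i3; split.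
    move: (integrableD mI j1 k1); apply: eq_integrable => // x; rewrite inE => Dx.
    by rewrite (E _ Dx) ReD EFinD.
  move: (integrableD mI j2 k2); apply: eq_integrable => // x; rewrite inE => Dx.
  by rewrite (E _ Dx) ImD EFinD.
transitivity (cintegral mu `]0, L] (fun x => ((1 - x / L) ^+ n)%:C * cpow x (z - 1) +
   (- L^-1)%:C * (((1 - x / L) ^+ n)%:C * cpow x (z + 1 - 1)))).
  exact: (eq_cintegral mu E).
rewrite cintegralD// cintegralZ// e1 e2 cpowS//.
rewrite [rising n.+1 (z + 1)]risingSr [rising n.+2 z]risingSl.
rewrite [rising n.+1 z]risingSl [rising n.+1 (z+1)]risingSr.
have r0 := rising_neq0 n z10.
have zn0 := neq0_Re z0.
have zn : z + 1 + n%:R != 0.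
  by apply: neq0_Re; rewrite ReD Re_nat ltr_wpDr.
have LC : L%:C != 0 :> R[i] by rewrite eq_complex /= (gt_eqF L0).
rewrite factS natrM -natr1 rmorphN fmorphV.
by field; rewrite zn zn0 r0 LC.
Qed.

Lemma pow_le_expRN n x : 0 <= x <= n.+1%:R -> (1 - x / n.+1%:R) ^+ n.+1 <= expR (- x).
Proof.
move=> /andP[x0 xn].
have n0 : (0 : R) < n.+1%:R by [].
have -> : - x = n.+1%:R * (- (x / n.+1%:R)) by field; lra.
rewrite expRM_natl lerXn2r// ?nnegrE ?expR_ge0//.
  by rewrite subr_ge0 ler_pdivrMr// mul1r.
exact: expR_ge1Dx.
Qed.

Lemma bernoulli_ineq n (t : R) : 0 <= t <= 1 -> 1 - n%:R * t <= (1 - t) ^+ n.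
Proof.
move=> /andP[t0 t1]; elim: n => [|n IH]; first by rewrite mul0r subr0 expr0.
rewrite exprSr.
have h : (1 - n%:R * t) * (1 - t) <= (1 - t) ^+ n * (1 - t) by rewrite ler_wpM2r// subr_ge0.
apply: le_trans h; rewrite -natr1.
have : 0 <= n%:R * (t * t) by rewrite mulr_ge0// mulr_ge0.
nra.
Qed.

(** With t = x/N, multiply by (1 + t)^N <= e^x and apply Bernoulli's inequality to (1 - t^2)^N. *)
Lemma pow_ge_expRN n x : 0 <= x <= n.+1%:R ->
  expR (- x) * (1 - x ^+ 2 / n.+1%:R) <= (1 - x / n.+1%:R) ^+ n.+1.
Proof.
move=> /andP[x0 xn]; set N : R := n.+1%:R.
have n0 : (0 : R) < N by [].
have t01 : 0 <= x / N <= 1 by rewrite divr_ge0//= ler_pdivrMr// mul1r.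
set t := x / N.
have xE : x = N * t by rewrite /t; field; lra.
have {}t01 : 0 <= t /\ t <= 1 by apply/andP.
have h1 : (1 + t) ^+ n.+1 <= expR x.
  rewrite {1}xE expRM_natl lerXn2r// ?nnegrE ?expR_ge0 ?expR_ge1Dx//.
  lra.
have h2 : 1 - x ^+ 2 / N <= (1 + t) ^+ n.+1 * (1 - t) ^+ n.+1.
  rewrite -exprMn.
  have -> : (1 + t) * (1 - t) = 1 - t ^+ 2 by ring.
  have -> : x ^+ 2 / N = N * t ^+ 2 by rewrite xE; field; lra.
  by apply: bernoulli_ineq; rewrite sqr_ge0/= exprn_ile1//; lra.
have h3 : 0 <= (1 - t) ^+ n.+1 by rewrite exprn_ge0//; lra.
rewrite expRN mulrC ler_pdivrMr ?expR_gt0// (le_trans h2)// mulrC.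
by rewrite ler_wpM2l.
Qed.

Lemma cvg_pow_expRN x : 0 < x ->
  (1 - x / n.+1%:R) ^+ n.+1 @[n --> \oo] --> expR (- x).
Proof.
move=> x0.
have h : expR (- x) * (1 - x ^+ 2 / n.+1%:R) @[n --> \oo] --> expR (- x).
  rewrite -[X in _ --> X]mulr1; apply: cvgMr; rewrite -[X in _ --> X]subr0.
  apply: cvgB; first exact: cvg_cst.
  by rewrite -(mulr0 (x ^+ 2)); apply: cvgMr; exact: cvg_harmonic.
apply: (squeeze_cvgr _ h (cvg_cst _)).
exists (Num.truncn x).+1 => // n /= hn.
have xn : 0 <= x <= n.+1%:R.
  rewrite ltW//= (le_trans (ltW (truncnS_gt _)))// ler_nat.
  exact: leq_trans hn _.
by rewrite pow_le_expRN// pow_ge_expRN.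
Qed.

End Gauss.

Section Gauss_limit.
Context {R : realType}.
Local Notation mu := (@lebesgue_measure R).
Local Notation pos := (`]0%R, +oo[%classic : set (measurableTypeR R)).
Implicit Types (x y L a : R) (z w : R[i]) (n : nat).

Lemma rpow_expRN_le (a : R) : exists2 K, 0 < K & forall x, 1 < x ->
  expR (a * ln x) * expR (- x) <= K * expR (- (1/2) * x).
Proof.
(* Any positive k >= 2|a| would do: ln x <= x/k + ln k then gives a ln x <= x/2 + |a| ln k. *)
pose k := 2 * `|a| + 1.
have k0 : 0 < k by rewrite /k; have := normr_ge0 a; lra.
exists (expR (`|a| * ln k)); first exact: expR_gt0.
move=> x x1; rewrite -!expRD ler_expR.
have lx0 : 0 <= ln x by rewrite ln_ge0// ltW.
have h1 : a * ln x <= `|a| * ln x by rewrite ler_wpM2r// ler_norm.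
have h2 : ln x <= x / k + ln k.
  have -> : ln x = ln (x / k) + ln k.
    by rewrite -lnM ?posrE ?divr_gt0//; [congr ln; field; lra|lra].
  rewrite lerD2r; have := @le_ln1Dx R (x / k - 1).
  rewrite addrCA subrr addr0 => h; apply: le_trans (h _) _; last lra.
  by rewrite ltrBrDl subrr divr_gt0//; lra.
have h3 : `|a| * ln x <= `|a| * (x / k + ln k) by rewrite ler_wpM2l.
have h4 : `|a| * (x / k) <= (1/2) * x.
  rewrite mulrA ler_pdivrMr// /k.
  have := normr_ge0 a; nra.
lra.
Qed.

Lemma integrable_gamma a : 0 < a ->
  mu.-integrable `]0, +oo[ (fun x => (expR ((a - 1) * ln x) * expR (- x))%:E).
Proof.
move=> a0.
have [K K0 hK] := rpow_expRN_le (a - 1).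
have mE : measurable_fun setT (fun x : R => expR (- x)).
  by apply: measurableT_comp; first exact: measurable_expR.
(* A majorant on each side of 1. The exponential density of rate 1/2 carries a factor 1/2,
   compensated by [2 * K]. *)
pose g x := (fun x => expR ((a - 1) * ln x)) \_ `]0, 1]%classic x +
            (2 * K) * exponential_pdf (1/2) x.
have mI : measurable (`]0, +oo[%classic : set (measurableTypeR R)) by [].
have half0 : 0 < 1 / 2 :> R by lra.
have ig : mu.-integrable `]0, +oo[ (EFin \o g).
  have i1 : mu.-integrable `]0, +oo[ (EFin \o (fun x => expR ((a - 1) * ln x)) \_ `]0,
    1]%classic).
    rewrite -restrict_EFin; apply/integrable_restrict => //.
    rewrite setIidr; last by move=> x/=; rewrite !in_itv/= => /andP[->].
    exact: integrable_rpow.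
  have i2 : mu.-integrable `]0, +oo[ (EFin \o exponential_pdf (1/2 : R)).
    by apply: integrableS (integrable_exponential_pdf half0).
  have i3 := integrableZl mI (2 * K) i2.
  exact: (integrableD mI i1 i3).
apply: (integrable_dominated _ _ _ ig) => //.
  by apply: measurable_funM; [exact: measurable_rpow|exact: measurable_funTS].
move=> x /itvoyP x0; rewrite ger0_norm ?mulr_ge0 ?expR_ge0// /g patchE.
rewrite exponential_pdfE; last exact: ltW.
have e0 := expR_gt0 (- (1 / 2) * x).
case: ifPn => [_|].
  have h1 : expR (- x) <= 1 by rewrite -expR0 ler_expR oppr_le0 ltW.
  have h2 := expR_ge0 ((a - 1) * ln x).
  have h3 : expR ((a - 1) * ln x) * expR (- x) <= expR ((a - 1) * ln x).
    by rewrite -[leRHS]mulr1 ler_wpM2l.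
  have : 0 <= K * expR (- (1 / 2) * x) by rewrite mulr_ge0// ltW.
  lra.
rewrite notin_setE => h; have x1 : 1 < x.
  by rewrite ltNge; apply/negP => x1; apply: h; apply/itvocP; rewrite x0.
rewrite /= add0r mulrA (_ : 2 * K * (1 / 2) = K); last by field.
exact: hK.
Qed.

(** Gauss's N^z N! / (z (z + 1) ... (z + N)) at N = [n.+1]; the shift keeps N positive, and the
    denominator has N + 1 = [n.+2] factors. *)
Definition gauss_seq n z : R[i] :=
  cpow n.+1%:R z * (n.+1`!)%:R / rising n.+2 z.

Lemma cintegral_indic (D E : set R) (f : R -> R[i]) :
  cintegral mu D (fun x => (\1_E x)%:C * f x) = cintegral mu (D `&` E) f.
Proof.
apply: eq_complexP; rewrite /cintegral/=.
  rewrite Rintegral_mkcondr; apply: eq_Rintegral => x _.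
  by rewrite ReM ReC ImC mul0r subr0 patchE indicE; case: ifP; rewrite ?(mul1r, mul0r).
rewrite Rintegral_mkcondr; apply: eq_Rintegral => x _.
by rewrite ImM ReC ImC mul0r addr0 patchE indicE; case: ifP; rewrite ?(mul1r, mul0r).
Qed.

Lemma ccvg_near u l (v : nat -> R[i]) : (\forall n \near \oo, u n = v n) -> ccvg u l -> ccvg v l.
Proof.
move=> uv [l1 l2]; split.
  by apply: cvg_trans l1; apply: near_eq_cvg; apply: filterS uv => n ->.
by apply: cvg_trans l2; apply: near_eq_cvg; apply: filterS uv => n ->.
Qed.

(** The Gauss quotients are the Beta integrals of (1 - x/N)^N x^(z-1) over []0, N]]. Extended by 0,
    these integrands converge to Euler's integrand and are dominated by its modulus. *)
Lemma gauss_limit z : 0 < complex.Re z -> ccvg (gauss_seq ^~ z) (Gamma_integral z).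
Proof.
move=> z0.
have mI : measurable (`]0, +oo[%classic : set (measurableTypeR R)) by [].
pose h n x := ((1 - x / n.+1%:R) ^+ n.+1)%:C * cpow x (z - 1).
pose f_ n x := (\1_(`]0, n.+1%:R]%classic) x)%:C * h n x.
have mf_ n : cmeasurable pos (f_ n).
  apply: cmeasurableM; first by apply: cmeasurable_real; exact: measurable_funTS.
  apply: cmeasurableM; last exact: cmeasurable_cpow.
  apply: cmeasurable_real; apply: measurable_funTS.
  by apply: measurable_funX; apply: measurable_funB => //; apply: measurable_funM.
have fE n : cintegral mu pos (f_ n) = gauss_seq n z.
  rewrite cintegral_indic setIidr; last by move=> x/=; rewrite !in_itv/= => /andP[->].
  by rewrite /gauss_seq; have [_ ->] := cintegral_beta n.+1 z0 (ltr0Sn R n).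
have cf x : `]0, +oo[%classic x -> ccvg (f_ ^~ x) (cpow x (z - 1) * (expR (- x))%:C).
  move=> /itvoyP x0.
  apply: (@ccvg_near (fun n => cpow x (z - 1) * ((1 - x / n.+1%:R) ^+ n.+1)%:C)).
    exists (Num.truncn x).+1 => // n /= hn.
    rewrite /f_ /h indicE mem_set ?mul1r 1?mulrC//.
    apply/itvocP; rewrite x0 (le_trans (ltW (truncnS_gt _)))// ler_nat.
    exact: leq_trans hn _.
  by apply: ccvgM; [exact: ccvg_cst|apply: ccvg_real; exact: cvg_pow_expRN].
have [||||h1 h2] := @cintegral_dominated_cvg _ _ _ mu pos f_
   (fun x => cpow x (z - 1) * (expR (- x))%:C)
   (fun x => expR ((complex.Re z - 1) * ln x) * expR (- x)) mI mf_ _ _ _ _ (integrable_gamma z0).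
- by move=> x Dx; exact: (cf x Dx).1.
- by move=> x Dx; exact: (cf x Dx).2.
- move=> n x /itvoyP x0; rewrite /f_ indicE; case: (boolP (x \in _)) => xn; last first.
    by rewrite mul0r sqnC expr0n sqr_ge0.
  rewrite mul1r /h sqnM sqn_cpow sqnC ReD ReN /= mulrC exprMn ler_wpM2l ?sqr_ge0//.
  move: xn; rewrite inE => /itvocP/andP[_ xn].
  have xn' : 0 <= x <= n.+1%:R by rewrite ltW.
  rewrite lerXn2r// ?nnegrE ?expR_ge0//; last exact: pow_le_expRN.
  by rewrite exprn_ge0// subr_ge0 ler_pdivrMr// mul1r.
- by move=> x _; rewrite mulr_ge0 ?expR_ge0.
by split; [under eq_fun do rewrite -fE|under eq_fun do rewrite -fE].
Qed.

(** Read off Gauss's quotients g_N: with N = [n.+1], z g_N(z) = g_N(z + 1) (1 + (z + 1)/N), and the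
    last factor tends to 1. *)
Lemma Gamma_integralS z : 0 < complex.Re z ->
  Gamma_integral (z + 1) = z * Gamma_integral z.
Proof.
move=> z0.
have z10 : 0 < complex.Re (z + 1) by rewrite ReD /=; lra.
have h1 := gauss_limit z0; have h2 := gauss_limit z10.
have h3 : ccvg (fun n => z * gauss_seq n z) (z * Gamma_integral z).
  by apply: ccvgM h1; exact: ccvg_cst.
have h4 : ccvg (fun n => gauss_seq n (z + 1) + (n.+1%:R^-1)%:C * ((z + 1) * gauss_seq n (z + 1)))
    (Gamma_integral (z + 1) + 0%:C * ((z + 1) * Gamma_integral (z + 1))).
  apply: (ccvgD h2); apply: ccvgM; last by apply: (ccvgM _ h2); exact: ccvg_cst.
  by apply: ccvg_real; exact: cvg_harmonic.
rewrite -[LHS]addr0 -[X in _ + X](mul0r ((z + 1) * Gamma_integral (z + 1))).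
apply: (ccvg_unique h4); apply: ccvg_near h3; apply: nearW => n.
rewrite /gauss_seq cpowS// [rising n.+2 (z + 1)]risingSr [rising n.+2 z]risingSl.
have r0 := rising_neq0 n.+1 z10.
have zn0 := neq0_Re z0.
have zn : z + 1 + n.+1%:R != 0.
  by apply: neq0_Re; rewrite ReD Re_nat ltr_wpDr.
have nC : n.+1%:R != 0 :> R[i] by rewrite pnatr_eq0.
rewrite fmorphV !rmorph_nat.
move: (n.+1%:R : R[i]) (rising n.+1 (z + 1)) zn nC r0 => N r zn nC r0.
by field; rewrite zn zn0 r0 nC.
Qed.

Lemma Gamma_integral_addn z n : 0 < complex.Re z ->
  Gamma_integral (z + n%:R) = rising n z * Gamma_integral z.
Proof.
move=> z0; elim: n => [|n IH]; first by rewrite addr0 /rising big_ord0 mul1r.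
rewrite -natr1 addrA Gamma_integralS ?IH; last by rewrite ReD Re_nat ltr_wpDr.
by rewrite risingSr; ring.
Qed.

(** In this half-plane 0 is the only pole and one step of the functional equation suffices. The
    Gamma factors of chi are evaluated on the selected lines in this region. *)
Lemma GammaE z : - 1 < complex.Re z -> z != 0 ->
  Gamma z = Gamma_integral (z + 1) / z.
Proof.
move=> z1 zn0; rewrite /Gamma -/(rising _ z).
have [z0|z0] := ltP 0 (complex.Re z).
  rewrite Gamma_integral_addn// Gamma_integralS//.
  by field; rewrite zn0 rising_neq0.
(* For -1 < Re z <= 0 the definition of [Gamma] shifts by exactly one. *)
have -> : Num.truncn `|complex.Re z| = 0%N.
  apply/truncn0Pn; rewrite -ltNge ler0_norm//; lra.
by rewrite /rising big_ord_recl big_ord0 addr0 mulr1.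
Qed.

Definition rgamma a := complex.Re (Gamma_integral a%:C).

Lemma Gamma_integral_realE a : Gamma_integral a%:C =
  cintegral mu pos (fun x => (expR ((a - 1) * ln x) * expR (- x))%:C).
Proof.
apply: (eq_cintegral mu) => x _.
rewrite -/(cpow x _) (_ : a%:C - 1 = (a - 1)%:C); last by rewrite rmorphB rmorph1.
by rewrite cpow_real -rmorphM.
Qed.

(** On []0, 1]] the integrand is at least e^(-1) x^(a-1), whose integral is e^(-1) / a. *)
Lemma rgamma_gt0 a : 0 < a -> 0 < rgamma a.
Proof.
move=> a0.
have mI : measurable (`]0, +oo[%classic : set (measurableTypeR R)) by [].
have E : rgamma a = \int[mu]_(x in `]0, +oo[) (expR ((a - 1) * ln x) * expR (- x)).
  by rewrite /rgamma Gamma_integral_realE.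
rewrite E.
have ig := integrable_gamma a0.
have iE : (\int[mu]_(x in `]0%R, +oo[) (expR ((a - 1) * ln x) * expR (- x))%:E =
    (\int[mu]_(x in `]0, +oo[) (expR ((a - 1) * ln x) * expR (- x)))%R%:E)%E.
  by rewrite /Rintegral fineK//; exact: integrable_fin_num.
have mf (D : set R) : measurable_fun D (fun x => (expR ((a - 1) * ln x) * expR (- x))%:E).
  apply/measurable_EFinP; apply: measurable_funM; first exact: measurable_rpow.
  by apply: measurable_funTS; apply: measurableT_comp; first exact: measurable_expR.
have e1 : 0 < expR (- 1) :> R by exact: expR_gt0.
suff h : ((expR (-1) * (expR (a * ln 1) / a))%:E <= (\int[mu]_(x in `]0,
  +oo[) (expR ((a - 1) * ln x) * expR (- x)))%R%:E)%E.
  rewrite lee_fin in h; apply: lt_le_trans h.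
  by rewrite mulr_gt0// divr_gt0// expR_gt0.
rewrite -iE EFinM -integral_rpow// -ge0_integralZl//.
2: by apply/measurable_EFinP; exact: measurable_rpow.
apply: (@le_trans _ _ (\int[mu]_(x in `]0%R, 1%R]) (expR ((a - 1) * ln x) * expR (- x))%:E)%E).
  apply: ge0_le_integral => //.
  - by apply: measurable_funeM; apply/measurable_EFinP; exact: measurable_rpow.
  - exact: mf.
  - move=> x /itvocP /andP[x0 x1]; rewrite -EFinM lee_fin mulrC ler_wpM2l ?expR_ge0//.
    by rewrite ler_expR lerN2.
apply: ge0_subset_integral => //.
- exact: mf.
- by move=> x/=; rewrite !in_itv/= => /andP[->].
Qed.

Lemma Gamma_integral_real a : Gamma_integral a%:C = (rgamma a)%:C.
Proof.
rewrite /rgamma Gamma_integral_realE; apply: eq_complexP => //=.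
by rewrite Rintegral_cst// mul0r.
Qed.

End Gauss_limit.

(** * Decay of ratios of Gamma functions *)

Section ratio.
Context {R : realType}.
Implicit Types (s x y a b : R) (z w : R[i]) (n : nat).

(* By Gauss's product, |Gamma (a + i y)|^2 / Gamma a ^ 2 is the infinite product
   of the sq_ratio (a + k) y. *)
Definition sq_ratio s y : R := s ^+ 2 / (s ^+ 2 + y ^+ 2).

Lemma sq_ratio_denom s y : 0 < s -> 0 < s ^+ 2 + y ^+ 2.
Proof. by move=> s0; rewrite ltr_wpDr ?sqr_ge0// exprn_gt0. Qed.

Lemma sq_ratio_gt0 s y : 0 < s -> 0 < sq_ratio s y.
Proof. by move=> s0; rewrite divr_gt0 ?exprn_gt0// sq_ratio_denom. Qed.

Lemma sq_ratio_le s t y : 0 < s -> s <= t -> sq_ratio s y <= sq_ratio t y.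
Proof.
move=> s0 st; have t0 : 0 < t by lra.
rewrite ler_pdivrMr ?sq_ratio_denom// mulrAC ler_pdivlMr ?sq_ratio_denom// !mulrDr mulrC lerD2l.
by rewrite ler_wpM2r ?sqr_ge0// lerXn2r// nnegrE ltW.
Qed.

Lemma sq_ratio_decay s y : 0 < s -> sq_ratio s y <= (1 + s ^+ 2) / (1 + y ^+ 2).
Proof.
move=> s0; have y0 : 0 < 1 + y ^+ 2 by have := sqr_ge0 y; lra.
rewrite ler_pdivrMr ?sq_ratio_denom// mulrAC ler_pdivlMr//.
have := sqr_ge0 y; have := sqr_ge0 s; have := sqr_ge0 (s ^+ 2); nra.
Qed.

Lemma sq_ratio_scale b s y : 0 < b -> sq_ratio (b * s) (b * y) = sq_ratio s y.
Proof.
move=> b0; rewrite /sq_ratio !exprMn -mulrDr -mulf_div divff ?mul1r//.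
by rewrite sqrf_eq0 gt_eqF.
Qed.

(** From 1 + v <= e^v with v = y^2/s^2, and 1/s^2 <= 1/(s (s - 1)). The exponent is written as a
    difference so that products over s, s + 1, ... telescope. *)
Lemma sq_ratio_ge s y : 1 < s -> expR (- y ^+ 2 * ((s - 1)^-1 - s^-1)) <= sq_ratio s y.
Proof.
move=> s1; have s0 : 0 < s by lra.
have -> : sq_ratio s y = (1 + y ^+ 2 / s ^+ 2)^-1.
  by rewrite /sq_ratio -invf_div mulrDl mulfV// sqrf_eq0 gt_eqF.
rewrite mulNr expRN lef_pV2 ?posrE ?expR_gt0//; last first.
  by rewrite ltr_wpDr// divr_ge0// sqr_ge0.
apply: le_trans (expR_ge1Dx _) _; rewrite ler_expR ler_wpM2l ?sqr_ge0//.
have -> : (s - 1)^-1 - s^-1 = (s * (s - 1))^-1 by field; lra.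
rewrite lef_pV2 ?posrE ?exprn_gt0// ?mulr_gt0//; nra.
Qed.

(** The factor at [a] stays apart since the telescoping bound requires s > 1; every later a + k
    satisfies this. *)
Lemma prod_sq_ratio_ge a y n : 0 < a ->
  sq_ratio a y * expR (- y ^+ 2 * (a^-1 - (a + n%:R)^-1)) <= \prod_(k < n.+1) sq_ratio (a +
    k%:R) y.
Proof.
move=> a0; elim: n => [|n IH].
  by rewrite big_ord_recl big_ord0 addr0 subrr mulr0 expR0.
rewrite big_ord_recr /=.
have n0 : 0 <= n%:R :> R by [].
have s1 : 1 < a + n.+1%:R by rewrite -natr1; lra.
have p1 : 0 <= sq_ratio a y * expR (- y ^+ 2 * (a^-1 - (a + n%:R)^-1)).
  by rewrite mulr_ge0 ?expR_ge0// ltW// sq_ratio_gt0.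
apply: le_trans (ler_pM p1 (expR_ge0 _) IH (sq_ratio_ge y s1)).
rewrite (_ : a + n.+1%:R - 1 = a + n%:R); last by rewrite -natr1; ring.
by rewrite -[leRHS]mulrA -expRD -mulrDr addrA subrK.
Qed.

Lemma prod_sq_ratio_lb a y n : 0 < a ->
  sq_ratio a y * expR (- y ^+ 2 * a^-1) <= \prod_(k < n.+1) sq_ratio (a + k%:R) y.
Proof.
move=> a0; apply: le_trans (prod_sq_ratio_ge y n a0).
apply: ler_wpM2l; first exact/ltW/sq_ratio_gt0.
rewrite ler_expR !mulNr lerN2 ler_wpM2l ?sqr_ge0//.
by rewrite lerBlDr lerDl invr_ge0 addr_ge0// ltW.
Qed.

(** Divide the Gauss quotients at z and at Re z: powers and factorials have the same modulus and
    cancel. [gauss_seq n] leaves n + 2 factors, hence the shift by 2 in the proof. *)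
Lemma cvg_prod_sq_ratio z : 0 < complex.Re z ->
  \prod_(k < n) sq_ratio (complex.Re z + k%:R) (complex.Im z) @[n --> \oo] -->
  sqn (Gamma_integral z) / rgamma (complex.Re z) ^+ 2.
Proof.
set a := complex.Re z; set y := complex.Im z => a0.
have aC0 : 0 < complex.Re a%:C by [].
have h1 := ccvg_sqn (gauss_limit a0); have h2 := ccvg_sqn (gauss_limit aC0).
rewrite Gamma_integral_real sqnC in h2.
have g0 : rgamma a ^+ 2 != 0 by rewrite sqrf_eq0 gt_eqF// rgamma_gt0.
have h3 : sqn (gauss_seq n z) / sqn (gauss_seq n a%:C) @[n --> \oo] -->
    sqn (Gamma_integral z) / rgamma a ^+ 2 := cvgM h1 (cvgV g0 h2).
suff h : \prod_(k < n + 2) sq_ratio (a + k%:R) y @[n --> \oo] --> sqn (Gamma_integral z) /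
  rgamma a ^+ 2.
  by rewrite -(cvg_shiftn 2).
suff E n : \prod_(k < n + 2) sq_ratio (a + k%:R) y = sqn (gauss_seq n z) / sqn (gauss_seq n a%:C).
  by under eq_fun do rewrite E; exact: h3.
have sE w : sqn (gauss_seq n w) = expR (complex.Re w * ln n.+1%:R) ^+ 2 * sqn (n.+1`!)%:R /
    \prod_(k < n.+2) sqn (w + k%:R).
  by rewrite /gauss_seq sqnM sqnM sqnV sqn_cpow /rising sqn_prod.
rewrite addn2 !sE.
have e0 (t : R) : expR t ^+ 2 != 0 by rewrite sqrf_eq0 gt_eqF ?expR_gt0.
have f0 : sqn (n.+1`!)%:R != 0 :> R by rewrite sqn_eq0 pnatr_eq0 -lt0n fact_gt0.
have p0 (w : R[i]) : 0 < complex.Re w -> \prod_(k < n.+2) sqn (w + k%:R) != 0.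
  move=> w0; apply/prodf_neq0 => k _; rewrite sqn_eq0; apply: neq0_Re.
  by rewrite ReD Re_nat ltr_wpDr.
have -> : \prod_(k < n.+2) sq_ratio (a + k%:R) y =
   \prod_(k < n.+2) sqn (a%:C + k%:R) / \prod_(k < n.+2) sqn (z + k%:R).
  rewrite -prodf_div; apply: eq_bigr => k _.
  by rewrite /sq_ratio /sqn !ReD !ImD !Re_nat !Im_nat !addr0 /= expr0n addr0.
have pz := p0 _ a0; have pa := p0 _ aC0.
rewrite ReC -/a.
move: (expR _ ^+ 2) (e0 (a * ln n.+1%:R)) (sqn _) f0 (\prod_(k < n.+2) sqn (a%:C + k%:R)) pa
  (\prod_(k < n.+2) sqn (z + k%:R)) pz => A A0 B B0 P P0 Q Q0.
by field; rewrite A0 B0 P0 Q0.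
Qed.

(** The partial products are bounded below by a positive number that does not depend on their
    length. This permits the division by Gamma(1 + u) in the moment formula. *)
Lemma Gamma_integral_neq0 z : 0 < complex.Re z -> Gamma_integral z != 0.
Proof.
move=> z0; rewrite -sqn_eq0.
have h := cvg_prod_sq_ratio z0.
have lb : sq_ratio (complex.Re z) (complex.Im z) * expR (- complex.Im z ^+ 2 * (complex.Re
  z)^-1) <=
   sqn (Gamma_integral z) / rgamma (complex.Re z) ^+ 2.
  apply: (ler_cvg_to (cvg_cst _) h); exists 1%N => // -[//|n] _.
  exact: prod_sq_ratio_lb.
have g0 := rgamma_gt0 z0.
rewrite gt_eqF//.
rewrite -(pmulr_lgt0 _ (_ : 0 < (rgamma (complex.Re z) ^+ 2)^-1)) ?invr_gt0 ?exprn_gt0//.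
by apply: lt_le_trans lb; rewrite mulr_gt0 ?expR_gt0// sq_ratio_gt0.
Qed.

(* Two factors of the product on the left pay for the quadratic decay; the
   remaining ones are compared with a shift of two indices, which is possible
   because b (k + 3) <= k + 1 for large k. *)
Lemma prod_sq_ratio_scaled (b x : R) : 0 < b < 1 -> - b < x ->
  exists2 K, 0 < K & forall y, exists N, forall n, (N <= n)%N ->
  \prod_(k < n.+2) sq_ratio (x + b * k.+1%:R) y <=
  (K / (1 + y ^+ 2)) ^+ 2 * \prod_(k < n) sq_ratio (x + k.+1%:R) y.
Proof.
move=> /andP[b0 b1] xb.
(* The condition means b (N + 2) <= N; it yields b (n + 3) <= n + 1 for all n >= N. *)
have [N hN] : exists N : nat, 2 * b / (1 - b) <= N%:R.
  exists (Num.truncn `|2 * b / (1 - b)|).+1.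
  by rewrite (le_trans (ler_norm _))// ltW// truncnS_gt.
have k1 (k : nat) : 1 <= k.+1%:R :> R by rewrite ler1n.
have s0 (k : nat) : 0 < x + b * k.+1%:R.
  have : 0 <= b * (k.+1%:R - 1) by rewrite mulr_ge0 ?subr_ge0// ltW.
  lra.
have s0' (k : nat) : 0 < x + k.+1%:R by have := k1 k; lra.
have r0 (k : nat) t : 0 <= sq_ratio (x + b * k.+1%:R) t by exact/ltW/sq_ratio_gt0/s0.
have r0' (k : nat) t : 0 <= sq_ratio (x + k.+1%:R) t by exact/ltW/sq_ratio_gt0/s0'.
pose s k : R := x + b * k.+1%:R.
pose K := (1 + s N ^+ 2) + (1 + s N.+1 ^+ 2).
have K1 (k : nat) y : k = N \/ k = N.+1 -> sq_ratio (s k) y <= K / (1 + y ^+ 2).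
  move=> hk; apply: le_trans (sq_ratio_decay y (s0 k)) _.
  apply: ler_wpM2r; first by rewrite invr_ge0; have := sqr_ge0 y; lra.
  by case: hk => ->; rewrite /K ?lerDl ?lerDr addr_ge0// sqr_ge0.
exists K; first by rewrite /K -addrA ltr_wpDr// !addr_ge0// sqr_ge0.
move=> y; exists N; elim=> [|n IH].
  rewrite leqn0 => /eqP N0; rewrite !big_ord_recr !big_ord0 /= mul1r [leRHS]mulr1 expr2.
  by apply: ler_pM; [exact: r0|exact: r0|
    apply: (K1 0%N); left; rewrite N0|apply: (K1 1%N); right; rewrite N0].
rewrite leq_eqVlt => /predU1P[NE|]; last first.
  rewrite ltnS => Nn; rewrite big_ord_recr [in leRHS]big_ord_recr /= [leRHS]mulrA.
  apply: ler_pM; [|exact: r0|exact: IH|].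
    by apply: prodr_ge0 => k _; exact: r0.
  apply: sq_ratio_le; first exact: s0.
  rewrite lerD2l; move: hN; rewrite ler_pdivrMr ?subr_gt0// => hN.
  have : N%:R <= n%:R :> R by rewrite ler_nat.
  by rewrite -!natr1; nra.
(* The induction starts at N = [n.+1]: the factors of indices N and N + 1 supply the decay, and the
   N others are compared index by index, using b < 1. *)
rewrite big_ord_recr big_ord_recr /= -mulrA mulrC expr2.
apply: ler_pM.
- by rewrite mulr_ge0//; exact: r0.
- by apply: prodr_ge0 => k _; exact: r0.
- by apply: ler_pM; [exact: r0|exact: r0|
    apply: (K1 n.+1); left; rewrite NE|apply: (K1 n.+2); right; rewrite NE].
- apply: ler_prod => k _; rewrite r0 /=; apply: sq_ratio_le => //.
  by rewrite lerD2l; have := k1 k; nra.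
Qed.

(** Multiplying numerator and denominator of each factor by b^2 turns the factor of 1 + x/b + k at
    y/b into the factor of x + b (k + 1) at y. The previous comparison then passes to the limit. *)
Lemma Gamma_ratio (b x : R) : 0 < b < 1 -> - b < x ->
  exists2 K, 0 < K & forall y,
  sqn (Gamma_integral ((1 + x / b) +i* (y / b))) <=
  (K / (1 + y ^+ 2)) ^+ 2 * sqn (Gamma_integral ((1 + x) +i* y)).
Proof.
move=> b01 xb; have /andP[b0 b1] := b01.
have [K K0 hK] := prod_sq_ratio_scaled b01 xb.
have x1 : 0 < 1 + x by lra.
have xb1 : 0 < 1 + x / b by rewrite -[1](mulfV (lt0r_neq0 b0)) -mulrDl divr_gt0//; lra.
have g1 := rgamma_gt0 x1; have g2 := rgamma_gt0 xb1.
exists (K * (rgamma (1 + x / b) / rgamma (1 + x))); first by rewrite mulr_gt0// divr_gt0.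
move=> y; set z1 := _ +i* _; set z2 := _ +i* y.
have h1 : \prod_(k < n) sq_ratio (x + b * k.+1%:R) y @[n --> \oo] -->
    sqn (Gamma_integral z1) / rgamma (1 + x / b) ^+ 2.
  suff E1 n : \prod_(k < n) sq_ratio (x + b * k.+1%:R) y =
      \prod_(k < n) sq_ratio (complex.Re z1 + k%:R) (complex.Im z1).
    by under eq_fun do rewrite E1; exact: (@cvg_prod_sq_ratio z1 xb1).
  apply: eq_bigr => k _ /=; rewrite -natr1 -[RHS](@sq_ratio_scale b)//; congr sq_ratio.
    by field; lra.
  by field; lra.
have h2 : \prod_(k < n) sq_ratio (x + k.+1%:R) y @[n --> \oo] -->
    sqn (Gamma_integral z2) / rgamma (1 + x) ^+ 2.
  suff E2 n : \prod_(k < n) sq_ratio (x + k.+1%:R) y =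
      \prod_(k < n) sq_ratio (complex.Re z2 + k%:R) (complex.Im z2).
    by under eq_fun do rewrite E2; exact: (@cvg_prod_sq_ratio z2 x1).
  by apply: eq_bigr => k _ /=; congr sq_ratio; rewrite -natr1; ring.
have h1' : \prod_(k < n + 2) sq_ratio (x + b * k.+1%:R) y @[n --> \oo] -->
    sqn (Gamma_integral z1) / rgamma (1 + x / b) ^+ 2.
  by move: h1; rewrite -(cvg_shiftn 2).
have h3 : sqn (Gamma_integral z1) / rgamma (1 + x / b) ^+ 2 <=
  (K / (1 + y ^+ 2)) ^+ 2 * (sqn (Gamma_integral z2) / rgamma (1 + x) ^+ 2).
  have [N hN] := hK y.
  apply: (ler_cvg_to h1' (cvgMr h2)); exists N => // n /= Nn.
  by rewrite addn2; exact: hN.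
rewrite ler_pdivrMr ?exprn_gt0// in h3.
apply: le_trans h3 _; rewrite le_eqVlt; apply/orP; left; apply/eqP.
have y0 : 1 + y ^+ 2 != 0 by rewrite gt_eqF//; have := sqr_ge0 y; lra.
by field; rewrite y0 (gt_eqF g1).
Qed.

End ratio.

(** * Moments of a stable variable *)

Section law.
Local Open Scope ereal_scope.
Context d1 (T1 : measurableType d1) d2 (T2 : measurableType d2) (R : realType).
Variables (m1 : {measure set T1 -> \bar R}) (m2 : {measure set T2 -> \bar R}).
Variables (phi1 : T1 -> measurableTypeR R) (phi2 : T2 -> measurableTypeR R).
Hypotheses (mphi1 : measurable_fun setT phi1) (mphi2 : measurable_fun setT phi2).
Hypothesis m1oo : m1 setT < +oo.
Hypothesis rays : forall r : R,
  m1 (phi1 @^-1` `]r, +oo[) = m2 (phi2 @^-1` `]r, +oo[).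

Let pphi1 : {mfun T1 >-> measurableTypeR R} :=
  HB.pack phi1 (isMeasurableFun.Build _ _ _ _ _ mphi1).
Let pphi2 : {mfun T2 >-> measurableTypeR R} :=
  HB.pack phi2 (isMeasurableFun.Build _ _ _ _ _ mphi2).

(** The rays are stable under intersection and generate the Borel sets; the rays from -n exhaust the
    line and have finite mass by [m1oo], so the measures are determined by them. *)
Lemma measure_eq_law A : measurable A -> m1 (phi1 @^-1` A) = m2 (phi2 @^-1` A).
Proof.
move=> mA.
apply: (@measure_unique _ R (measurableTypeR R) (@RGenOInfty.G R) (fun n => `](- n%:R)%R,
  +oo[%classic)
  _ _ _ _ (pushforward m1 pphi1) (pushforward m2 pphi2)) => //.
- exact: RGenOInfty.measurableE.
- move=> _ _ [x ->] [y ->]; exists (Num.max x y).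
  by apply/seteqP; split => z /=; rewrite !in_itv/= !andbT gt_max => /andP.
- by move=> n; exists (- n%:R)%R.
- apply/seteqP; split=> // x _; exists (Num.truncn `|x|%R).+1 => //=.
  rewrite in_itv/= andbT ltrNl (le_lt_trans (ler_norm _))// normrN.
  exact: truncnS_gt.
- by move=> _ [x ->]; exact: rays.
- move=> n.
  have h : m1 (phi1 @^-1` `](- n%:R)%R, +oo[) <= m1 setT.
    apply: le_measure; rewrite ?inE//.
    by rewrite -[X in measurable X]setTI; exact: mphi1.
  exact: le_lt_trans h m1oo.
Qed.

Lemma ge0_integral_eq_law (f : R -> \bar R) : measurable_fun setT f ->
  (forall x, 0 <= f x) -> \int[m1]_x f (phi1 x) = \int[m2]_x f (phi2 x).
Proof.
move=> mf f0.
have := @ge0_integral_pushforward _ _ _ _ R _ mphi1 m1 setT f measurableT mf (fun x _ => f0 x).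
rewrite preimage_setT => <-.
have := @ge0_integral_pushforward _ _ _ _ R _ mphi2 m2 setT f measurableT mf (fun x _ => f0 x).
rewrite preimage_setT => <-.
by apply: eq_measure_integral => A mA _; exact: measure_eq_law.
Qed.

Lemma integral_eq_law (f : R -> R) : measurable_fun setT f ->
  m1.-integrable setT (EFin \o (f \o phi1)) ->
  m2.-integrable setT (EFin \o (f \o phi2)) ->
  \int[m1]_x (f (phi1 x))%:E = \int[m2]_x (f (phi2 x))%:E.
Proof.
move=> mf i1 i2; have mf' : measurable_fun setT (EFin \o f) by exact/measurable_EFinP.
have := @integral_pushforward _ _ _ _ R _ mphi1 m1 setT (EFin \o f) mf' i1 measurableT.
rewrite preimage_setT => <-.
have := @integral_pushforward _ _ _ _ R _ mphi2 m2 setT (EFin \o f) mf' i2 measurableT.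
rewrite preimage_setT => <-.
by apply: eq_measure_integral => A mA _; exact: measure_eq_law.
Qed.

Lemma cintegral_eq_law (f : R -> R[i]) : cmeasurable setT f ->
  cintegrable m1 setT (f \o phi1) -> cintegrable m2 setT (f \o phi2) ->
  cintegral m1 setT (f \o phi1) = cintegral m2 setT (f \o phi2).
Proof.
move=> [f1 f2] [i1 j1] [i2 j2]; congr (fine _ +i* fine _).
  exact: (@integral_eq_law (fun x => complex.Re (f x))).
exact: (@integral_eq_law (fun x => complex.Im (f x))).
Qed.

End law.

(** * Integrals of products over product measures *)

Section product.
Context d1 (T1 : measurableType d1) d2 (T2 : measurableType d2) (R : realType).
Variables (m1 : {sigma_finite_measure set T1 -> \bar R})
  (m2 : {sigma_finite_measure set T2 -> \bar R}).

Lemma ge0_integral_prod (p : T1 -> R) (q : T2 -> R) :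
  measurable_fun setT p -> measurable_fun setT q ->
  (forall x, 0 <= p x) -> (forall x, 0 <= q x) ->
  (\int[m1 \x m2]_z (p z.1 * q z.2)%:E =
   (\int[m1]_x (p x)%:E) * (\int[m2]_x (q x)%:E))%E.
Proof.
move=> mp mq p0 q0.
rewrite (fubini_tonelli1 (fun z : T1 * T2 => (p z.1 * q z.2)%:E)); last 2 first.
- apply/measurable_EFinP; apply: measurable_funM.
    exact: (measurableT_comp mp measurable_fst).
  exact: (measurableT_comp mq measurable_snd).
- by move=> z; rewrite lee_fin mulr_ge0.
rewrite -ge0_integralZr//; last 3 first.
- exact/measurable_EFinP.
- by move=> x _; rewrite lee_fin.
- by apply: integral_ge0 => x _; rewrite lee_fin.
apply: eq_integral => x _; rewrite /fubini_F /=.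
under eq_integral do rewrite EFinM.
by rewrite ge0_integralZl_EFin//; [move=> y _; rewrite lee_fin|exact/measurable_EFinP].
Qed.

Lemma integrable_prod (p : T1 -> R) (q : T2 -> R) :
  m1.-integrable setT (EFin \o p) -> m2.-integrable setT (EFin \o q) ->
  (m1 \x m2)%E.-integrable setT (fun z => (p z.1 * q z.2)%:E).
Proof.
move=> ip iq.
have mp : measurable_fun setT p by apply/measurable_EFinP; exact: measurable_int ip.
have mq : measurable_fun setT q by apply/measurable_EFinP; exact: measurable_int iq.
apply/integrableP; split.
  apply/measurable_EFinP; apply: measurable_funM.
    exact: (measurableT_comp mp measurable_fst).
  exact: (measurableT_comp mq measurable_snd).
under eq_integral do rewrite /= normrM.
rewrite (ge0_integral_prod (p := fun x => `|p x|) (q := fun x => `|q x|))//; last 2 first.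
- exact: measurableT_comp.
- exact: measurableT_comp.
have /integrableP[_ h1] := ip; have /integrableP[_ h2] := iq.
by apply: lte_mul_pinfty => //; [exact: integral_ge0|rewrite ge0_fin_numE//; exact: integral_ge0].
Qed.

Lemma Rintegral_prod (p : T1 -> R) (q : T2 -> R) :
  m1.-integrable setT (EFin \o p) -> m2.-integrable setT (EFin \o q) ->
  \int[(m1 \x m2)%E]_z (p z.1 * q z.2) =
   (\int[m1]_x p x) * (\int[m2]_x q x).
Proof.
move=> ip iq.
rewrite [LHS]/Rintegral -integral12_prod_meas1//=; last exact: integrable_prod.
transitivity (\int[m1]_x (p x * \int[m2]_y q y)).
  congr fine; apply: eq_integral => x _; rewrite /fubini_F /=.
  under eq_integral do rewrite EFinM.
  rewrite integralZl// EFinM; congr (_ * _)%E.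
  by rewrite /Rintegral fineK//; exact: integrable_fin_num.
by rewrite RintegralZr.
Qed.

Lemma cintegral_prod (f : T1 -> R[i]) (g : T2 -> R[i]) :
  cintegrable m1 setT f -> cintegrable m2 setT g ->
  cintegral (m1 \x m2)%E setT (fun z => f z.1 * g z.2) =
  cintegral m1 setT f * cintegral m2 setT g.
Proof.
move=> [f1 f2] [g1 g2]; apply: eq_complexP.
  rewrite ReM /= -!Rintegral_prod// -RintegralB//;
    [|exact: integrable_prod f1 g1|exact: integrable_prod f2 g2].
  by apply: eq_Rintegral => z _; rewrite ReM.
rewrite ImM /= -!Rintegral_prod// -RintegralD//;
  [|exact: integrable_prod f1 g2|exact: integrable_prod f2 g1].
by apply: eq_Rintegral => z _; rewrite ImM.
Qed.

Lemma cintegrable_prod (f : T1 -> R[i]) (g : T2 -> R[i]) :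
  cintegrable m1 setT f -> cintegrable m2 setT g ->
  cintegrable (m1 \x m2)%E setT (fun z => f z.1 * g z.2).
Proof.
move=> [f1 f2] [g1 g2]; split.
  under eq_fun do rewrite ReM EFinB.
  exact: (integrableB measurableT (integrable_prod f1 g1) (integrable_prod f2 g2)).
under eq_fun do rewrite ImM EFinD.
exact: (integrableD measurableT (integrable_prod f1 g2) (integrable_prod f2 g1)).
Qed.

End product.

Section pack_probability.
Context d (T : measurableType d) (R : realType) (m : {measure set T -> \bar R}).
Hypothesis m1 : m setT = 1%E.

(** A new name for [m], to which the probability structure given by [m1] can be attached. *)
Definition pack_measure : set T -> \bar R := m.
HB.instance Definition _ := Measure.on pack_measure.
HB.instance Definition _ := @Measure_isProbability.Build _ _ R pack_measure m1.

Lemma probability_ex : exists nu : probability T R, forall A, nu A = m A.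
Proof. by exists pack_measure. Qed.

End pack_probability.

(** * The standard exponential law *)

Section exp_law.
Context {R : realType}.
Local Notation mu := (@lebesgue_measure R).
Local Notation pos := (`]0%R, +oo[%classic : set (measurableTypeR R)).

Definition exp_density (x : R) : R := expR (- x) * \1_(`]0%R, +oo[%classic) x.

Lemma measurable_exp_density : measurable_fun setT exp_density.
Proof.
apply: measurable_funM => //.
by apply: measurableT_comp; first exact: measurable_expR.
Qed.

Lemma exp_density_ge0 x : 0 <= exp_density x.
Proof. by rewrite mulr_ge0// ?expR_ge0// indicE. Qed.

(** The upper ends are v + (n + 2): with v + (n + 1) the piece of index 0 would reduce to a point,
    whereas the exhaustion lemmas ask for p n < q n. *)
Lemma exhaust_oy (v : R) :
  [/\ forall n : nat, v + n.+1%:R^-1 < v + n.+2%:R,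
    forall n m : nat, (n <= m)%N -> v + m.+1%:R^-1 <= v + n.+1%:R^-1 /\ v + n.+2%:R <= v +
      m.+2%:R &
    forall x, `]v, +oo[%classic x <-> exists n : nat, v + n.+1%:R^-1 <= x <= v + n.+2%:R].
Proof.
split.
- by move=> n; rewrite ltrD2l (@le_lt_trans _ _ 1)// ?invf_le1 ?ler1n ?ltr1n//.
- move=> n m nm; split; rewrite lerD2l; last by rewrite ler_nat.
  by rewrite lef_pV2 ?posrE// ler_nat.
- move=> x; rewrite /= in_itv/= andbT; split.
    move=> vx; have xv : 0 < x - v by rewrite subr_gt0.
    exists (maxn (Num.truncn (x - v)) (Num.truncn (x - v)^-1)).
    rewrite -lerBrDl -[X in _ && X]lerBlDl; apply/andP; split.
      rewrite invf_ple ?posrE// (le_trans (ltW (truncnS_gt _)))// ler_nat ltnS.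
      exact: leq_maxr.
    rewrite (le_trans (ltW (truncnS_gt _)))// ler_nat ltnS.
    by rewrite (leq_trans (leq_maxl _ (Num.truncn (x - v)^-1))).
  by move=> [n /andP[h _]]; apply: lt_le_trans h; rewrite ltrDl.
Qed.

Lemma integral_exp_ray (v : R) :
  (\int[mu]_(x in `]v, +oo[) (expR (- x))%:E = (expR (- v))%:E)%E.
Proof.
have -> : expR (- v) = 0 - (- expR (- v)) by rewrite sub0r opprK.
have d (x : R) : is_derive x 1 (fun t => - expR (- t)) (expR (- x)).
  have h1 : is_derive x 1 (fun t : R => - t) (- 1) by exact: is_deriveN.
  have h2 := is_deriveN (is_derive1_comp (is_derive_expR _) h1).
  by apply: is_derive_eq h2 _; rewrite mulrN1 opprK.
have c (x : R) : {for x, continuous (fun t => - expR (- t))}.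
  have [h _] := d x.
  by apply: differentiable_continuous; exact/derivable1_diffP.
have [h1 h2 h3] := exhaust_oy v.
apply: (@ge0_FTC_exhaust _ (fun t => expR (- t)) (fun t => - expR (- t)) _ _ _ _ _ h1 h2 h3).
- move=> x _.
  have : (- - expR (- t)) @[t --> x] --> - - expR (- x) by apply: cvgN; exact: c.
  by rewrite opprK; under eq_fun do rewrite opprK.
- have hu : v + n.+1%:R^-1 @[n --> \oo] --> v.
    rewrite -[X in _ --> X]addr0; apply: cvgD; first exact: cvg_cst.
    exact: cvg_harmonic.
  exact: (cvg_comp _ _ hu (c v)).
- rewrite -oppr0; apply: cvgN.
  have -> : (fun n => expR (- (v + n.+2%:R))) = (fun n => expR (- v) * expR (-1) ^+ 2 * expR
    (-1) ^+ n).
    apply/funext => n; rewrite -mulrA -exprD -expRM_natl -expRD; congr expR.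
    by rewrite addSn addSn add0n; ring.
  rewrite -(mulr0 (expR (- v) * expR (-1) ^+ 2)); apply: cvgMr; apply: cvg_expr.
  by rewrite ger0_norm ?expR_ge0// -[ltRHS]expR0 ltr_expR ltrN10.
- by move=> x _; exact: expR_ge0.
Qed.

Lemma integral_exp_density (f : R -> R) (A : set R) :
  (\int[mu]_(x in A) (f x * exp_density x)%:E =
  \int[mu]_(x in A `&` `]0%R, +oo[) (f x * expR (- x))%:E)%E.
Proof.
rewrite integral_mkcondr; apply: eq_integral => x _.
rewrite /exp_density /patch indicE; case: ifP => _; first by rewrite mulr1.
by rewrite !mulr0.
Qed.

Lemma exp_law_ex : exists nu : probability (measurableTypeR R) R,
  forall A, measurable A -> nu A = (\int[mu]_(x in A) (exp_density x)%:E)%E.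
Proof.
have [m mE] := density_measure_ex mu measurable_exp_density exp_density_ge0.
have m1 : m setT = 1%E.
  rewrite mE//; under eq_integral do rewrite -[exp_density _]mul1r.
  rewrite integral_exp_density setTI; under eq_integral do rewrite mul1r.
  by rewrite integral_exp_ray oppr0 expR0.
have [nu nuE] := probability_ex m1.
by exists nu => A mA; rewrite nuE mE.
Qed.

End exp_law.

(** * Complex moments from the Laplace transform *)

Section moments.
Context d (T : measurableType d) {R : realType} (P : probability T R).
Local Notation mu := (@lebesgue_measure R).
Local Notation pos := (`]0%R, +oo[%classic : set (measurableTypeR R)).
Variables (D : T -> R) (b t : R).
Hypotheses (mD : measurable_fun setT D) (D0 : P (D @^-1` `]-oo, 0]) = 0%E)
  (b01 : 0 < b < 1) (t0 : 0 < t).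
Hypothesis laplace : forall s, 0 < s ->
  (\int[P]_w (expR (- s * D w))%:E)%E = (expR (- t * s `^ b))%:E.

Let b0 : 0 < b. Proof. by have /andP[] := b01. Qed.

Variable nu : probability (measurableTypeR R) R.
Hypothesis nuE : forall A, measurable A -> nu A = (\int[mu]_(x in A) (exp_density x)%:E)%E.

Lemma ae_pos : {ae P, forall w, 0 < D w}.
Proof.
exists (D @^-1` `]-oo, 0]); split => //.
  by rewrite -[X in measurable X]setTI; exact: mD.
by move=> w /= /negP; rewrite -leNgt in_itv.
Qed.

(** Both sides of the equality in law reduce to this tail, taken at v = r + ln D and at v = r b + ln
    t. *)
Lemma nu_ray (v : R) : nu [set e | v < ln e] = (expR (- expR v))%:E.
Proof.
have mA : measurable ([set e : R | v < ln e] : set (measurableTypeR R)).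
  have -> : [set e : R | v < ln e] = setT `&` (@ln R) @^-1` `]v, +oo[.
    by rewrite setTI; apply/seteqP; split => x /=; rewrite in_itv/= andbT.
  exact: (@measurable_ln R).
rewrite nuE//; under eq_integral do rewrite -[exp_density _]mul1r.
rewrite integral_exp_density; under eq_integral do rewrite mul1r.
rewrite -integral_exp_ray; congr integral.
apply/seteqP; split => x /=; rewrite !in_itv/= !andbT.
  by move=> [h x0]; rewrite -(lnK x0) ltr_expR.
move=> h; have x0 : 0 < x by apply: lt_trans h; exact: expR_gt0.
by split => //; rewrite -ltr_expR lnK.
Qed.

Let L (w : T) : R := ln (D w).

Let mL : measurable_fun setT L.
Proof. exact: (measurableT_comp (@measurable_ln R) mD). Qed.

Let X1 (z : T * measurableTypeR R) : measurableTypeR R := ln (z.2 : R) - L z.1.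
Let X2 (e : measurableTypeR R) : measurableTypeR R := (ln (e : R) - ln t) / b.

Let mX1 : measurable_fun setT X1.
Proof.
apply: measurable_funB.
  exact: (measurableT_comp (@measurable_ln R) measurable_snd).
exact: (measurableT_comp mL measurable_fst).
Qed.

Let mX2 : measurable_fun setT X2.
Proof.
apply: measurable_funM => //; apply: measurable_funB => //.
Qed.

(* For an exponential variable E independent of D, the Laplace transform of D
   says that ln E - ln D and (ln E - ln t) / b have the same law. *)
Let rays (r : R) : (P \x nu)%E (X1 @^-1` `]r, +oo[) = nu (X2 @^-1` `]r, +oo[).
Proof.
have -> : X2 @^-1` `]r, +oo[ = [set e | r * b + ln t < ln e].
  by apply/seteqP; split => e /=; rewrite in_itv/= andbT /X2 ltr_pdivlMr// ltrBrDr.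
rewrite nu_ray.
transitivity (\int[P]_w (expR (- expR r * D w))%:E)%E; last first.
  rewrite laplace ?expR_gt0//; congr (_%:E); congr expR.
  by rewrite -expRM expRD lnK// mulNr mulrC.
rewrite /product_measure1 /=.
have mA : measurable (X1 @^-1` `]r, +oo[).
  by rewrite -[X in measurable X]setTI; exact: mX1.
apply: ge0_ae_eq_integral => //.
- exact: measurable_fun_xsection.
- apply/measurable_EFinP; apply: measurableT_comp; first exact: measurable_expR.
  exact: measurable_funM.
(* The section at w is an exponential tail equal to exp(- e^r D w) as soon as D w > 0, hence almost
   everywhere. *)
have [N [mN N0 sN]] := ae_pos; exists N; split => // w hw; apply: sN => w0; apply: hw => _ /=.
have -> : xsection (X1 @^-1` `]r, +oo[) w = [set e | r + L w < ln e].
  apply/seteqP; split => e; rewrite /xsection /= inE /= in_itv /= andbT /X1 /=.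
    by rewrite ltrBrDr.
  by rewrite ltrBrDr.
by rewrite nu_ray expRD lnK// mulNr.
Qed.

Let mlin (a : R) : measurable_fun setT (fun x : R => expR (a * x)).
Proof.
by apply: measurableT_comp; [exact: measurable_expR|exact: measurable_funM].
Qed.

Lemma integral_nu (f : R -> R) : measurable_fun setT f ->
  (\int[nu]_x (f x)%:E = \int[mu]_(x in `]0%R, +oo[) (f x * expR (- x))%:E)%E.
Proof.
move=> mf; rewrite (@integral_density _ (measurableTypeR R) R mu exp_density
  measurable_exp_density exp_density_ge0 nu nuE f mf).
by rewrite integral_exp_density setTI.
Qed.

Lemma integral_nu_rpow (a : R) : - 1 < a ->
  (\int[nu]_x (expR (a * ln x))%:E = (rgamma (1 + a))%:E)%E.
Proof.
move=> a1; rewrite integral_nu; last exact: measurable_rpow.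
have a10 : 0 < 1 + a by lra.
have ig := integrable_gamma a10.
rewrite /rgamma Gamma_integral_realE /= /Rintegral fineK; last exact: integrable_fin_num.
by apply: eq_integral => x _; rewrite addrAC subrr add0r.
Qed.

Lemma cintegral_nu_cpow (u : R[i]) : - 1 < complex.Re u ->
  cintegrable nu setT (fun x => cpow x u) /\
  cintegral nu setT (fun x => cpow x u) = Gamma_integral (1 + u).
Proof.
move=> u1; have [m1 m2] := @cmeasurable_cpow R setT u.
split.
  apply: (@cintegrable_dominated _ (measurableTypeR R) R nu setT _ (fun x => expR (complex.Re
    u * ln x))) => //.
  - by move=> x _; rewrite sqn_cpow.
  - apply/integrableP; split; first by apply/measurable_EFinP; exact: measurable_rpow.
    under eq_integral do rewrite /= ger0_norm ?expR_ge0//.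
    by rewrite integral_nu_rpow// ltry.
have E : Gamma_integral (1 + u) = cintegral mu pos (fun x => cpow x u * (expR (- x))%:C).
  by apply: (eq_cintegral mu) => x _; rewrite addrAC subrr add0r.
rewrite E; congr (fine _ +i* fine _); rewrite integral_nu//; apply: eq_integral => x _.
  by rewrite (ReM (cpow x u)) /= mulr0 subr0.
by rewrite (ImM (cpow x u)) /= mulr0 add0r.
Qed.

(** Integrating e^(x X1) and e^(x X2) shows that E[D^(-x)] Gamma(1 + x) is finite; since Gamma(1 +
    x) > 0, the first factor cannot be infinite. *)
Lemma integrable_moment (x : R) : - b < x ->
  P.-integrable setT (fun w => (expR (- x * ln (D w)))%:E).
Proof.
move=> xb.
have x1 : - 1 < x by have /andP[] := b01; lra.
have xb1 : - 1 < x / b by rewrite ltr_pdivlMr// mulN1r.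
have me : measurable_fun setT (fun w => expR (- x * L w)) by exact: (measurableT_comp (mlin
  (- x)) mL).
apply/integrableP; split; first exact/measurable_EFinP.
under eq_integral do rewrite /= ger0_norm ?expR_ge0//.
have h := @ge0_integral_eq_law _ _ _ _ _ (P \x nu)%E nu X1 X2 mX1 mX2 _ rays
  (fun l => (expR (x * l))%:E) _ _.
have hP : (\int[(P \x nu)%E]_z (expR (x * X1 z))%:E =
   (\int[P]_w (expR (- x * L w))%:E) * (rgamma (1 + x))%:E)%E.
  rewrite -integral_nu_rpow// -ge0_integral_prod//; last exact: measurable_rpow.
  by apply: eq_integral => z _; rewrite -expRD /X1; congr (_%:E); congr expR; ring.
have h2 : (\int[nu]_e (expR (x * X2 e))%:E < +oo)%E.
  rewrite (_ : (\int[nu]_e _)%E = (\int[nu]_e ((expR (- x / b * ln t))%:E * (expR ((x / b) *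
    ln e))%:E))%E).
    rewrite ge0_integralZl_EFin ?expR_ge0//.
    - by rewrite integral_nu_rpow// -EFinM ltry.
    - by apply/measurable_EFinP; exact: measurable_rpow.
  by apply: eq_integral => e _; rewrite -EFinM -expRD /X2; congr (_%:E); congr expR; ring.
rewrite -h// in h2; last 2 first.
- by rewrite (le_lt_trans (probability_le1 _ _))// ltry.
- by apply/measurable_EFinP; exact: mlin.
rewrite hP in h2.
have g0 : 0 < rgamma (1 + x) by apply: rgamma_gt0; lra.
rewrite ltNge leye_eq; apply/negP => /eqP e; move: h2; rewrite /= e gt0_mulye ?ltxx// lte_fin.
Qed.

(** Both sides are the mean of e^(u l) under the common law of X1 and X2. On the product space that
    mean factors into a moment of the exponential variable and one of D. *)
Lemma cpow_moment (u : R[i]) : - b < complex.Re u ->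
  cintegrable P setT (fun w => cpow (D w) (- u)) /\
  Gamma_integral (1 + u) * cintegral P setT (fun w => cpow (D w) (- u)) =
  cpow t (- u / b%:C) * Gamma_integral (1 + u / b%:C).
Proof.
move=> ub.
have u1 : - 1 < complex.Re u by have /andP[] := b01; lra.
have ReVb : complex.Re (u / b%:C) = complex.Re u / b.
  by rewrite -fmorphV ReM ReC ImC mulr0 subr0.
have ub1 : - 1 < complex.Re (u / b%:C) by rewrite ReVb ltr_pdivlMr// mulN1r.
have mc : cmeasurable setT (fun w => cpow (D w) (- u)).
  by have [c1 c2] := @cmeasurable_cpow R setT (- u); split;
    [exact: (measurableT_comp c1 mD)|exact: (measurableT_comp c2 mD)].
have ci : cintegrable P setT (fun w => cpow (D w) (- u)).
  apply: (cintegrable_dominated _ mc _ _ (integrable_moment ub)) => //.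
  by move=> w _; rewrite sqn_cpow ReN.
have [i1 e1] := cintegral_nu_cpow u1; have [i2 e2] := cintegral_nu_cpow ub1.
split => //.
rewrite -e1 -e2 mulrC -cintegral_prod// -cintegralZ//.
pose f (l : R) := expC (u * l%:C).
have mf : cmeasurable setT f.
  apply: cmeasurable_expC; apply: cmeasurableM; first exact: cmeasurable_cst.
  exact: cmeasurable_real.
have f1 : (fun z : T * R => cpow (D z.1) (- u) * cpow z.2 u) = f \o X1.
  apply/funext => z; rewrite /= /f /cpow -expCD; congr expC.
  by rewrite rmorphB; ring.
have bC : b%:C != 0 :> R[i] by rewrite eq_complex /= (gt_eqF b0).
have f2 : (fun e : R => cpow t (- u / b%:C) * cpow e (u / b%:C)) = f \o X2.
  apply/funext => e; rewrite /= /f /cpow -expCD; congr expC.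
  by rewrite rmorphM rmorphB fmorphV; field.
rewrite f1 f2; apply: (cintegral_eq_law mX1 mX2 _ rays) => //.
- by rewrite (le_lt_trans (probability_le1 _ _))// ltry.
- by rewrite -f1; exact: (cintegrable_prod ci i1).
- by rewrite -f2; exact: (cintegrableZ _ measurableT i2).
Qed.

End moments.

(** * Mellin inversion *)

Section poisson.
Context {R : realType}.
Local Notation mu := (@lebesgue_measure R).
Implicit Types (a v y e : R) (n : nat).

(** This and the next function are the real and imaginary parts of e^((a + i v) y) / (a + i v). *)
Definition exp_cos_prim a v y := expR (a * y) * (a * cos (v * y) + v * sin (v * y)) / (a ^+ 2
  + v ^+ 2).
Definition exp_sin_prim a v y := expR (a * y) * (a * sin (v * y) - v * cos (v * y)) / (a ^+ 2
  + v ^+ 2).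

Lemma is_derive_lin a y : is_derive y 1 (fun t => a * t) a.
Proof.
have h : is_derive y 1 (fun t => a * t) (a *: 1) by exact: is_deriveZ.
by apply: is_derive_eq h _; rewrite /GRing.scale /= mulr1.
Qed.

Lemma is_derive_exp_cos_prim a v y : a != 0 ->
  is_derive y 1 (exp_cos_prim a v) (expR (a * y) * cos (v * y)).
Proof.
move=> a0.
have d0 : a ^+ 2 + v ^+ 2 != 0.
  by rewrite gt_eqF// ltr_wpDr ?sqr_ge0// exprn_even_gt0.
have hE := is_derive1_comp (is_derive_expR _) (is_derive_lin a y).
have hc := is_derive1_comp (is_derive_cos _) (is_derive_lin v y).
have hs := is_derive1_comp (is_derive_sin _) (is_derive_lin v y).
have h1 : is_derive y 1 (fun t => a * cos (v * t)) (a *: (- sin (v * y) * v)) := is_deriveZ a hc.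
have h2 : is_derive y 1 (fun t => v * sin (v * t)) (v *: (cos (v * y) * v)) := is_deriveZ v hs.
have h3 := is_deriveM hE (is_deriveD h1 h2).
have h4 : is_derive y 1 (fun t => (a ^+ 2 + v ^+ 2)^-1 * _) _ :=
  is_deriveZ (a ^+ 2 + v ^+ 2)^-1 h3.
have -> : exp_cos_prim a v = (fun t => (a ^+ 2 + v ^+ 2)^-1 * (expR (a * t) * (a * cos (v *
  t) + v * sin (v * t)))).
  by apply/funext => t; rewrite /exp_cos_prim mulrC.
apply: is_derive_eq h4 _.
by rewrite /GRing.scale /= fctE; field.
Qed.

Lemma is_derive_exp_sin_prim a v y : a != 0 ->
  is_derive y 1 (exp_sin_prim a v) (expR (a * y) * sin (v * y)).
Proof.
move=> a0.
have d0 : a ^+ 2 + v ^+ 2 != 0.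
  by rewrite gt_eqF// ltr_wpDr ?sqr_ge0// exprn_even_gt0.
have hE := is_derive1_comp (is_derive_expR _) (is_derive_lin a y).
have hc := is_derive1_comp (is_derive_cos _) (is_derive_lin v y).
have hs := is_derive1_comp (is_derive_sin _) (is_derive_lin v y).
have h1 : is_derive y 1 (fun t => a * sin (v * t)) (a *: (cos (v * y) * v)) := is_deriveZ a hs.
have h2 : is_derive y 1 (fun t => - v * cos (v * t)) (- v *: (- sin (v * y) * v)) :=
  is_deriveZ (- v) hc.
have h3 := is_deriveM hE (is_deriveD h1 h2).
have h4 : is_derive y 1 (fun t => (a ^+ 2 + v ^+ 2)^-1 * _) _ :=
  is_deriveZ (a ^+ 2 + v ^+ 2)^-1 h3.
have -> : exp_sin_prim a v = (fun t => (a ^+ 2 + v ^+ 2)^-1 * (expR (a * t) * (a * sin (v *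
  t) + - v * cos (v * t)))).
  by apply/funext => t; rewrite /exp_sin_prim mulNr mulrC.
apply: is_derive_eq h4 _.
by rewrite /GRing.scale /= fctE; field.
Qed.

Lemma continuous_expR_trig a v y :
  {for y, continuous (fun t => expR (a * t) * cos (v * t))} /\
  {for y, continuous (fun t => expR (a * t) * sin (v * t))}.
Proof.
have hE := is_derive1_comp (is_derive_expR _) (is_derive_lin a y).
have hc := is_derive1_comp (is_derive_cos _) (is_derive_lin v y).
have hs := is_derive1_comp (is_derive_sin _) (is_derive_lin v y).
have [h1 _] := is_deriveM hE hc; have [h2 _] := is_deriveM hE hs.
by split; apply: differentiable_continuous; exact/derivable1_diffP.
Qed.

Lemma exp_trig_prim_bound a v y : a != 0 ->
  `|exp_cos_prim a v y| <= expR (a * y) * ((`|a| + `|v|) / (a ^+ 2 + v ^+ 2)) /\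
  `|exp_sin_prim a v y| <= expR (a * y) * ((`|a| + `|v|) / (a ^+ 2 + v ^+ 2)).
Proof.
move=> a0.
have d0 : 0 < a ^+ 2 + v ^+ 2 by rewrite ltr_wpDr ?sqr_ge0// exprn_even_gt0.
have b (s c : R) : `|s| <= 1 -> `|c| <= 1 -> `|a * s + v * c| <= `|a| + `|v|.
  move=> s1 c1; apply: le_trans (ler_normD _ _) _; rewrite !normrM.
  by apply: lerD; rewrite -[leRHS]mulr1 ler_wpM2l.
rewrite /exp_cos_prim /exp_sin_prim -mulNr !normrM !(ger0_norm (expR_ge0 _)) normfV
  (gtr0_norm d0) -!mulrA.
have i0 : 0 <= (a ^+ 2 + v ^+ 2)^-1 by rewrite invr_ge0 ltW.
split; apply: ler_wpM2l; rewrite ?expR_ge0//; apply: ler_wpM2r => //.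
  by apply: b; rewrite ?cos_max ?sin_max.
by rewrite mulNr -mulrN; apply: b; rewrite ?normrN ?cos_max ?sin_max.
Qed.

Lemma cvg_expRN_nat e : 0 < e -> expR (- e * n.+1%:R) @[n --> \oo] --> (0 : R).
Proof.
move=> e0.
have -> : (fun n => expR (- e * n.+1%:R)) = (fun n => expR (- e) * expR (- e) ^+ n).
  by apply/funext => n; rewrite -exprS -expRM_natl mulrC.
rewrite -(mulr0 (expR (- e))); apply: cvgMr; apply: cvg_expr.
by rewrite ger0_norm ?expR_ge0// -[ltRHS]expR0 ltr_expR oppr_lt0.
Qed.

Lemma exp_trig_prim_cvg0 a v (u : nat -> R) : a != 0 -> expR (a * u n) @[n --> \oo] --> (0 : R) ->
  exp_cos_prim a v (u n) @[n --> \oo] --> (0 : R) /\ exp_sin_prim a v (u n) @[n --> \oo] -->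
    (0 : R).
Proof.
move=> a0 h.
have h2 : expR (a * u n) * ((`|a| + `|v|) / (a ^+ 2 + v ^+ 2)) @[n --> \oo] --> (0 : R).
  by rewrite -(mul0r ((`|a| + `|v|) / (a ^+ 2 + v ^+ 2))); exact: cvgMl.
split; apply/norm_cvg0P; apply: (squeeze_cvgr _ (cvg_cst 0) h2); apply: nearW => n;
  rewrite normr_ge0 /=.
  exact: (exp_trig_prim_bound v (u n) a0).1.
exact: (exp_trig_prim_bound v (u n) a0).2.
Qed.

Lemma exhaust_cy :
  [/\ forall n : nat, (0 : R) < n.+1%:R,
    forall n m : nat, (n <= m)%N -> (0 : R) <= 0 /\ (n.+1%:R : R) <= m.+1%:R &
    forall y, `[0, +oo[%classic y <-> exists n : nat, 0 <= y <= n.+1%:R].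
Proof.
split => //.
- by move=> n m nm; rewrite lexx ler_nat.
- move=> y; rewrite /= in_itv/= andbT; split; last by move=> [n /andP[]].
  by move=> y0; exists (Num.truncn y); rewrite y0 ltW// truncnS_gt.
Qed.

Lemma exhaust_Nyc :
  [/\ forall n : nat, - n.+1%:R < (0 : R),
    forall n m : nat, (n <= m)%N -> - m.+1%:R <= - (n.+1%:R : R) /\ (0 : R) <= 0 &
    forall y, `]-oo, 0]%classic y <-> exists n : nat, - n.+1%:R <= y <= 0].
Proof.
split => //.
- by move=> n m nm; rewrite lexx lerN2 ler_nat.
- move=> y; rewrite /= in_itv/=; split; last by move=> [n /andP[]].
  by move=> y0; exists (Num.truncn (- y)); rewrite y0 andbT lerNl ltW// truncnS_gt.
Qed.

Lemma half_line_right e : 0 < e ->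
  mu.-integrable `[0, +oo[ (fun y => (expR (- e * y))%:E) /\
  forall v, \int[mu]_(y in `[0, +oo[) (expR (- e * y) * cos (v * y)) = e / (e ^+ 2 + v ^+ 2) /\
   \int[mu]_(y in `[0, +oo[) (expR (- e * y) * sin (v * y)) = v / (e ^+ 2 + v ^+ 2).
Proof.
move=> e0; have [h1 h2 h3] := exhaust_cy.
have Ne0 : - e != 0 by rewrite oppr_eq0 gt_eqF.
have me : measurable_fun (`[0, +oo[ : set R) (fun y => expR (- e * y)).
  by apply: measurable_funTS; apply: measurableT_comp;
    [exact: measurable_expR|exact: measurable_funM].
have cs v : exp_cos_prim (- e) v 0 = - (e / (e ^+ 2 + v ^+ 2)) /\ exp_sin_prim (- e) v 0 = -
  (v / (e ^+ 2 + v ^+ 2)).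
  by rewrite /exp_cos_prim /exp_sin_prim !mulr0 expR0 cos0 sin0 !mulr0 mulr1 addr0 sub0r
    !mul1r sqrrN mulr1 !mulNr.
have lim v := exp_trig_prim_cvg0 v Ne0 (cvg_expRN_nat e0).
have ie : mu.-integrable `[0, +oo[ (fun y => (expR (- e * y))%:E).
  apply/integrableP; split; first exact/measurable_EFinP.
  under eq_integral do rewrite /= ger0_norm ?expR_ge0//.
  suff -> : (\int[mu]_(y in `[0%R, +oo[) (expR (- e * y))%:E = (0 - exp_cos_prim (- e) 0
    0)%:E)%E by rewrite ltry.
  apply: (@ge0_FTC_exhaust _ (fun y => expR (- e * y)) (exp_cos_prim (- e) 0) _ _ _
    (exp_cos_prim (- e) 0 0) 0 h1 h2 h3).
  - move=> y _; apply: is_derive_eq (is_derive_exp_cos_prim 0 y Ne0) _.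
    by rewrite mul0r cos0 mulr1.
  - move=> y _; have := (continuous_expR_trig (- e) 0 y).1.
    suff -> : (fun t => expR (- e * t) * cos (0 * t)) = (fun t => expR (- e * t)) by [].
    by apply/funext => t; rewrite mul0r cos0 mulr1.
  - exact: cvg_cst.
  - exact: (lim 0).1.
  - by move=> y _; exact: expR_ge0.
split => // v; have [c1 c2] := cs v.
have ib (s : R -> R) : measurable_fun setT s -> (forall y, `|s y| <= 1) ->
    mu.-integrable `[0, +oo[ (EFin \o (fun y => expR (- e * y) * s y)).
  move=> ms s1; apply: (integrable_dominated _ _ _ ie) => //.
    by apply: measurable_funM => //; exact: measurable_funTS.
  by move=> y _; rewrite normrM ger0_norm ?expR_ge0// -[leRHS]mulr1 ler_wpM2l ?expR_ge0.
have mc : measurable_fun setT (fun y : R => cos (v * y)).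
  apply: measurableT_comp; last exact: measurable_funM.
  by apply: continuous_measurable_fun; exact: continuous_cos.
have ms : measurable_fun setT (fun y : R => sin (v * y)).
  apply: measurableT_comp; last exact: measurable_funM.
  by apply: continuous_measurable_fun; exact: continuous_sin.
split.
- transitivity (0 - exp_cos_prim (- e) v 0); last by rewrite c1 sub0r opprK.
  apply: (@FTC_exhaust _ _ (exp_cos_prim (- e) v) _ _ _ (exp_cos_prim (- e) v 0) 0 h1 h2 h3).
  + by move=> y _; exact: is_derive_exp_cos_prim.
  + by move=> y _; exact: (continuous_expR_trig (- e) v y).1.
  + exact: cvg_cst.
  + exact: (lim v).1.
  + by apply: ib => // y; exact: cos_max.
- transitivity (0 - exp_sin_prim (- e) v 0); last by rewrite c2 sub0r opprK.
  apply: (@FTC_exhaust _ _ (exp_sin_prim (- e) v) _ _ _ (exp_sin_prim (- e) v 0) 0 h1 h2 h3).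
  + by move=> y _; exact: is_derive_exp_sin_prim.
  + by move=> y _; exact: (continuous_expR_trig (- e) v y).2.
  + exact: cvg_cst.
  + exact: (lim v).2.
  + by apply: ib => // y; exact: sin_max.
Qed.

Lemma half_line_left e : 0 < e ->
  mu.-integrable `]-oo, 0] (fun y => (expR (e * y))%:E) /\
  forall v, \int[mu]_(y in `]-oo, 0]) (expR (e * y) * cos (v * y)) = e / (e ^+ 2 + v ^+ 2) /\
   \int[mu]_(y in `]-oo, 0]) (expR (e * y) * sin (v * y)) = - (v / (e ^+ 2 + v ^+ 2)).
Proof.
move=> e0; have [h1 h2 h3] := exhaust_Nyc.
have Ne0 : e != 0 by rewrite gt_eqF.
have me : measurable_fun (`]-oo, 0] : set R) (fun y => expR (e * y)).
  by apply: measurable_funTS; apply: measurableT_comp;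
    [exact: measurable_expR|exact: measurable_funM].
have cs v : exp_cos_prim e v 0 = e / (e ^+ 2 + v ^+ 2) /\ exp_sin_prim e v 0 = - (v / (e ^+ 2
  + v ^+ 2)).
  by rewrite /exp_cos_prim /exp_sin_prim !mulr0 expR0 cos0 sin0 !mulr0 mulr1 addr0 sub0r
    !mul1r mulr1 !mulNr.
have lim v : exp_cos_prim e v (- n.+1%:R) @[n --> \oo] --> (0 : R) /\ exp_sin_prim e v (-
  n.+1%:R) @[n --> \oo] --> (0 : R).
  apply: exp_trig_prim_cvg0 => //; under eq_fun do rewrite mulrN -mulNr.
  exact: cvg_expRN_nat.
have ie : mu.-integrable `]-oo, 0] (fun y => (expR (e * y))%:E).
  apply/integrableP; split; first exact/measurable_EFinP.
  under eq_integral do rewrite /= ger0_norm ?expR_ge0//.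
  suff -> : (\int[mu]_(y in `]-oo, 0%R]) (expR (e * y))%:E = (exp_cos_prim e 0 0 - 0)%:E)%E
    by rewrite ltry.
  apply: (@ge0_FTC_exhaust _ (fun y => expR (e * y)) (exp_cos_prim e 0) _ _ _ 0 (exp_cos_prim
    e 0 0) h1 h2 h3).
  - move=> y _; apply: is_derive_eq (is_derive_exp_cos_prim 0 y Ne0) _.
    by rewrite mul0r cos0 mulr1.
  - move=> y _; have := (continuous_expR_trig e 0 y).1.
    suff -> : (fun t => expR (e * t) * cos (0 * t)) = (fun t => expR (e * t)) by [].
    by apply/funext => t; rewrite mul0r cos0 mulr1.
  - exact: (lim 0).1.
  - exact: cvg_cst.
  - by move=> y _; exact: expR_ge0.
split => // v; have [c1 c2] := cs v.
have ib (s : R -> R) : measurable_fun setT s -> (forall y, `|s y| <= 1) ->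
    mu.-integrable `]-oo, 0] (EFin \o (fun y => expR (e * y) * s y)).
  move=> ms s1; apply: (integrable_dominated _ _ _ ie) => //.
    by apply: measurable_funM => //; exact: measurable_funTS.
  by move=> y _; rewrite normrM ger0_norm ?expR_ge0// -[leRHS]mulr1 ler_wpM2l ?expR_ge0.
have mc : measurable_fun setT (fun y : R => cos (v * y)).
  apply: measurableT_comp; last exact: measurable_funM.
  by apply: continuous_measurable_fun; exact: continuous_cos.
have ms : measurable_fun setT (fun y : R => sin (v * y)).
  apply: measurableT_comp; last exact: measurable_funM.
  by apply: continuous_measurable_fun; exact: continuous_sin.
split.
- transitivity (exp_cos_prim e v 0 - 0); last by rewrite c1 subr0.
  apply: (@FTC_exhaust _ _ (exp_cos_prim e v) _ _ _ 0 (exp_cos_prim e v 0) h1 h2 h3).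
  + by move=> y _; exact: is_derive_exp_cos_prim.
  + by move=> y _; exact: (continuous_expR_trig e v y).1.
  + exact: (lim v).1.
  + exact: cvg_cst.
  + by apply: ib => // y; exact: cos_max.
- transitivity (exp_sin_prim e v 0 - 0); last by rewrite c2 subr0.
  apply: (@FTC_exhaust _ _ (exp_sin_prim e v) _ _ _ 0 (exp_sin_prim e v 0) h1 h2 h3).
  + by move=> y _; exact: is_derive_exp_sin_prim.
  + by move=> y _; exact: (continuous_expR_trig e v y).2.
  + exact: (lim v).2.
  + exact: cvg_cst.
  + by apply: ib => // y; exact: sin_max.
Qed.

End poisson.

Section poisson_line.
Context {R : realType}.
Local Notation mu := (@lebesgue_measure R).
Implicit Types (a v y e : R) (n : nat).

Lemma measurable_expR_lin a : measurable_fun setT (fun y => expR (a * y)).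
Proof. by apply: measurableT_comp; [exact: measurable_expR|exact: measurable_funM]. Qed.

Lemma measurable_cos_lin a : measurable_fun setT (fun y : R => cos (a * y)).
Proof.
apply: measurableT_comp; last exact: measurable_funM.
by apply: continuous_measurable_fun; exact: continuous_cos.
Qed.

Lemma measurable_sin_lin a : measurable_fun setT (fun y : R => sin (a * y)).
Proof.
apply: measurableT_comp; last exact: measurable_funM.
by apply: continuous_measurable_fun; exact: continuous_sin.
Qed.

Lemma measurable_expRN_norm e : measurable_fun setT (fun y => expR (- e * `|y|)).
Proof. exact: (measurableT_comp (measurable_expR_lin (- e)) (@normr_measurable R setT)). Qed.

Lemma integrable_expRN_norm e : 0 < e ->
  mu.-integrable setT (fun y => (expR (- e * `|y|))%:E).
Proof.
move=> e0; have [i1 _] := half_line_left e0; have [i2 _] := half_line_right e0.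
pose g y := (fun y => expR (e * y)) \_ `]-oo, 0]%classic y +
            (fun y => expR (- e * y)) \_ `[0, +oo[%classic y.
have ig : mu.-integrable setT (EFin \o g).
  have j1 : mu.-integrable setT (EFin \o (fun y => expR (e * y)) \_ `]-oo, 0]%classic).
    by rewrite -restrict_EFin; apply/integrable_restrict => //; rewrite setTI.
  have j2 : mu.-integrable setT (EFin \o (fun y => expR (- e * y)) \_ `[0, +oo[%classic).
    by rewrite -restrict_EFin; apply/integrable_restrict => //; rewrite setTI.
  exact: (integrableD measurableT j1 j2).
apply: (integrable_dominated _ _ _ ig) => //.
  exact: measurable_expRN_norm.
move=> y _; rewrite ger0_norm ?expR_ge0// /g !patchE.
have h (b : bool) (r : R) : 0 <= r -> 0 <= if b then r else 0 by case: b.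
have [y0|y0] := leP 0 y.
  by rewrite ger0_norm// [X in _ + X]ifT ?lerDr ?h ?expR_ge0// inE/= in_itv/= y0.
by rewrite ltr0_norm// mulrNN [X in X + _]ifT ?lerDl ?h ?expR_ge0// inE/= in_itv/= ltW.
Qed.

Lemma integrable_expRN_norm_mul e (s : R -> R) : 0 < e -> measurable_fun setT s ->
  (forall y, `|s y| <= 1) ->
  mu.-integrable setT (fun y => (expR (- e * `|y|) * s y)%:E).
Proof.
move=> e0 ms s1; apply: (integrable_dominated _ _ _ (integrable_expRN_norm e0)) => //.
  by apply: measurable_funM => //; exact: measurable_expRN_norm.
by move=> y _; rewrite normrM ger0_norm ?expR_ge0// -[leRHS]mulr1 ler_wpM2l ?expR_ge0.
Qed.

Lemma Rintegral_line (f : R -> R) : mu.-integrable setT (EFin \o f) ->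
  \int[mu]_y f y = \int[mu]_(y in `]-oo, 0]) f y + \int[mu]_(y in `[0, +oo[) f y.
Proof.
move=> fi.
have i2 : mu.-integrable `]0, +oo[ (EFin \o f) by exact: integrableS fi.
have U : setT = `]-oo, 0]%classic `|` `]0, +oo[%classic :> set R.
  by apply/seteqP; split => // y _ /=; rewrite !in_itv/= andbT; case: leP; [left|right].
rewrite {1}U Rintegral_setU//.
- by rewrite (Rintegral_itv_obnd_cbnd i2).
- by rewrite -U.
- apply/disj_set2P; apply/seteqP; split => // y /= []; rewrite !in_itv/= andbT => y0.
  by rewrite ltNge y0.
Qed.

Lemma poisson_cos e v : 0 < e ->
  \int[mu]_y (expR (- e * `|y|) * cos (v * y)) = 2 * (e / (e ^+ 2 + v ^+ 2)).
Proof.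
move=> e0; have [_ h1] := half_line_left e0; have [_ h2] := half_line_right e0.
rewrite Rintegral_line; last first.
  by apply: integrable_expRN_norm_mul => //; [exact: measurable_cos_lin|move=> y; exact: cos_max].
have [c1 _] := h1 v; have [c2 _] := h2 v.
rewrite mulr_natl mulr2n -{1}c1 -c2; congr (_ + _); apply: eq_Rintegral => y;
  rewrite inE/= in_itv/= ?andbT => y0.
  by rewrite ler0_norm// mulrNN.
by rewrite ger0_norm.
Qed.

Lemma poisson_sin e v : 0 < e ->
  \int[mu]_y (expR (- e * `|y|) * sin (v * y)) = 0.
Proof.
move=> e0; have [_ h1] := half_line_left e0; have [_ h2] := half_line_right e0.
rewrite Rintegral_line; last first.
  by apply: integrable_expRN_norm_mul => //; [exact: measurable_sin_lin|move=> y; exact: sin_max].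
have [_ c1] := h1 v; have [_ c2] := h2 v.
rewrite -[RHS](addNr (v / (e ^+ 2 + v ^+ 2))) -c1 -c2; congr (_ + _); apply: eq_Rintegral => y;
  rewrite inE/= in_itv/= ?andbT => y0.
  by rewrite ler0_norm// mulrNN.
by rewrite ger0_norm.
Qed.

Lemma integrable_invDsqr (K : R) : mu.-integrable setT (fun y => (K / (1 + y ^+ 2))%:E).
Proof.
suff h : mu.-integrable setT (EFin \o (fun y => (1 + y ^+ 2)^-1)).
  by have := integrableZl measurableT K h; under eq_fun do rewrite -EFinM.
have p0 y : 0 < 1 + y ^+ 2 by rewrite ltr_wpDr// sqr_ge0.
have c y : {for y, continuous (fun y : R => (1 + y ^+ 2)^-1)}.
  exact: continuous_oneDsqrV.
apply/integrableP; split.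
  by apply/measurable_EFinP; apply: continuous_measurable_fun => y; exact: c.
under eq_integral do rewrite /= ger0_norm ?invr_ge0 ?(ltW (p0 _))//.
suff -> : (\int[mu]_(y in [set: R]) ((1 + y ^+ 2)^-1)%:E = (pi / 2 - - (pi / 2))%:E)%E by
  rewrite ltry.
have lim : atan n.+1%:R @[n --> \oo] --> (pi / 2 : R).
  apply: (cvg_comp (fun n : nat => n.+1%:R : R) (@atan R) _ (@cvgy_atan R)).
  by have := @cvgr_idn R; rewrite -(cvg_shiftn 1); under eq_fun do rewrite addn1.
apply: (@ge0_FTC_exhaust _ (fun y : R => (1 + y ^+ 2)^-1) (@atan R) setT
  (fun n => - n.+1%:R) (fun n => n.+1%:R)).
- by move=> n; rewrite gtrN.
- by move=> n m nm; rewrite lerN2 ler_nat.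
- move=> y; split => // _; exists (Num.truncn `|y|).
  by rewrite -ler_norml ltW// truncnS_gt.
- by move=> y _; exact: c.
- by under eq_fun do rewrite atanN; exact: cvgN.
- exact: lim.
- by move=> y _; rewrite invr_ge0 ltW.
Qed.

End poisson_line.

(** * Fourier integrals of the law of [L] weighted by [W], and their smoothing by Poisson kernels *)

Section mellin_kernel.
Context d (T : measurableType d) {R : realType} (P : probability T R).
Local Notation mu := (@lebesgue_measure R).
Variables (W L : T -> R).
Hypotheses (mL : measurable_fun setT L) (W0 : forall w, 0 <= W w)
  (iW : P.-integrable setT (EFin \o W)).

Let mW : measurable_fun setT W.
Proof. by apply/measurable_EFinP; exact: measurable_int iW. Qed.

Lemma integrable_Wmul (s : T -> R) (C : R) : measurable_fun setT s ->
  (forall w, `|s w| <= C) -> P.-integrable setT (fun w => (W w * s w)%:E).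
Proof.
move=> ms sC.
have iC : P.-integrable setT (EFin \o (fun w => C * W w)).
  by have := integrableZl measurableT C iW; under eq_fun do rewrite -EFinM.
apply: (integrable_dominated _ _ _ iC) => //; first exact: measurable_funM.
by move=> w _; rewrite normrM (ger0_norm (W0 w)) mulrC ler_wpM2r.
Qed.

Section oscillating.
Variable s : R -> R.
Hypotheses (ms : measurable_fun setT s) (s1 : forall y, `|s y| <= 1).

Lemma integrable_osc a y : P.-integrable setT (fun w => (W w * s ((L w - a) * y))%:E).
Proof.
apply: (@integrable_Wmul _ 1) => // .
apply: (measurableT_comp ms); apply: measurable_funM => //.
exact: measurable_funB.
Qed.

Let F e a (z : R * T) := expR (- e * `|z.1|) * (W z.2 * s ((L z.2 - a) * z.1)).

Let mF e a : measurable_fun setT (F e a).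
Proof.
apply: measurable_funM; first exact: (measurableT_comp (measurable_expRN_norm e) measurable_fst).
apply: measurable_funM; first exact: (measurableT_comp mW measurable_snd).
apply: (measurableT_comp ms); apply: measurable_funM; last exact: measurable_fst.
apply: measurable_funB => //.
exact: (measurableT_comp mL measurable_snd).
Qed.

Let iF e a : 0 < e -> (mu \x P)%E.-integrable setT (EFin \o F e a).
Proof.
move=> e0.
have i0 := @integrable_prod _ (measurableTypeR R) _ T R mu P _ W (integrable_expRN_norm e0) iW.
apply: (integrable_dominated _ _ _ i0) => //; first exact: mF.
move=> z _; rewrite /F normrM (ger0_norm (expR_ge0 _)) ler_wpM2l ?expR_ge0//.
by rewrite normrM (ger0_norm (W0 _)) -[leRHS]mulr1 ler_wpM2l.
Qed.

Let innerE e a y : (\int[P]_w (F e a (y, w))%:E =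
  (expR (- e * `|y|) * \int[P]_w (W w * s ((L w - a) * y)))%:E)%E.
Proof.
rewrite /F /=; under eq_integral do rewrite EFinM.
rewrite integralZl//; last exact: integrable_osc.
rewrite EFinM; congr (_ * _)%E.
by rewrite /Rintegral fineK//; apply: integrable_fin_num => //; exact: integrable_osc.
Qed.

(** Measurability in y comes from Fubini's theorem, which asks for integrability over the whole
    line; the factor expR (- |y|) is inserted for that purpose and divided out again. *)
Lemma measurable_osc a : measurable_fun setT (fun y => \int[P]_w (W w * s ((L w - a) * y))).
Proof.
have h := measurable_fubini_F (iF a (@ltr01 R)).
have h2 : measurable_fun setT (fun y : R => (expR (- 1 * `|y|) * \int[P]_w (W w * s ((L w -
  a) * y)))).
  apply/measurable_EFinP; rewrite (_ : _ \o _ = fubini_F P (EFin \o F 1 a))//.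
  by apply/funext => y; rewrite /fubini_F /= innerE.
have h3 := measurable_funM (measurable_expRN_norm (-1)) h2.
rewrite (_ : (fun y => \int[P]_w _) = (fun y => expR (- -1 * `|y|) *
  (expR (- 1 * `|y|) * \int[P]_w (W w * s ((L w - a) * y)))))//.
by apply/funext => y; rewrite mulrA -expRD opprK mulN1r mul1r subrr expR0 mul1r.
Qed.

Lemma Fubini_osc e a : 0 < e ->
  \int[mu]_y (expR (- e * `|y|) * \int[P]_w (W w * s ((L w - a) * y))) =
  \int[P]_w (W w * \int[mu]_y (expR (- e * `|y|) * s ((L w - a) * y))).
Proof.
move=> e0; have h := Fubini (iF a e0).
congr fine; transitivity (\int[mu]_y (\int[P]_w (F e a (y, w))%:E))%E.
  by apply: eq_integral => y _; rewrite innerE.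
rewrite h; apply: eq_integral => w _; rewrite /F /=.
have i1 : mu.-integrable setT (fun y => (expR (- e * `|y|) * s ((L w - a) * y))%:E).
  by apply: integrable_expRN_norm_mul => //; apply: (measurableT_comp ms); exact: measurable_funM.
rewrite EFinM /Rintegral fineK; last exact: integrable_fin_num.
rewrite -integralZl//; apply: eq_integral => y _.
by rewrite -EFinM mulrCA.
Qed.

End oscillating.

(** The Poisson kernel of the half-plane at height [e], times 2 pi; this total mass is divided out
    in [dens]. *)
Definition poisson_kernel (e v : R) : R := 2 * (e / (e ^+ 2 + v ^+ 2)).

Lemma poisson_kernel_ge0 e v : 0 < e -> 0 <= poisson_kernel e v.
Proof. by move=> e0; rewrite /poisson_kernel mulr_ge0// divr_ge0 ?addr_ge0 ?sqr_ge0// ltW. Qed.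

Lemma poisson_kernel_le e v : 0 < e -> poisson_kernel e v <= 2 / e.
Proof.
move=> e0; rewrite /poisson_kernel ler_wpM2l// ler_pdivrMr;
  last by rewrite ltr_wpDr ?sqr_ge0// exprn_gt0.
by rewrite mulrDr expr2 mulrA mulVf ?gt_eqF// mul1r lerDl mulr_ge0 ?sqr_ge0// invr_ge0 ltW.
Qed.

Lemma measurable_poisson_kernel e : measurable_fun setT (poisson_kernel e).
Proof.
have [->|e0] := eqVneq e 0.
  have -> : poisson_kernel 0 = fun=> 0 by apply/funext => v; rewrite /poisson_kernel mul0r mulr0.
  exact: measurable_cst.
apply: continuous_measurable_fun => v.
have : 2 * (e * (e ^+ 2 + v ^+ 2)^-1) @[v --> v] --> poisson_kernel e v.
  apply: cvgMr; apply: cvgMr; apply: cvgV.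
    by rewrite gt_eqF// ltr_wpDr ?sqr_ge0// exprn_even_gt0.
  by apply: cvgD; [exact: cvg_cst|exact: exprn_continuous].
by [].
Qed.

Lemma is_derive_poisson_kernel (e v x : R) : 0 < e -> 0 < x ->
  is_derive x 1 (fun t => 2 * atan (e^-1 * (ln t - v))) (poisson_kernel e (v - ln x) / x).
Proof.
move=> e0 x0.
have h1 : is_derive x 1 (fun t => ln t - v) (x^-1 - 0).
  exact: (is_deriveB (is_derive1_ln x0) (is_derive_cst v x 1)).
have h2 : is_derive x 1 (fun t => e^-1 * (ln t - v)) (e^-1 *: (x^-1 - 0)) := is_deriveZ e^-1 h1.
have h3 := is_derive1_comp (is_derive1_atan _) h2.
have h4 : is_derive x 1 (fun t => 2 * atan (e^-1 * (ln t - v))) _ := is_deriveZ 2 h3.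
apply: is_derive_eq h4 _.
rewrite /GRing.scale /= subr0 /poisson_kernel.
have d0 : 0 < e ^+ 2 + (v - ln x) ^+ 2 by rewrite ltr_wpDr ?sqr_ge0// exprn_gt0.
have d1 : 0 < 1 + (e^-1 * (ln x - v)) ^+ 2 by rewrite ltr_wpDr ?sqr_ge0.
have -> : 1 + (e^-1 * (ln x - v)) ^+ 2 = (e ^+ 2 + (v - ln x) ^+ 2) / e ^+ 2.
  by field; rewrite gt_eqF.
by field; rewrite !gt_eqF.
Qed.

Lemma integral_poisson_kernel (e v p q : R) : 0 < e -> 0 < p -> p < q ->
  (\int[mu]_(x in `[p, q]) (poisson_kernel e (v - ln x) / x)%:E =
  (2 * atan (e^-1 * (ln q - v)) - 2 * atan (e^-1 * (ln p - v)))%:E)%E.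
Proof.
move=> e0 p0 pq.
apply: (@ge0_FTC_exhaust _ (fun x => poisson_kernel e (v - ln x) / x)
   (fun t => 2 * atan (e^-1 * (ln t - v))) _ (fun=> p) (fun=> q)) => //.
- by move=> x; rewrite /= in_itv/=; split => [h|[]//]; exists 0%N.
- by move=> x; rewrite /= in_itv/= => /andP[px _]; apply: is_derive_poisson_kernel => //;
    exact: lt_le_trans px.
- move=> x; rewrite /= in_itv/= => /andP[px _].
  have x0 : 0 < x by exact: lt_le_trans px.
  have : 2 * (e * (e ^+ 2 + (v - ln t) ^+ 2)^-1) * t^-1 @[t --> x] --> poisson_kernel e (v -
    ln x) / x.
    apply: cvgM; last by apply: cvgV => //; rewrite gt_eqF.
    apply: cvgMr; apply: cvgMr; apply: cvgV.
      by rewrite gt_eqF// ltr_wpDr ?sqr_ge0// exprn_gt0.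
    apply: cvgD; first exact: cvg_cst.
    rewrite expr2; under eq_fun do rewrite expr2.
    by apply: cvgM; (apply: cvgB; [exact: cvg_cst|exact: continuous_ln]).
  by [].
- exact: cvg_cst.
- exact: cvg_cst.
- move=> x; rewrite /= in_itv/= => /andP[px _].
  by rewrite divr_ge0 ?poisson_kernel_ge0// (le_trans _ px)// ltW.
Qed.

Definition smoothed e a := \int[P]_w (W w * poisson_kernel e (L w - a)).

Lemma integrable_smoothed e a : 0 < e -> P.-integrable setT (fun w => (W w * poisson_kernel e
  (L w - a))%:E).
Proof.
move=> e0; apply: (@integrable_Wmul _ (2 / e)).
  by apply: (measurableT_comp (measurable_poisson_kernel e)); exact: measurable_funB.
by move=> w; rewrite ger0_norm ?poisson_kernel_ge0// poisson_kernel_le.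
Qed.

Lemma smoothedE e a : 0 < e ->
  (\int[P]_w (W w * poisson_kernel e (L w - a))%:E)%E = (smoothed e a)%:E.
Proof.
move=> e0; rewrite /smoothed /Rintegral fineK//.
by apply: integrable_fin_num => //; exact: integrable_smoothed.
Qed.

Lemma smoothed_ge0 e a : 0 < e -> 0 <= smoothed e a.
Proof. by move=> e0; apply: Rintegral_ge0 => w _; rewrite mulr_ge0 ?W0 ?poisson_kernel_ge0. Qed.

Let mG e : measurable_fun setT (fun z : T * R => (W z.1 * poisson_kernel e (L z.1 - ln z.2))%:E).
Proof.
apply/measurable_EFinP; apply: measurable_funM; first exact: (measurableT_comp mW measurable_fst).
apply: (measurableT_comp (measurable_poisson_kernel e)); apply: measurable_funB.
  exact: (measurableT_comp mL measurable_fst).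
exact: (measurableT_comp (@measurable_ln R) measurable_snd).
Qed.

Lemma measurable_smoothed e : 0 < e -> measurable_fun setT (fun x => smoothed e (ln x)).
Proof.
move=> e0.
have h := @measurable_fun_fubini_tonelli_G _ _ T (measurableTypeR R) R P _ (mG e)
   (fun z => _).
apply/measurable_EFinP.
rewrite (_ : _ \o _ = fubini_G P (fun z : T * R => (W z.1 * poisson_kernel e (L z.1 - ln
  z.2))%:E)).
  by apply: h; move=> z; rewrite lee_fin mulr_ge0 ?W0 ?poisson_kernel_ge0.
by apply/funext => x; rewrite /fubini_G /= smoothedE.
Qed.

(** Tonelli's theorem and the primitive 2 atan((ln x - v) / e); the factor 1/x is the Jacobian of
    the logarithm. As e tends to 0, the difference of arctangents tends to 2 pi when p < e^L < q and
    to 0 when e^L lies outside [[p, q]]. *)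
Lemma integral_smoothed e p q : 0 < e -> 0 < p -> p < q ->
  (\int[mu]_(x in `[p, q]) (smoothed e (ln x) / x)%:E =
   \int[P]_w (W w * (2 * atan (e^-1 * (ln q - L w)) - 2 * atan (e^-1 * (ln p - L w))))%:E)%E.
Proof.
move=> e0 p0 pq.
pose Phi (z : T * R) := W z.1 * poisson_kernel e (L z.1 - ln z.2) * ((\1_`[p, q]) z.2 / z.2).
have i0 (x : R) : 0 <= \1_`[p, q] x / x.
  rewrite indicE; case: (boolP (x \in _)) => xpq; last by rewrite mul0r.
  by rewrite mul1r invr_ge0; move: xpq; rewrite inE/= in_itv/= => /andP[px _];
    rewrite (le_trans _ px)// ltW.
have mV : measurable_fun setT (fun x : R => \1_`[p, q] x / x).
  have -> : (fun x : R => \1_`[p, q] x / x) = (fun x : R => x^-1) \_ `[p, q].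
    by apply/funext => x; rewrite patchE indicE; case: (boolP (x \in _)) => _;
      rewrite ?mul1r ?mul0r.
  apply/(measurable_restrictT _ _).1 => //.
  apply: subspace_continuous_measurable_fun => //.
  apply: continuous_in_subspaceT => x; rewrite inE/= in_itv/= => /andP[px _].
  by apply: cvgV => //; rewrite gt_eqF// (lt_le_trans p0).
have mPhi : measurable_fun setT (EFin \o Phi).
  apply/measurable_EFinP; apply: measurable_funM; first by apply/measurable_EFinP; exact: mG.
  exact: (measurableT_comp mV measurable_snd).
have Phi0 z : (0 <= (EFin \o Phi) z)%E.
  by rewrite /= lee_fin /Phi mulr_ge0// mulr_ge0 ?W0 ?poisson_kernel_ge0.
have h := @fubini_tonelli _ _ T (measurableTypeR R) R P mu (EFin \o Phi) mPhi Phi0.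
transitivity (\int[mu]_x \int[P]_w (EFin \o Phi) (w, x))%E.
  rewrite integral_mkcond; apply: eq_integral => x _; rewrite /Phi /=.
  under [RHS]eq_integral do rewrite EFinM.
  rewrite integralZr//; last exact: integrable_smoothed.
  rewrite smoothedE// -EFinM patchE indicE.
  by case: (boolP (x \in _)) => _; rewrite ?mul0r ?mulr0// mul1r.
rewrite -h; apply: eq_integral => w _ /=.
rewrite EFinM -integral_poisson_kernel// -ge0_integralZl//; last 3 first.
- apply/measurable_EFinP.
  have mk : measurable_fun setT (fun x : R => poisson_kernel e (L w - ln x) * (\1_`[p, q] x / x)).
    apply: measurable_funM => //; apply: (measurableT_comp (measurable_poisson_kernel e)).
    by apply: measurable_funB => //; exact: measurable_ln.
  apply: (eq_measurable_fun (fun x : R => poisson_kernel e (L w - ln x) * (\1_`[p, q] x / x))).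
    by move=> x xpq; rewrite indicE xpq mul1r.
  exact: measurable_funTS.
- move=> x; rewrite /= in_itv/= => /andP[px _].
  by rewrite lee_fin divr_ge0 ?poisson_kernel_ge0// (le_trans _ px)// ltW.
- by rewrite lee_fin.
rewrite [RHS]integral_mkcond; apply: eq_integral => x _.
rewrite /Phi /= patchE indicE -EFinM -mulrA.
by case: (boolP (x \in _)) => _; rewrite ?mul0r ?mulr0// mul1r.
Qed.

End mellin_kernel.

Lemma complex_lin (R : realType) (p q r s l : R) :
  (p +i* q) + (r +i* s) * l%:C = (p + r * l) +i* (q + s * l).
Proof.
by rewrite -complexr0; simpc.
Qed.

Lemma expC_pair (R : realType) (p q : R) :
  expC (p +i* q) = (expR p * cos q) +i* (expR p * sin q).
Proof. by apply: eq_complexP; rewrite ?Re_expC ?Im_expC. Qed.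

Lemma ae_eq_preimage d (T : measurableType d) (R : realType) (P : probability T R)
    (X Y : T -> R) (B : set R) :
  measurable_fun setT X -> measurable_fun setT Y -> {ae P, forall w, X w = Y w} ->
  measurable B -> P (X @^-1` B) = P (Y @^-1` B).
Proof.
move=> mX mY [N [mN N0 sN]] mB.
have mA1 : measurable (X @^-1` B) by rewrite -[X in measurable X]setTI; exact: mX.
have mA2 : measurable (Y @^-1` B) by rewrite -[X in measurable X]setTI; exact: mY.
rewrite -[X @^-1` B]setIT -[Y @^-1` B]setIT -!integral_indic//.
apply: ge0_ae_eq_integral => //.
- by apply/measurable_EFinP.
- by apply/measurable_EFinP.
exists N; split => // w hw; apply: sN => w0; apply: hw => _ /=; congr (_%:E).
rewrite !indicE; congr (_%:R); congr (nat_of_bool _).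
by apply/idP/idP; rewrite !inE /= w0.
Qed.

(** * From the Mellin transform on one vertical line to the density *)

Section mellin.
Context d (T : measurableType d) {R : realType} (P : probability T R).
Local Notation mu := (@lebesgue_measure R).
Variables (X : T -> R) (c K : R) (M : R -> R[i]).
Hypotheses (mX : measurable_fun setT X) (X0 : P (X @^-1` `]-oo, 0]) = 0%E)
  (K0 : 0 <= K)
  (iW : P.-integrable setT (fun w => (expR ((c - 1) * ln (X w)))%:E))
  (ME : forall y, M y = cintegral P setT (fun w => cpow (X w) ((c - 1) +i* y)))
  (MK : forall y, sqn (M y) <= (K / (1 + y ^+ 2)) ^+ 2).

Let L (w : T) : R := ln (X w).
Let W (w : T) : R := expR ((c - 1) * L w).

Let mL : measurable_fun setT L.
Proof. exact: (measurableT_comp (@measurable_ln R) mX). Qed.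

Let W0 w : 0 <= W w. Proof. exact: expR_ge0. Qed.

Let mW : measurable_fun setT W.
Proof. by apply/measurable_EFinP; exact: measurable_int iW. Qed.

Let iW' : P.-integrable setT (EFin \o W) := iW.

Let mcos : measurable_fun setT (@cos R).
Proof. by apply: continuous_measurable_fun; exact: continuous_cos. Qed.
Let msin : measurable_fun setT (@sin R).
Proof. by apply: continuous_measurable_fun; exact: continuous_sin. Qed.

(** The inversion integrand at x = e^a stripped of the factor x^(-c); [h] and [k] are its real and
    imaginary parts, written as means over the probability space. *)
Let E (a y : R) : R[i] := M y * expC (0 +i* (- (y * a))).
Let h a y := \int[P]_w (W w * cos ((L w - a) * y)).
Let k a y := \int[P]_w (W w * sin ((L w - a) * y)).

Let EE a y : E a y = h a y +i* k a y.
Proof.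
have ci : cintegrable P setT (fun w => cpow (X w) ((c - 1) +i* y)).
  apply: (@cintegrable_dominated _ _ _ _ _ _ W) => //.
    have [c1 c2] := @cmeasurable_cpow R setT ((c - 1) +i* y).
    by split; [exact: (measurableT_comp c1 mX)|exact: (measurableT_comp c2 mX)].
  by move=> w _; rewrite sqn_cpow.
rewrite /E ME mulrC -cintegralZ//.
have Q w : expC (0 +i* (- (y * a))) * cpow (X w) ((c - 1) +i* y) =
    (W w * cos ((L w - a) * y)) +i* (W w * sin ((L w - a) * y)).
  rewrite /cpow -expCD complex_lin expC_pair add0r.
  by rewrite (_ : - (y * a) + y * ln (X w) = (L w - a) * y)// /L; ring.
by rewrite /cintegral; congr (_ +i* _); apply: eq_Rintegral => w _; rewrite Q.
Qed.

Let E_bound a y : `|h a y| <= K / (1 + y ^+ 2) /\ `|k a y| <= K / (1 + y ^+ 2).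
Proof.
have p : 0 <= K / (1 + y ^+ 2) by rewrite divr_ge0// addr_ge0// sqr_ge0.
have s : sqn (h a y +i* k a y) <= (K / (1 + y ^+ 2)) ^+ 2.
  by rewrite -EE /E sqnM sqn_expC expR0 expr1n mulr1.
by split; [exact: (ler_Re p s)|exact: (ler_Im p s)].
Qed.

Let mh a : measurable_fun setT (h a).
Proof. exact: (measurable_osc mL W0 iW' mcos (@cos_max R)). Qed.
Let mk a : measurable_fun setT (k a).
Proof. exact: (measurable_osc mL W0 iW' msin (@sin_max R)). Qed.

Let eps (n : nat) : R := n.+1%:R^-1.
Let eps0 n : 0 < eps n. Proof. by rewrite /eps invr_gt0. Qed.

(* Abel summation: the factor expR (- eps n * |y|) turns the inversion integral
   into a mean of Poisson kernels centred at ln X. *)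
Let abel_limit (f : R -> R) : measurable_fun setT f ->
  (forall y, `|f y| <= K / (1 + y ^+ 2)) ->
  mu.-integrable setT (EFin \o f) /\
  \int[mu]_y (expR (- eps n * `|y|) * f y) @[n --> \oo] --> \int[mu]_y f y.
Proof.
move=> mf fK; apply: (@Rintegral_dominated_cvg _ _ _ mu setT measurableT
   (fun n y => expR (- eps n * `|y|) * f y) f (fun y => K / (1 + y ^+ 2))).
- by move=> n; apply: measurable_funM => //; exact: measurable_expRN_norm.
- move=> y _; rewrite -[X in _ --> X]mul1r; apply: cvgMl.
  have h0 : - eps n * `|y| @[n --> \oo] --> (0 : R).
    by rewrite -(mul0r `|y|) -oppr0; apply: cvgMl; apply: cvgN; exact: cvg_harmonic.
  by rewrite -expR0; exact: (cvg_comp _ _ h0 (@continuous_expR R 0)).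
- move=> n y _; rewrite normrM ger0_norm ?expR_ge0//; apply: le_trans (fK y).
  rewrite -[leRHS]mul1r ler_wpM2r// -expR0 ler_expR mulNr oppr_le0.
  by rewrite mulr_ge0// ltW.
- exact: integrable_invDsqr.
Qed.

Definition mellin_real a := \int[mu]_y h a y.
Let H := mellin_real.

Let smoothed_abel n a : smoothed P W L (eps n) a = \int[mu]_y (expR (- eps n * `|y|) * h a y).
Proof.
rewrite (Fubini_osc mL W0 iW' mcos (@cos_max R))//; apply: eq_Rintegral => w _.
by rewrite poisson_cos.
Qed.

Let smoothed_cvg a : smoothed P W L (eps n) a @[n --> \oo] --> H a.
Proof.
under eq_fun do rewrite smoothed_abel.
by apply: (abel_limit _ _).2 => // y; exact: (E_bound a y).1.
Qed.

(** With the even Abel factor the odd sine integrates to 0, and the limit inherits this: the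
    inversion integral is real. *)
Let k_int0 a : \int[mu]_y k a y = 0.
Proof.
have h1 : \int[mu]_y (expR (- eps n * `|y|) * k a y) @[n --> \oo] --> \int[mu]_y k a y.
  by apply: (abel_limit _ _).2 => // y; exact: (E_bound a y).2.
have h2 : \int[mu]_y (expR (- eps n * `|y|) * k a y) @[n --> \oo] --> (0 : R).
  have -> : (fun n => \int[mu]_y (expR (- eps n * `|y|) * k a y)) = (fun=> 0).
    apply/funext => n; rewrite (Fubini_osc mL W0 iW' msin (@sin_max R))//.
    rewrite (_ : (fun w => _) = (fun=> 0)) ?Rintegral_cst ?mul0r//.
    by apply/funext => w; rewrite poisson_sin// mulr0.
  exact: cvg_cst.
exact: (cvg_unique _ h1 h2).
Qed.

(** As a limit of means of nonnegative kernels, [H] is nonnegative at every point; [has_pdf] demands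
    this pointwise and not only almost everywhere. *)
Let H_ge0 a : 0 <= H a.
Proof.
have h0 : (0 : R) @[n --> \oo] --> (0 : R) by exact: cvg_cst.
refine (ler_cvg_to h0 (@smoothed_cvg a) _).
by apply: nearW => n; exact: smoothed_ge0.
Qed.

Let C := \int[mu]_y (K / (1 + y ^+ 2)).

(** Uniform in [n] and [a]: it provides the dominating function when the limit is taken under the
    integral in [piece]. *)
Let smoothed_leC n a : smoothed P W L (eps n) a <= C.
Proof.
rewrite smoothed_abel.
apply: le_Rintegral => //.
- apply: (integrable_dominated _ _ _ (integrable_invDsqr K)) => //.
    by apply: measurable_funM; [exact: measurable_expRN_norm|exact: mh].
  move=> y _; rewrite normrM ger0_norm ?expR_ge0//; apply: le_trans (E_bound a y).1.
  rewrite -[leRHS]mul1r ler_wpM2r// -expR0 ler_expR mulNr oppr_le0.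
  by rewrite mulr_ge0// ltW.
- exact: integrable_invDsqr.
- move=> y _; apply: le_trans (ler_norm _) _.
  rewrite normrM ger0_norm ?expR_ge0//; apply: le_trans (E_bound a y).1.
  rewrite -[leRHS]mul1r ler_wpM2r// -expR0 ler_expR mulNr oppr_le0.
  by rewrite mulr_ge0// ltW.
Qed.

Let mHln : measurable_fun setT (fun x => H (ln x)).
Proof.
apply: (@measurable_fun_cvg _ _ _ setT (fun n x => smoothed P W L (eps n) (ln x))).
- by move=> n; exact: (measurable_smoothed mL W0 iW').
- by move=> x _; exact: smoothed_cvg.
Qed.

Let atan_limit (z : R) : atan ((eps n)^-1 * z) @[n --> \oo] --> pi / 2 * Num.sg z.
Proof.
have pos (u : R) : 0 < u -> atan ((eps n)^-1 * u) @[n --> \oo] --> pi / 2.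
  move=> u0.
  have h0 : n.+1%:R @[n --> \oo] --> (+oo : set_system R).
    by have := @cvgr_idn R; rewrite -(cvg_shiftn 1); under eq_fun do rewrite addn1.
  have h1 : (eps n)^-1 * u @[n --> \oo] --> (+oo : set_system R).
    by under eq_fun do rewrite /eps invrK; exact: (cvg_comp _ _ h0 (gt0_cvgMly u0 cvg_id)).
  exact: (cvg_comp _ _ h1 (@cvgy_atan R)).
have [z0|z0|->] := ltgtP z 0.
- rewrite ltr0_sg// mulrN1; have -> : z = - (- z) by rewrite opprK.
  by under eq_fun do rewrite mulrN atanN; apply: cvgN; apply: pos; rewrite oppr_gt0.
- by rewrite gtr0_sg// mulr1; exact: pos.
- by rewrite sgr0 mulr0; under eq_fun do rewrite mulr0 atan0; exact: cvg_cst.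
Qed.

Let atan_bound (z : R) : `|atan z| <= pi / 2.
Proof. by rewrite ler_norml ltW ?atan_gtNpi2// ltW// atan_ltpi2. Qed.

Let sg_meas (u : R) : measurable_fun setT (fun w => Num.sg (u - L w)).
Proof.
apply: (@measurable_fun_cvg _ _ _ setT (fun n w => (pi / 2)^-1 * atan ((eps n)^-1 * (u - L w)))).
- move=> n; apply: measurable_funM => //.
  apply: (measurableT_comp (f := @atan R)).
    by apply: continuous_measurable_fun; exact: continuous_atan.
  by apply: measurable_funM => //; exact: measurable_funB.
- move=> w _; have p0 : pi / 2 != 0 :> R by rewrite gt_eqF// divr_gt0// pi_gt0.
  rewrite -[X in _ --> X](mulKf p0); apply: cvgMr; exact: atan_limit.
Qed.

(** The limit of [integral_smoothed]. The signs vanish at p and q, so an atom there would count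
    half; [dens_ray] disposes of these half weights. *)
Let piece p q : 0 < p -> p < q ->
  \int[mu]_(x in `[p, q]) (H (ln x) / x) =
  \int[P]_w (W w * (pi * (Num.sg (ln q - L w) - Num.sg (ln p - L w)))).
Proof.
move=> p0 pq.
have mV : measurable_fun `[p, q] (fun x : R => x^-1).
  apply: subspace_continuous_measurable_fun => //.
  apply: continuous_in_subspaceT => x; rewrite inE/= in_itv/= => /andP[px _].
  by apply: cvgV => //; rewrite gt_eqF// (lt_le_trans p0).
have h1 : \int[mu]_(x in `[p, q]) (smoothed P W L (eps n) (ln x) / x) @[n --> \oo] -->
    \int[mu]_(x in `[p, q]) (H (ln x) / x).
  apply: (@Rintegral_dominated_cvg _ _ _ mu `[p,
    q] _ (fun n x => smoothed P W L (eps n) (ln x) / x)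
    _ (fun=> C / p) _ _ _ _).2 => //.
  - move=> n; apply: measurable_funM => //; apply: measurable_funTS.
    exact: (measurable_smoothed mL W0 iW').
  - by move=> x _; apply: cvgMl; exact: smoothed_cvg.
  - move=> n x; rewrite /= in_itv/= => /andP[px _].
    have x0 : 0 < x by exact: lt_le_trans px.
    have s0 : 0 <= smoothed P W L (eps n) (ln x) by exact: smoothed_ge0.
    rewrite ger0_norm; last by rewrite divr_ge0// ltW.
    apply: ler_pM => //; first by rewrite invr_ge0 ltW.
    by rewrite lef_pV2.
  - apply/integrableP; split; first exact: measurable_cst.
    by rewrite integral_cst//= lte_mul_pinfty// lebesgue_measure_itv/= lte_fin pq -EFinB ltry.
have h2 : \int[P]_w (W w * (2 * atan ((eps n)^-1 * (ln q - L w)) - 2 * atan ((eps n)^-1 * (ln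
  p - L w))))
   @[n --> \oo] --> \int[P]_w (W w * (pi * (Num.sg (ln q - L w) - Num.sg (ln p - L w)))).
  have ma (n : nat) (u : R) : measurable_fun setT (fun w => 2 * atan ((eps n)^-1 * (u - L w))).
    apply: measurable_funM => //; apply: (measurableT_comp (f := @atan R)).
      by apply: continuous_measurable_fun; exact: continuous_atan.
    by apply: measurable_funM => //; exact: measurable_funB.
  apply: (@Rintegral_dominated_cvg _ _ _ P setT measurableT (fun n w => W w * (2 * atan ((eps
    n)^-1 * (ln q - L w)) - 2 * atan ((eps n)^-1 * (ln p - L w))))
    _ (fun w => (2 * pi) * W w) _ _ _ _).2.
  - by move=> n; apply: measurable_funM => //; apply: measurable_funB.
  - move=> w _; apply: cvgMr.
    have [hp hpE] : exists hp : R, hp = pi / 2 by exists (pi / 2).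
    rewrite mulrBr (_ : pi = 2 * hp); last by rewrite hpE; field.
    by rewrite -!mulrA; apply: cvgB; apply: cvgMr; rewrite hpE; exact: atan_limit.
  - move=> n w _; rewrite normrM ger0_norm// mulrC ler_wpM2r//.
    have := atan_bound ((eps n)^-1 * (ln q - L w)); have :=
      atan_bound ((eps n)^-1 * (ln p - L w)).
    rewrite !ler_norml => /andP[? ?] /andP[? ?]; apply/andP; split; lra.
  - by have := integrableZl measurableT (2 * pi) iW'; under eq_fun do rewrite -EFinM.
have e n : \int[mu]_(x in `[p, q]) (smoothed P W L (eps n) (ln x) / x) =
    \int[P]_w (W w * (2 * atan ((eps n)^-1 * (ln q - L w)) - 2 * atan ((eps n)^-1 * (ln p - L
      w)))).
  by congr fine; exact: (integral_smoothed mL W0 iW').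
move: h1; under eq_fun do rewrite e; move=> h1.
exact: (cvg_unique _ h1 h2).
Qed.

Let sg_expR (u : R) w : 0 < u -> Num.sg (ln u - L w) = Num.sg (u - expR (L w)).
Proof.
move=> u0; have [h1|h1|h1] := ltgtP (expR (L w)) u.
- by rewrite !gtr0_sg// subr_gt0// -ltr_expR lnK.
- by rewrite !ltr0_sg// subr_lt0// -ltr_expR lnK.
- by rewrite -h1 expRK !subrr.
Qed.

(** The density of the image under e^L of P weighted by [W], that is x^(c-1) times the density
    sought; the law of X itself is recovered at the end. *)
Let dens (x : R) : R := (2 * pi)^-1 * (H (ln x) / x) * \1_(`]0, +oo[%classic) x.

Let pi2_gt0 : 0 < 2 * pi :> R.
Proof. by rewrite mulr_gt0// pi_gt0. Qed.

Let dens_ge0 x : 0 <= dens x.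
Proof.
rewrite /dens indicE; case: (boolP (x \in _)) => x0; last by rewrite mulr0.
rewrite mulr1 mulr_ge0 ?invr_ge0 ?(ltW pi2_gt0)// divr_ge0//.
by move: x0; rewrite inE/= in_itv/= andbT => /ltW.
Qed.

Let mHx (D : set R) : measurable D -> D `<=` `]0, +oo[%classic ->
  measurable_fun D (fun x => H (ln x) / x).
Proof.
move=> mD D0; apply: measurable_funM; first exact: measurable_funTS.
have m0 : measurable_fun (`]0, +oo[%classic : set R) (fun x : R => x^-1).
  apply: open_continuous_measurable_fun; first exact: interval_open.
  move=> x; rewrite inE/= in_itv/= andbT => x0.
  by apply: cvgV => //; rewrite gt_eqF.
by apply: measurable_funS D0 m0.
Qed.

Let mdens : measurable_fun setT dens.
Proof.
have -> : dens = (fun x => (2 * pi)^-1 * (H (ln x) / x)) \_ `]0, +oo[%classic.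
  apply/funext => x; rewrite /dens patchE indicE.
  by case: (boolP (x \in _)) => _; rewrite ?mulr1 ?mulr0.
apply/(measurable_restrictT _ _).1 => //.
by apply: measurable_funM => //; exact: mHx.
Qed.

(** Exhaust the ray by the pieces from r + 1/(n+1) to r + n + 2: monotone convergence on the side of
    [dens], dominated convergence under P. *)
Let dens_ray (r : R) : 0 <= r ->
  (\int[mu]_(x in `]r, +oo[) (dens x)%:E =
   \int[P]_(w in [set w | (r < expR (L w))%R]) (W w)%:E)%E.
Proof.
move=> r0; have [h1 h2 h3] := exhaust_oy r.
pose p n : R := r + n.+1%:R^-1; pose q n : R := r + n.+2%:R.
have p0 n : 0 < p n by rewrite /p ltr_wpDl// invr_gt0.
have q0 n : 0 < q n by exact: (lt_trans (p0 n) (h1 n)).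
have DE : `]r, +oo[%classic = \bigcup_n `[p n, q n]%classic := exhaust_bigcup h3.
have sub n : `[p n, q n]%classic `<=` `]0, +oo[%classic.
  by move=> x; rewrite /= !in_itv/= andbT => /andP[px _]; exact: lt_le_trans (p0 n) px.
have l1 : (\int[mu]_(x in `[p n, q n]) (dens x)%:E)%E @[n --> \oo] -->
    (\int[mu]_(x in `]r, +oo[) (dens x)%:E)%E.
  rewrite DE; apply: ge0_nondecreasing_set_cvg_integral => //.
  - move=> n m nm; apply/subsetPset => x/=; rewrite !in_itv/= => /andP[a b].
    by have [e1 e2] := h2 _ _ nm; rewrite (le_trans e1 a) (le_trans b e2).
  - by move=> n; apply/measurable_EFinP; exact: measurable_funTS.
  - by move=> n x _; rewrite lee_fin.
have l2 : (2 * pi)^-1 * \int[P]_w (W w * (pi * (Num.sg (ln (q n) - L w) - Num.sg (ln (p n) -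
  L w))))
    @[n --> \oo] --> (2 * pi)^-1 * \int[P]_w (W w * (2 * pi * \1_[set w | r < expR (L w)] w)).
  apply: cvgMr.
  apply: (@Rintegral_dominated_cvg _ _ _ P setT measurableT (fun n w => W w * (pi * (Num.sg
    (ln (q n) - L w) - Num.sg (ln (p n) - L w))))
    _ (fun w => (2 * pi) * W w) _ _ _ _).2.
  - by move=> n; apply: measurable_funM => //; apply: measurable_funM => //;
      exact: measurable_funB.
  - move=> w _; apply: cvgMr; rewrite [2 * _]mulrC -mulrA; apply: cvgMr.
    (* For each w both signs are eventually constant and nonzero, so the limit is the exact
       indicator of r < e^L. *)
    have big : \forall n \near \oo, Num.sg (ln (q n) - L w) = 1.
      exists (Num.truncn (expR (L w))) => // n /= hn.
      rewrite sg_expR// gtr0_sg// subr_gt0 (lt_le_trans (truncnS_gt _))// /q.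
      by rewrite -[leLHS]add0r lerD// ler_nat ltnS leqW.
    have [rw|rw] := ltP r (expR (L w)); last first.
      rewrite indicE memNset ?mulr0; last by move=> /=; apply/negP; rewrite -leNgt.
      apply: cvg_near_cst; apply: filterS big => n ->.
      by rewrite sg_expR// gtr0_sg ?subrr// subr_gt0 (le_lt_trans rw)// /p ltrDl invr_gt0.
    rewrite indicE mem_set// mulr1.
    have small : \forall n \near \oo, Num.sg (ln (p n) - L w) = -1.
      have d0 : 0 < expR (L w) - r by rewrite subr_gt0.
      exists (Num.truncn (expR (L w) - r)^-1) => // n /= hn.
      rewrite sg_expR// ltr0_sg// subr_lt0 /p addrC -ltrBrDr.
      rewrite invf_plt ?posrE//; apply: lt_le_trans (truncnS_gt _) _.
      by rewrite ler_nat ltnS.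
    apply: cvg_near_cst; near=> n.
    have -> : Num.sg (ln (q n) - L w) = 1 by near: n.
    have -> : Num.sg (ln (p n) - L w) = -1 by near: n.
    by rewrite opprK.
  - move=> n w _; rewrite normrM ger0_norm// mulrC ler_wpM2r//.
    rewrite normrM gtr0_norm ?pi_gt0// mulrC ler_wpM2r ?(ltW (pi_gt0 R))//.
    by apply: le_trans (ler_normB _ _) _; rewrite !normr_sg (_ : 2 = 1 + 1)//; apply: lerD;
      case: eqP.
  - by have := integrableZl measurableT (2 * pi) iW'; under eq_fun do rewrite -EFinM.
have pieceE n : (\int[mu]_(x in `[p n, q n]) (dens x)%:E)%E =
   ((2 * pi)^-1 * \int[P]_w (W w * (pi * (Num.sg (ln (q n) - L w) - Num.sg (ln (p n) - L
     w)))))%:E.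
  rewrite -piece//; last exact: h1.
  have ib : mu.-integrable `[p n, q n] (fun x => (H (ln x) / x)%:E).
    have iC : mu.-integrable `[p n, q n] (EFin \o (fun=> C / p n)).
      apply/integrableP; split; first exact: measurable_cst.
      by rewrite integral_cst//= lte_mul_pinfty// lebesgue_measure_itv/= lte_fin h1 -EFinB ltry.
    apply: (integrable_dominated _ _ _ iC) => //; first exact: mHx.
    move=> x; rewrite /= in_itv/= => /andP[px _].
    have x0 : 0 < x by exact: lt_le_trans px.
    rewrite ger0_norm; last by rewrite divr_ge0// ltW.
    apply: ler_pM => //; first by rewrite invr_ge0 ltW.
      have sC : smoothed P W L (eps n) (ln x) @[n --> \oo] --> H (ln x) by exact: smoothed_cvg.
      have cC : C @[_ --> \oo] --> (C : R) by exact: cvg_cst.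
      by apply: (ler_cvg_to sC cC); apply: nearW => m; exact: smoothed_leC.
    by rewrite lef_pV2 ?posrE ?p0//.
  rewrite EFinM /Rintegral fineK; last exact: integrable_fin_num.
  rewrite -integralZl//; apply: eq_integral => x; rewrite inE => xpq.
  by rewrite /dens indicE mem_set ?mulr1//; exact: sub xpq.
have l3 : (\int[mu]_(x in `[p n, q n]) (dens x)%:E)%E @[n --> \oo] -->
   ((2 * pi)^-1 * \int[P]_w (W w * (2 * pi * \1_[set w | r < expR (L w)] w)))%:E.
  by under eq_fun do rewrite pieceE; apply: cvg_EFin; [exact: nearW|].
rewrite (cvg_unique _ l1 l3)//.
have mr : measurable [set w | r < expR (L w)].
  have -> : [set w | r < expR (L w)] = setT `&` (expR \o L) @^-1` `]r, +oo[.
    by rewrite setTI; apply/seteqP; split => w /=; rewrite in_itv/= andbT.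
  exact: (measurableT_comp (@measurable_expR R) mL).
have -> : \int[P]_w (W w * (2 * pi * \1_[set w | r < expR (L w)] w)) =
   (2 * pi) * \int[P]_(w in [set w | r < expR (L w)]) W w.
  rewrite -RintegralZl//; last by apply: integrableS iW'.
  rewrite [RHS]Rintegral_mkcond; apply: eq_Rintegral => w _.
  rewrite patchE indicE; case: (boolP (w \in _)) => _; last by rewrite !mulr0.
  by rewrite mulr1 mulrC.
rewrite mulKf ?gt_eqF// /Rintegral fineK//.
by apply: integrable_fin_num => //; apply: integrableS iW'.
Unshelve. all: by end_near. Qed.

Let dens_restrict (f : R -> R) (A : set R) :
  (\int[mu]_(x in A) (f x * dens x)%:E =
   \int[mu]_(x in A `&` `]0%R, +oo[) (f x * ((2 * pi)^-1 * (H (ln x) / x)))%:E)%E.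
Proof.
rewrite integral_mkcondr; apply: eq_integral => x _.
rewrite /dens /patch indicE; case: ifP => _; first by rewrite mulr1.
by rewrite !mulr0.
Qed.

Let dens_ray_all (r : R) :
  (\int[mu]_(x in `]r, +oo[) (dens x)%:E =
   \int[P]_(w in [set w | (r < expR (L w))%R]) (W w)%:E)%E.
Proof.
have [r0|r0] := leP 0 r; first exact: dens_ray.
have -> : [set w | r < expR (L w)] = [set w | 0 < expR (L w)].
  by apply/seteqP; split => w _ /=; [exact: expR_gt0|exact: lt_trans r0 (expR_gt0 _)].
rewrite -dens_ray//.
under eq_integral do rewrite -[dens _]mul1r.
rewrite dens_restrict; under [RHS]eq_integral do rewrite -[dens _]mul1r.
rewrite [RHS]dens_restrict; congr integral.
apply/seteqP; split => x /=; rewrite !in_itv/= !andbT; first by move=> [].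
by move=> [x0 _]; split => //; exact: lt_trans x0.
Qed.

(** Agreement on rays determines the weighted law. The variable e^L replaces X: it is positive
    everywhere and equals X almost surely. *)
Let law_eq (f : R -> \bar R) : measurable_fun setT f -> (forall x, 0 <= f x)%E ->
  (\int[P]_w (f (expR (L w)) * (W w)%:E) = \int[mu]_x (f x * (dens x)%:E))%E.
Proof.
move=> mf f0.
have [m1 m1E] := density_measure_ex P mW W0.
have [m2 m2E] := @density_measure_ex _ (measurableTypeR R) R mu dens mdens dens_ge0.
have meL : measurable_fun setT (expR \o L) by exact: (measurableT_comp (@measurable_expR R) mL).
have m1oo : (m1 setT < +oo)%E.
  rewrite m1E//; have /integrableP[_] := iW'; apply: le_lt_trans.
  apply: ge0_le_integral => //.
  - by move=> w _; rewrite lee_fin.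
  - exact/measurable_EFinP.
  - by apply: measurableT_comp => //; exact/measurable_EFinP.
  - by move=> w _; rewrite /= lee_fin ler_norm.
have rays (r : R) : m1 ((expR \o L) @^-1` `]r, +oo[) = m2 (id @^-1` `]r, +oo[).
  rewrite preimage_id m2E//.
  have -> : (expR \o L) @^-1` `]r, +oo[ = [set w | r < expR (L w)].
    by apply/seteqP; split => w /=; rewrite in_itv/= andbT.
  rewrite dens_ray_all m1E//.
  have -> : [set w | r < expR (L w)] = setT `&` (expR \o L) @^-1` `]r, +oo[.
    by rewrite setTI; apply/seteqP; split => w /=; rewrite in_itv/= andbT.
  exact: meL.
have hl := @ge0_integral_eq_law _ T _ (measurableTypeR R) R m1 m2 (expR \o L) id meL
  (@measurable_id _ _ _) m1oo rays f mf f0.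
rewrite -(@ge0_integral_density _ _ _ P W mW W0 m1 m1E (fun w => f (expR (L w))))//; last first.
  exact: (measurableT_comp mf meL).
rewrite -(@ge0_integral_density _ (measurableTypeR R) R mu dens mdens dens_ge0 m2 m2E f mf f0).
exact: hl.
Qed.

Let preimage_expR (B : set R) : measurable B -> P (X @^-1` B) = P ((expR \o L) @^-1` B).
Proof.
move=> mB.
have meL : measurable_fun setT (expR \o L) by exact: (measurableT_comp (@measurable_expR R) mL).
apply: ae_eq_preimage => //.
have [N [mN N0 sN]] := ae_pos mX X0.
by exists N; split => // w hw; apply: sN => w0; apply: hw; rewrite /= /L lnK.
Qed.

Let iE a : cintegrable mu setT (E a).
Proof.
have [i1 _] := abel_limit (mh a) (fun y => (E_bound a y).1).
have [i2 _] := abel_limit (mk a) (fun y => (E_bound a y).2).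
by split; [move: i1|move: i2]; apply: eq_integrable => // y _; rewrite EE.
Qed.

Let integrandE x y : M y * cpow x (- (c +i* y)) = (expR (- c * ln x))%:C * E (ln x) y.
Proof.
rewrite /E [RHS]mulrCA.
suff -> : cpow x (- (c +i* y)) = (expR (- c * ln x))%:C * expC (0 +i* (- (y * ln x))) by [].
have -> : (expR (- c * ln x))%:C = expC ((- c * ln x) +i* 0) by rewrite complexr0 expC_real.
rewrite -expCD; congr expC; have e0 := complex_lin 0 0 (- c) (- y) (ln x).
by move: e0; rewrite !add0r => ->; apply: eq_complexP; rewrite /= ?addr0 ?add0r ?mulNr.
Qed.

Lemma mellin_integrable x :
  cintegrable mu setT (fun y => M y * cpow x (- (c +i* y))).
Proof.
suff -> : (fun y => M y * cpow x (- (c +i* y))) =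
    (fun y => (expR (- c * ln x))%:C * E (ln x) y) by exact/cintegrableZ/iE.
by apply/funext => y; exact: integrandE.
Qed.

Theorem mellin_inversion : has_pdf P X (fun x =>
  ((2 * pi)^-1)%:C * integralC setT (fun y => M y * cpow x (- (c +i* y)))).
Proof.
split => //.
exists (fun x => (2 * pi)^-1 * (expR (- c * ln x) * H (ln x))); split.
- apply: measurable_funM => //; apply: measurable_funM; first exact: measurable_rpow.
  exact: measurable_funTS.
- by move=> x x0; rewrite mulr_ge0 ?invr_ge0 ?(ltW pi2_gt0)// mulr_ge0// expR_ge0.
- move=> x x0; rewrite rmorphM; congr (_ * _).
  transitivity (cintegral mu setT (fun y => (expR (- c * ln x))%:C * E (ln x) y)).
    by apply: (eq_cintegral mu) => y _; exact: integrandE.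
  rewrite (cintegralZ _ measurableT (iE (ln x))).
  rewrite rmorphM; congr (_ * _).
  apply: eq_complexP.
    by apply: eq_Rintegral => y _; rewrite EE.
  by rewrite -[RHS](k_int0 (ln x)); apply: eq_Rintegral => y _; rewrite EE.
- move=> B mB; rewrite preimage_expR//.
  (* The factor x^(1-c) cancels the weight x^(c-1), leaving the indicator of B on the side of P. *)
  pose f (x : R) := (expR ((1 - c) * ln x) * \1_B x)%:E.
  have mf : measurable_fun setT f.
    apply/measurable_EFinP; apply: measurable_funM; first exact: measurable_rpow.
    exact: measurable_indic.
  have f0 x : (0 <= f x)%E by rewrite lee_fin mulr_ge0 ?expR_ge0// indicE.
  have meL : measurable_fun setT (expR \o L) by exact: (measurableT_comp (@measurable_expR R) mL).
  have mA2 : measurable ((expR \o L) @^-1` B) by rewrite -[X in measurable X]setTI; exact: meL.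
  have := law_eq mf f0.
  rewrite (_ : (\int[P]_w _)%E = P ((expR \o L) @^-1` B)); last first.
    rewrite -[X in P X]setIT -integral_indic//; apply: eq_integral => w _.
    rewrite /f expRK -EFinM mulrAC -expRD (_ : (1 - c) * L w + (c - 1) * L w = 0); last by ring.
    by rewrite expR0 mul1r.
  move=> ->; rewrite /f; under eq_integral do rewrite -EFinM.
  rewrite dens_restrict setTI [RHS]integral_mkcondl; apply: eq_integral => x.
  rewrite inE/= in_itv/= andbT => x0.
  rewrite patchE indicE; case: (boolP (x \in _)) => _; last by rewrite mulr0 mul0r.
  rewrite mulr1; congr (_%:E).
  have -> : expR ((1 - c) * ln x) = x * expR (- c * ln x).
    by rewrite mulrDl mul1r expRD lnK.
  by move: ((2 * pi)^-1 : R) => u; field; rewrite gt_eqF.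
Qed.

End mellin.

(** * Independence *)

Section comp_law.
Local Open Scope ereal_scope.
Context d1 (T1 : measurableType d1) d2 (T2 : measurableType d2) (R : realType).
Variables (m1 : {measure set T1 -> \bar R}) (m2 : {measure set T2 -> \bar R}).
Variables (phi : T1 -> T2).
Hypothesis (mphi : measurable_fun setT phi).
Hypothesis mE : forall A, measurable A -> m2 A = m1 (phi @^-1` A).

Let pphi : {mfun T1 >-> T2} := HB.pack phi (isMeasurableFun.Build _ _ _ _ _ mphi).

Let pushE (f : T2 -> \bar R) : \int[m2]_x f x = \int[pushforward m1 pphi]_x f x.
Proof. by apply: eq_measure_integral => A mA _; rewrite mE. Qed.

Lemma integrable_law (f : T2 -> R) : measurable_fun setT f ->
  m2.-integrable setT (EFin \o f) <-> m1.-integrable setT (EFin \o (f \o phi)).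
Proof.
move=> mf; have mf' : measurable_fun setT (EFin \o f) by exact/measurable_EFinP.
have e : \int[m2]_x `|(f x)%:E| = \int[m1]_x `|(f (phi x))%:E|.
  rewrite pushE ge0_integral_pushforward ?preimage_setT//.
  exact: measurableT_comp.
split => /integrableP[_ h]; apply/integrableP; split => //.
- by apply/measurable_EFinP; exact: measurableT_comp.
- by rewrite -e.
- by rewrite e.
Qed.

Lemma integral_law (f : T2 -> R) : measurable_fun setT f ->
  m1.-integrable setT (EFin \o (f \o phi)) ->
  \int[m2]_x (f x)%:E = \int[m1]_x (f (phi x))%:E.
Proof.
move=> mf i1; have mf' : measurable_fun setT (EFin \o f) by exact/measurable_EFinP.
rewrite pushE.
have := @integral_pushforward _ _ _ _ R _ mphi m1 setT (EFin \o f) mf' i1 measurableT.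
by rewrite preimage_setT.
Qed.

Lemma cintegrable_law (f : T2 -> R[i]) : cmeasurable setT f ->
  cintegrable m2 setT f <-> cintegrable m1 setT (f \o phi).
Proof.
move=> [f1 f2]; split => -[i1 i2]; split.
- exact: (integrable_law f1).1.
- exact: (integrable_law f2).1.
- exact: (integrable_law f1).2.
- exact: (integrable_law f2).2.
Qed.

Lemma cintegral_law (f : T2 -> R[i]) : cmeasurable setT f ->
  cintegrable m1 setT (f \o phi) ->
  cintegral m2 setT f = cintegral m1 setT (f \o phi).
Proof.
move=> [f1 f2] [i1 i2]; congr (fine _ +i* fine _).
  exact: (integral_law f1).
exact: (integral_law f2).
Qed.

End comp_law.

Section independent_pair.
Context d (T : measurableType d) {R : realType} (P : probability T R).
Variables (X Y : T -> measurableTypeR R).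
Hypotheses (mX : measurable_fun setT X) (mY : measurable_fun setT Y).
Hypothesis indep : forall A B, measurable A -> measurable B ->
  P (X @^-1` A `&` Y @^-1` B) = (P (X @^-1` A) * P (Y @^-1` B))%E.

Let pX : {RV P >-> measurableTypeR R} := HB.pack X (isMeasurableFun.Build _ _ _ _ _ mX).
Let pY : {RV P >-> measurableTypeR R} := HB.pack Y (isMeasurableFun.Build _ _ _ _ _ mY).
Let XY w : measurableTypeR R * measurableTypeR R := (X w, Y w).

Let mXY : measurable_fun setT XY.
Proof. exact: measurable_fun_pair. Qed.

Let pXY : {mfun T >-> (measurableTypeR R * measurableTypeR R)%type} :=
  HB.pack XY (isMeasurableFun.Build _ _ _ _ _ mXY).

Let lawXY A : measurable A ->
  (distribution P pX \x distribution P pY)%E A = P (XY @^-1` A).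
Proof.
move=> mA; rewrite (@product_measure_unique _ _ _ _ _ _ _ (pushforward P pXY))//.
Qed.

Lemma cintegral_indep (f g : R -> R[i]) : cmeasurable setT f -> cmeasurable setT g ->
  cintegrable P setT (f \o X) -> cintegrable P setT (g \o Y) ->
  cintegrable P setT (fun w => f (X w) * g (Y w)) /\
  cintegral P setT (fun w => f (X w) * g (Y w)) =
  cintegral P setT (f \o X) * cintegral P setT (g \o Y).
Proof.
move=> mf mg fi gi.
have lX A : measurable A -> distribution P pX A = P (X @^-1` A) by [].
have lY A : measurable A -> distribution P pY A = P (Y @^-1` A) by [].
have fi' := (cintegrable_law mX lX mf).2 fi.
have gi' := (cintegrable_law mY lY mg).2 gi.
have fgi := cintegrable_prod fi' gi'.
have mfg : cmeasurable setT (fun z : measurableTypeR R * measurableTypeR R => f z.1 * g z.2).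
  have [f1 f2] := mf; have [g1 g2] := mg.
  apply: cmeasurableM; split.
  - exact: (measurableT_comp f1 measurable_fst).
  - exact: (measurableT_comp f2 measurable_fst).
  - exact: (measurableT_comp g1 measurable_snd).
  - exact: (measurableT_comp g2 measurable_snd).
have h := (cintegrable_law mXY lawXY mfg).1 fgi.
split; first exact: h.
rewrite -(cintegral_law mX lX mf fi) -(cintegral_law mY lY mg gi).
rewrite -cintegral_prod//.
by rewrite (cintegral_law mXY lawXY mfg h).
Qed.

End independent_pair.

Section independent_event.
Local Open Scope ereal_scope.
Context d (T : measurableType d) {R : realType} (P : probability T R).
Context d1 (T1 : measurableType d1) d2 (T2 : measurableType d2).
Variables (X : T -> T1) (Y : T -> T2) (E : set T).
Hypotheses (mX : measurable_fun setT X) (mY : measurable_fun setT Y) (mE : measurable E).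
Hypothesis rect : forall A B, measurable A -> measurable B ->
  P (X @^-1` A `&` Y @^-1` B `&` E) = P (X @^-1` A `&` Y @^-1` B) * P E.

(** Rectangles are stable under intersection and generate the product sigma-algebra; the sets C with
    the product formula form a Dynkin system. *)
Lemma independent_event_pair (C : set (T1 * T2)) : measurable C ->
  P ((fun w => (X w, Y w)) @^-1` C `&` E) = P ((fun w => (X w, Y w)) @^-1` C) * P E.
Proof.
pose Z w := (X w, Y w); rewrite -/Z.
have mZ : measurable_fun setT Z by exact: measurable_fun_pair.
have mpre A : measurable A -> measurable (Z @^-1` A).
  by move=> mA; rewrite -[X in measurable X]setTI; exact: mZ.
rewrite measurable_prod_measurableType.
move: C; apply: dynkin_induction => /=.
- by rewrite measurable_prod_measurableType.
- move=> _ _ [A1 mA1 [A2 mA2 <-]] [B1 mB1 [B2 mB2 <-]].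
  exists (A1 `&` B1); first exact: measurableI.
  by exists (A2 `&` B2); [exact: measurableI|rewrite setXI].
- by rewrite preimage_setT setTI probability_setT mul1e.
- by move=> _ [A mA [B mB <-]]; exact: rect.
- move=> S mS h; rewrite -!preimage_setC.
  rewrite probability_setC; last exact: mpre.
  have -> : ~` (Z @^-1` S) `&` E = E `\` (Z @^-1` S `&` E).
    by apply/seteqP; split => w /=; [move=> [a b]; split=> // -[]|move=> [a b]; split=> // c;
      exact: b].
  have -> : P (E `\` (Z @^-1` S `&` E)) = P E - P (Z @^-1` S `&` E).
    have m1 : measurable (Z @^-1` S `&` E) by apply: measurableI => //; exact: mpre.
    have oo : P E < +oo by rewrite (le_lt_trans (probability_le1 _ _)) ?ltry.
    by have := measureD mE m1 oo; rewrite setICA setIid.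
  rewrite h.
  have /fineK <- : P E \is a fin_num by exact: fin_num_measure.
  have /fineK <- : P (Z @^-1` S) \is a fin_num by exact/fin_num_measure/mpre.
  by rewrite -EFinM -!EFinB -EFinM mulrBl mul1r.
- move=> F mF tF h; rewrite !preimage_bigcup setI_bigcupl.
  have tZ : trivIset [set: nat] (fun k => Z @^-1` F k).
    by apply/trivIsetP => i j _ _ ij; have /trivIsetP/(_ i j I I ij) := tF;
      rewrite -preimage_setI => ->; rewrite preimage_set0.
  have m1 k : measurable (Z @^-1` F k `&` E) by apply: measurableI => //; exact: mpre.
  have m2 k : measurable (Z @^-1` F k) by exact: mpre.
  have e1 := @measure_bigcup _ _ _ P setT _ (fun k _ => m1 k) (trivIset_setIr tZ).
  have e2 := @measure_bigcup _ _ _ P setT _ (fun k _ => m2 k) tZ.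
  transitivity (\sum_(k <oo | k \in [set: nat]) P (Z @^-1` F k `&` E)); first exact: e1.
  transitivity (P E * \sum_(k <oo | k \in [set: nat]) P (Z @^-1` F k)); last first.
    by rewrite muleC; congr (_ * _).
  have /fineK <- : P E \is a fin_num by exact: fin_num_measure.
  rewrite -nneseriesZl//; apply: eq_eseriesr => k _.
  by rewrite fineK ?fin_num_measure// muleC; exact: h.
Qed.

End independent_event.

Section independent_family.
Context d (T : measurableType d) {R : realType} (P : probability T R).
Context (I : finType) (L : I -> T -> measurableTypeR R).
Hypothesis mL : forall i, measurable_fun setT (L i).
Hypothesis indep : forall B, (forall i, measurable (B i)) ->
  fine (P (\bigcap_(i in [set: I]) L i @^-1` B i)) = \prod_i fine (P (L i @^-1` B i)).

Let rect (B : I -> set (measurableTypeR R)) := \bigcap_(i in [set: I]) L i @^-1` B i.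

Let mpre i (A : set (measurableTypeR R)) : measurable A -> measurable (L i @^-1` A).
Proof. by move=> mA; rewrite -[X in measurable X]setTI; exact: mL. Qed.

Let mrect B : (forall i, measurable (B i)) -> measurable (rect B).
Proof.
by move=> mB; apply: fin_bigcap_measurable => // i _; exact: mpre.
Qed.

Let PM (A B C : set T) : measurable A -> measurable B -> measurable C ->
  fine (P A) = fine (P B) * fine (P C) -> P A = (P B * P C)%E.
Proof.
move=> mA mB mC h; rewrite -[LHS]fineK ?fin_num_measure// h EFinM !fineK//.
  exact: fin_num_measure.
exact: fin_num_measure.
Qed.

(** A constraint [setT] leaves an index free, so product formulas for the full family also express
    independence of subfamilies; [set_at] then constrains one free index. *)
Let set_at (B : I -> set (measurableTypeR R)) i A := fun j => if j == i then A else B j.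

Let rect_set_at B i A : B i = setT -> rect (set_at B i A) = L i @^-1` A `&` rect B.
Proof.
move=> Bi; apply/seteqP; split => w /= h.
  split; first by have := h i Logic.I; rewrite /set_at/= eqxx; exact.
  by move=> j _ /=; have := h j Logic.I; rewrite /set_at/=; case: eqP => [->|//]; rewrite Bi.
by move=> j _; rewrite /set_at/=; case: eqP => [->|_]; [case: h|exact: h.2].
Qed.

Let rectM B i A : (forall i, measurable (B i)) -> measurable A -> B i = setT ->
  P (L i @^-1` A `&` rect B) = (P (L i @^-1` A) * P (rect B))%E.
Proof.
move=> mB mA Bi; apply: PM.
- by apply: measurableI; [exact: mpre|exact: mrect].
- exact: mpre.
- exact: mrect.
rewrite -rect_set_at// indep; last by move=> j; rewrite /set_at; case: eqP.
rewrite indep// [in LHS](bigD1 i)//= [in RHS](bigD1 i)//= /set_at eqxx Bi.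
rewrite preimage_setT probability_setT mul1r; congr (_ * _).
by apply: eq_bigr => j /negbTE ->.
Qed.

Let S (s : seq I) w := \sum_(i <- s) L i w.

Let mS s : measurable_fun setT (S s : T -> measurableTypeR R).
Proof. exact: measurable_sum. Qed.

(* Sums are added one variable at a time: by Dynkin's lemma the pair made of the
   partial sum and the next variable is independent of the other variables. *)
Let indep_sum_rect s : uniq s -> forall C B, measurable C -> (forall i, measurable (B i)) ->
  (forall i, i \in s -> B i = setT) ->
  P (S s @^-1` C `&` rect B) = (P (S s @^-1` C) * P (rect B))%E.
Proof.
elim: s => [_ C B mC mB _|i s IH /=/andP[si us] C B mC mB BT].
  have -> : S [::] = cst 0 by apply/funext => w; rewrite /S big_nil.
  rewrite preimage_cst; case: ifP => _; first by rewrite setTI probability_setT mul1e.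
  by rewrite set0I measure0 mul0e.
pose A : set (measurableTypeR R * measurableTypeR R) := (fun z => z.2 + z.1) @^-1` C.
have mA : measurable A.
  rewrite -[X in measurable X]setTI.
  exact: (measurable_funD (@measurable_snd _ _ (measurableTypeR R) (measurableTypeR R))
    (@measurable_fst _ _ (measurableTypeR R) (measurableTypeR R))).
have SA : S (i :: s) @^-1` C = (fun w => (S s w, L i w)) @^-1` A.
  by apply/seteqP; split => w; rewrite /S /A /= big_cons.
rewrite SA; apply: independent_event_pair => //; first exact: mS.
  exact: mrect.
move=> F G mF mG.
have Bi : B i = setT by apply: BT; rewrite mem_head.
have BTs j : j \in s -> set_at B i G j = setT.
  by move=> js; rewrite /set_at; case: eqP js si => [-> ->//|_ js _]; rewrite BT// inE js orbT.
have mBG j : measurable (set_at B i G j) by rewrite /set_at; case: eqP.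
rewrite -setIA -rect_set_at// IH// rect_set_at// rectM// muleA; congr (_ * _)%E.
have -> : L i @^-1` G = rect (set_at (fun=> setT) i G).
  rewrite rect_set_at// [X in _ `&` X](_ : _ = setT) ?setIT//.
  by apply/seteqP; split.
rewrite IH//; first by move=> j; rewrite /set_at; case: eqP.
by move=> j js; rewrite /set_at; case: eqP js si => [-> ->|].
Qed.

(** Induction along the enumeration of [I]: by [indep_sum_rect] the head is independent of the sum
    over the tail, so the mean of the product of exponentials factors. *)
Lemma cintegral_exp_sum (z : R[i]) :
  (forall i, cintegrable P setT (fun w => expC (z * (L i w)%:C))) ->
  cintegrable P setT (fun w => expC (z * (\sum_i L i w)%:C)) /\
  cintegral P setT (fun w => expC (z * (\sum_i L i w)%:C)) =
  \prod_i cintegral P setT (fun w => expC (z * (L i w)%:C)).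
Proof.
move=> iL.
suff h s : uniq s -> cintegrable P setT (fun w => expC (z * (S s w)%:C)) /\
    cintegral P setT (fun w => expC (z * (S s w)%:C)) =
    \prod_(i <- s) cintegral P setT (fun w => expC (z * (L i w)%:C)).
  exact: h (index_enum_uniq I).
elim: s => [_|i s IH /=/andP[si us]].
  have e : (fun w => expC (z * (S [::] w)%:C)) = cst 1.
    by apply/funext => w; rewrite /S big_nil mulr0 expC0.
  rewrite e big_nil; split.
    split => /=; first exact: finite_measure_integrable_cst.
    exact: finite_measure_integrable_cst.
  have P1 : fine (P setT) = 1 by rewrite probability_setT.
  apply: eq_complexP; rewrite /= Rintegral_cst//.
    exact: etrans (congr1 _ P1) (mulr1 1).
  by rewrite mul0r.
have [s1 s2] := IH us.
pose f x : R[i] := expC (z * x%:C).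
have mf : cmeasurable setT f.
  apply: cmeasurable_expC; apply: cmeasurableM; first exact: cmeasurable_cst.
  exact: cmeasurable_real.
have ind A B : measurable A -> measurable B ->
    P (L i @^-1` A `&` S s @^-1` B) = (P (L i @^-1` A) * P (S s @^-1` B))%E.
  move=> mA mB; rewrite setIC muleC.
  have -> : L i @^-1` A = rect (set_at (fun=> setT) i A).
    rewrite rect_set_at// [X in _ `&` X](_ : _ = setT) ?setIT//.
    by apply/seteqP; split.
  rewrite indep_sum_rect//; first by move=> j; rewrite /set_at; case: eqP.
  by move=> j js; rewrite /set_at; case: eqP js si => [-> ->|].
have [h1 h2] := cintegral_indep (mL i) (mS s) ind mf mf (iL i) s1.
have e : (fun w => expC (z * (S (i :: s) w)%:C)) = (fun w => f (L i w) * f (S s w)).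
  by apply/funext => w; rewrite /f -expCD -mulrDr -rmorphD /S big_cons.
by rewrite e big_cons -s2.
Qed.

End independent_family.

(** * Densities as Fox H-functions *)

Section point_modification.
Context {R : realType}.
Local Notation mu := (@lebesgue_measure R).

(** Removes the effect of the default value of chi at s = 1. Writing [g] as [f] plus a multiple of
    the indicator of a point supplies the measurability of [g]. *)
Lemma eq_Rintegral_off (f g : R -> R) (x0 : R) : measurable_fun setT f ->
  (forall x, x != x0 -> f x = g x) ->
  \int[mu]_x f x = \int[mu]_x g x.
Proof.
move=> mf fg.
have gE : g = (fun x => f x + (g x0 - f x0) * \1_[set x0] x).
  apply/funext => x; rewrite indicE.
  have [->|xx0] := eqVneq x x0; first by rewrite mem_set// mulr1 addrCA subrr addr0.
  by rewrite memNset ?mulr0 ?addr0 ?fg//= => e; move: xx0; rewrite e eqxx.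
have m1 : measurable ([set x0] : set R) by exact: measurable_set1.
have mg : measurable_fun setT g.
  rewrite gE; apply: measurable_funD => //; apply: measurable_funM => //.
congr fine; apply: ae_eq_integral => //; [exact/measurable_EFinP|exact/measurable_EFinP|].
exists [set x0]; split => //; first exact: lebesgue_measure_set1.
move=> x /= h; apply/eqP/negP => /negP xx0; apply: h => _.
by rewrite fg.
Qed.

Lemma eq_integralC_off (f g : R -> R[i]) (x0 : R) : cintegrable mu setT f ->
  (forall x, x != x0 -> f x = g x) -> integralC setT f = integralC setT g.
Proof.
move=> [f1 f2] fg; congr (_ +i* _); apply: (@eq_Rintegral_off _ _ x0).
- by apply/measurable_EFinP; exact: measurable_int f1.
- by move=> x /fg ->.
- by apply/measurable_EFinP; exact: measurable_int f2.
- by move=> x /fg ->.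
Qed.

End point_modification.

Section has_pdf_congr.
Context d (T : measurableType d) {R : realType} (P : probability T R).

Lemma eq_has_pdf (X : T -> R) (F G : R -> R[i]) :
  (forall x, 0 < x -> F x = G x) -> has_pdf P X F -> has_pdf P X G.
Proof.
move=> FG [mX [f [mf f0 Ff PX]]]; split => //; exists f; split => // x x0.
by rewrite -FG// Ff.
Qed.

Lemma ae_eq_has_pdf (X Y : T -> R) (F : R -> R[i]) : measurable_fun setT Y ->
  {ae P, forall w, Y w = X w} -> has_pdf P X F -> has_pdf P Y F.
Proof.
move=> mY YX [mX [f [mf f0 Ff PX]]]; split => //; exists f; split => // B mB.
by rewrite -PX//; exact: ae_eq_preimage.
Qed.

End has_pdf_congr.

Section decay.
Context {R : realType}.
Implicit Types (f g : R -> R[i]).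

Definition quadratic_decay f :=
  exists2 K : R, 0 <= K & forall y, sqn (f y) <= (K / (1 + y ^+ 2)) ^+ 2.

Let sq0 (y : R) : 0 < 1 + y ^+ 2.
Proof. by rewrite ltr_pwDl// sqr_ge0. Qed.

Lemma quadratic_decayM f g : quadratic_decay f -> quadratic_decay g ->
  quadratic_decay (fun y => f y * g y).
Proof.
move=> [K K0 fK] [K' K'0 gK]; exists (K * K') => [|y]; first exact: mulr_ge0.
rewrite sqnM; apply: le_trans (_ : (K / (1 + y ^+ 2)) ^+ 2 * K' ^+ 2 <= _); last first.
  by rewrite -exprMn mulrAC.
apply: ler_pM; rewrite ?sqn_ge0//; apply: le_trans (gK y) _.
rewrite ler_pXn2r// ?nnegrE// ?divr_ge0// ?(ltW (sq0 y))//.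
by rewrite ler_pdivrMr// ler_peMr// lerDl sqr_ge0.
Qed.

(** The witness [i0] excludes the empty product, which is 1 and does not decay. *)
Lemma quadratic_decay_prod (I : finType) (i0 : I) (f : I -> R -> R[i]) :
  (forall i, quadratic_decay (f i)) -> quadratic_decay (fun y => \prod_i f i y).
Proof.
move=> fK.
suff h s i : quadratic_decay (fun y => \prod_(j <- i :: s) f j y).
  have := mem_index_enum i0; case: (index_enum I) => // i s _; exact: h.
elim: s i => [|j s IH] i.
  suff -> : (fun y => \prod_(k <- [:: i]) f k y) = f i by exact: fK.
  by apply/funext => y; rewrite big_seq1.
suff -> : (fun y => \prod_(k <- i :: j :: s) f k y) =
    (fun y => f i y * \prod_(k <- j :: s) f k y) by exact: quadratic_decayM.
by apply/funext => y; rewrite big_cons.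
Qed.

Lemma quadratic_decayZ z f : quadratic_decay f -> quadratic_decay (fun y => z * f y).
Proof.
move=> [K K0 fK]; exists (Num.sqrt (sqn z) * K) => [|y]; first by rewrite mulr_ge0// sqrtr_ge0.
by rewrite sqnM -mulrA exprMn sqr_sqrtr ?sqn_ge0// ler_wpM2l ?sqn_ge0.
Qed.

Lemma quadratic_decay_eq f g : (forall y, sqn (f y) = sqn (g y)) ->
  quadratic_decay f -> quadratic_decay g.
Proof. by move=> fg [K K0 fK]; exists K => // y; rewrite -fg. Qed.

Lemma quadratic_decay_comp f (r : R) : r != 0 -> quadratic_decay f ->
  quadratic_decay (fun y => f (r * y)).
Proof.
(* The constant comes from 1 + y^2 <= (1 + r^(-2)) (1 + r^2 y^2). *)
move=> r0 [K K0 fK]; exists (K * (1 + r ^- 2)) => [|y].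
  by rewrite mulr_ge0// addr_ge0// invr_ge0 sqr_ge0.
have v0 : 0 <= r ^- 2 by rewrite invr_ge0 sqr_ge0.
have K'0 : 0 <= K * (1 + r ^- 2) by rewrite mulr_ge0// addr_ge0.
apply: le_trans (fK _) _; rewrite (ler_pXn2r (ltn0Sn 1)) ?nnegrE; last 2 first.
- exact: (divr_ge0 K0 (ltW (sq0 _))).
- exact: (divr_ge0 K'0 (ltW (sq0 _))).
rewrite ler_pdivrMr// mulrAC ler_pdivlMr// -mulrA ler_wpM2l//.
have r2 : 0 < r ^+ 2 by rewrite exprn_even_gt0.
rewrite exprMn mulrDl mul1r mulrDr mulr1 mulKf ?gt_eqF//.
have v2 : 0 < r ^- 2 by rewrite invr_gt0.
have : 0 <= r ^+ 2 * y ^+ 2 by rewrite mulr_ge0 ?sqr_ge0.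
lra.
Qed.

End decay.

(** The Mellin transform of e^Lam at s = c + i y. With logarithms, products and quotients of
    subordinators become sums and differences. *)
Definition line_moment d (T : measurableType d) (R : realType) (P : probability T R)
    (Lam : T -> R) (c y : R) : R[i] :=
  cintegral P setT (fun w => expC (((c - 1) +i* y) * (Lam w)%:C)).

Definition line_integrable d (T : measurableType d) (R : realType) (P : probability T R)
    (Lam : T -> R) (c y : R) :=
  cintegrable P setT (fun w => expC (((c - 1) +i* y) * (Lam w)%:C)).

(* For ratios the chosen line may be Re s = 1, and chi has a junk value at s = 1,
   where poles cancel; hence ME is only required for y != 0. *)
Section fox_pdf.
Context d (T : measurableType d) {R : realType} (P : probability T R).
Variables (m n : nat) (aA bB : seq (R[i] * R)) (X Lam : T -> R) (c A tau : R).
Hypotheses (mX : measurable_fun setT X) (mLam : measurable_fun setT Lam)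
  (XE : {ae P, forall w, X w = expR (Lam w)})
  (cE : xget 0 [set c | separates m n aA bB c] = c)
  (A0 : 0 < A) (tau0 : 0 < tau)
  (iM : line_integrable P Lam c 0)
  (MK : quadratic_decay (line_moment P Lam c))
  (ME : forall y, y != 0 -> line_moment P Lam c y =
    A%:C * chi m n aA bB (c +i* y) * cpow tau (c +i* y)).

Lemma fox_pdf : has_pdf P X (fun x => A%:C * foxH m n aA bB (x / tau) 0).
Proof.
have meL : measurable_fun setT (expR \o Lam).
  exact: (measurableT_comp (@measurable_expR R) mLam).
apply: (ae_eq_has_pdf mX XE).
have X0 : P ((expR \o Lam) @^-1` `]-oo, 0]) = 0%E.
  rewrite (_ : _ @^-1` _ = set0) ?measure0//; apply/seteqP; split => w //=.
  by rewrite in_itv/= leNgt expR_gt0.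
have iW' : P.-integrable setT (fun w => (expR ((c - 1) * ln ((expR \o Lam) w)))%:E).
  have [i1 _] := iM; move: i1; apply: eq_integrable => // w _ /=; congr (_%:E).
  by rewrite expRK !mul0r !mulr0 !subr0 add0r cos0 mulr1.
pose M := line_moment P Lam c; have [K K0 MKy] := MK.
have ME' y : M y = cintegral P setT (fun w => cpow ((expR \o Lam) w) ((c - 1) +i* y)).
  by apply: (eq_cintegral P) => w _; rewrite /cpow /= expRK.
have := mellin_inversion meL X0 K0 iW' ME' MKy.
apply: eq_has_pdf => x x0.
have iMx := mellin_integrable meL K0 iW' ME' MKy x.
have AC : A%:C != 0 :> R[i] by rewrite eq_complex /= gt_eqF.
pose g y := chi m n aA bB (c +i* y) * expC (- (c +i* y) * (ln (x / tau) +i* 0)).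
have gE y : y != 0 -> A%:C^-1 * (M y * cpow x (- (c +i* y))) = g y.
  move=> y0; rewrite /M ME// /g.
  have -> : expC (- (c +i* y) * (ln (x / tau) +i* 0)) =
      cpow tau (c +i* y) * cpow x (- (c +i* y)).
    rewrite /cpow -expCD; congr expC.
    rewrite complexr0 ln_div// rmorphB; ring.
  move: (chi _ _ _ _ _) (cpow tau _) (cpow x _) => u v w.
  by rewrite !mulrA mulVf// mul1r.
rewrite /foxH /vertical_integral cE.
have -> : integralC setT (fun y => chi m n aA bB (c +i* y) *
    expC (- (c +i* y) * (ln (x / tau) +i* 0))) =
    A%:C^-1 * integralC setT (fun y => M y * cpow x (- (c +i* y))).
  rewrite -[RHS](cintegralZ _ measurableT iMx).
  (* The integrands agree except possibly at y = 0, the real point s = c of the line. *)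
  apply/esym/(eq_integralC_off (x0 := 0)); first exact: cintegrableZ.
  exact: gE.
move: (integralC _ _) => I.
have i0 : 'i != 0 :> R[i] by rewrite eq_complex /= oner_eq0 andbF.
have p0 : pi%:C != 0 :> R[i] by rewrite eq_complex /= gt_eqF// pi_gt0.
have -> : ((2 * pi)^-1)%:C = (2 * pi%:C)^-1 :> R[i].
  by rewrite (fmorphV (real_complex R)) (rmorphM (real_complex R)) rmorph_nat.
move: p0; move: (pi : R) => p p0.
by field; apply/and3P; split.
Qed.

End fox_pdf.

(** * The moment function of a stable variable *)

Section stable_moment.
Context {R : realType}.
Variables (b t : R).
Hypotheses (b01 : 0 < b < 1) (t0 : 0 < t).

(** The value of E[D^(-u)]. Unlike Gamma(u/b) / Gamma(u), this form also holds at u = 0, the point s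
    = 1 of a Mellin line. *)
Definition stable_moment (u : R[i]) : R[i] :=
  cpow t (- u / b%:C) * (Gamma_integral (1 + u / b%:C) / Gamma_integral (1 + u)).

Let b0 : 0 < b. Proof. by have /andP[] := b01. Qed.

Let bC : b%:C != 0 :> R[i]. Proof. by rewrite eq_complex /= gt_eqF. Qed.

Let ReVb u : complex.Re (u / b%:C) = complex.Re u / b.
Proof. by rewrite -fmorphV ReM ReC ImC mulr0 subr0. Qed.

Let ImVb u : complex.Im (u / b%:C) = complex.Im u / b.
Proof. by rewrite -fmorphV ImM ReC ImC mulr0 add0r. Qed.

Let Re1 (u : R[i]) : - b < complex.Re u -> 0 < complex.Re (1 + u).
Proof. by move=> h; rewrite ReD /=; have /andP[] := b01; lra. Qed.

Lemma stable_moment_decay (x : R) : - b < x -> quadratic_decay (fun y => stable_moment (x +i* y)).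
Proof.
move=> bx; have [K K0 h] := Gamma_ratio b01 bx.
exists (expR (- x / b * ln t) * K) => [|y]; first by rewrite mulr_ge0// ?expR_ge0// ltW.
rewrite sqnM sqn_cpow mulNr ReN ReVb -mulNr -mulrA exprMn ler_wpM2l ?sqr_ge0//.
have n0 : 0 < sqn (Gamma_integral (1 + (x +i* y))).
  by rewrite lt_def sqn_ge0 sqn_eq0 andbT; exact/Gamma_integral_neq0/Re1.
rewrite sqnM sqnV ler_pdivrMr//; move: (h y).
have -> : (1 + x / b) +i* (y / b) = 1 + (x +i* y) / b%:C :> R[i].
  by apply: eq_complexP; rewrite ?ReD ?ImD ?ReVb ?ImVb//= add0r.
suff -> : (1 + x) +i* y = 1 + (x +i* y) :> R[i] by [].
by apply: eq_complexP; rewrite ?ReD ?ImD//= add0r.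
Qed.

(** Gamma(1 + v) = v Gamma(v) at v = u/b and at v = u; the quotient of the two factors is 1/b, the
    origin of the factors 1/beta in the densities. *)
Lemma stable_momentE u : - b < complex.Re u -> u != 0 ->
  stable_moment u = b%:C^-1 * cpow t (- u / b%:C) * (Gamma (u / b%:C) / Gamma u).
Proof.
move=> bu u0.
have g0 : Gamma_integral (1 + u) != 0 by exact/Gamma_integral_neq0/Re1.
rewrite !GammaE//.
- rewrite /stable_moment ![_ + 1]addrC; move: g0.
  move: (Gamma_integral _) (Gamma_integral _) (cpow _ _) => g h p g0.
  by field; apply/and3P; split.
- by have /andP[] := b01; lra.
- by rewrite ReVb ltr_pdivlMr// mulN1r.
- by rewrite mulf_neq0// invr_eq0.
Qed.

Context d (T : measurableType d) (P : probability T R) (D : T -> R).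
Hypotheses (mD : measurable_fun setT D) (D0 : P (D @^-1` `]-oo, 0]) = 0%E).
Hypothesis laplace : forall s, 0 < s ->
  (\int[P]_w (expR (- s * D w))%:E)%E = (expR (- t * s `^ b))%:E.

Lemma cintegral_stable u : - b < complex.Re u ->
  cintegrable P setT (fun w => expC (- u * (ln (D w))%:C)) /\
  cintegral P setT (fun w => expC (- u * (ln (D w))%:C)) = stable_moment u.
Proof.
move=> bu; have [nu nuE] := @exp_law_ex R.
have [ci e] := cpow_moment mD D0 b01 t0 laplace nuE bu; split => //.
have g0 : Gamma_integral (1 + u) != 0 by exact/Gamma_integral_neq0/Re1.
apply: (mulfI g0); rewrite [LHS]e /stable_moment mulrCA; congr (_ * _).
by rewrite mulrCA mulfV// mulr1.
Qed.

End stable_moment.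

Section cpow_powR.
Context {R : realType}.
Implicit Types (x y p : R) (z w : R[i]).

Lemma cpowD x z w : cpow x (z + w) = cpow x z * cpow x w.
Proof. by rewrite /cpow mulrDl expCD. Qed.

Lemma cpow_mul x y z : 0 < x -> 0 < y -> cpow (x * y) z = cpow x z * cpow y z.
Proof. by move=> x0 y0; rewrite /cpow lnM ?posrE// rmorphD mulrDr expCD. Qed.

Lemma cpow_powR x p z : cpow (x `^ p) z = cpow x (p%:C * z).
Proof. by congr expC; rewrite ln_powR rmorphM mulrCA mulrA. Qed.

Lemma powRV_cpow x p : 0 < x -> ((x `^ p)^-1)%:C = cpow x (- p)%:C.
Proof.
by move=> x0; rewrite -powRN cpow_real /powR (gt_eqF x0).
Qed.

End cpow_powR.

Section line_stable.
Context {R : realType} d (T : measurableType d) (P : probability T R) (D : T -> R).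
Variables (b t r c : R).
Hypotheses (b01 : 0 < b < 1) (t0 : 0 < t).
Hypotheses (mD : measurable_fun setT D) (D0 : P (D @^-1` `]-oo, 0]) = 0%E).
Hypothesis laplace : forall s, 0 < s ->
  (\int[P]_w (expR (- s * D w))%:E)%E = (expR (- t * s `^ b))%:E.
Hypotheses (r0 : r != 0) (rc : - b < r * (1 - c)).

Let Lam w := r * ln (D w).

Let ReU y : complex.Re (r%:C * (1 - (c +i* y))) = r * (1 - c).
Proof. by rewrite !complexE /=; ring. Qed.

Let integrandE y w : expC (((c - 1) +i* y) * (Lam w)%:C) =
  expC (- (r%:C * (1 - (c +i* y))) * (ln (D w))%:C).
Proof.
congr expC; rewrite /Lam rmorphM.
have -> : (c - 1) +i* y = (c +i* y) - 1 by apply: eq_complexP; rewrite /= ?subr0.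
by ring.
Qed.

(** The substitution u = r (1 - s) turns (s - 1) r ln D into - u ln D, and [rc] says that the line
    Re s = c falls in the half-plane Re u > -b. *)
Lemma line_integrable_stable y : line_integrable P Lam c y.
Proof.
rewrite /line_integrable (funext (integrandE y)).
have ub : - b < complex.Re (r%:C * (1 - (c +i* y))) by rewrite ReU.
exact: (cintegral_stable b01 t0 mD D0 laplace ub).1.
Qed.

Lemma line_moment_stable y :
  line_moment P Lam c y = stable_moment b t (r%:C * (1 - (c +i* y))).
Proof.
rewrite /line_moment (funext (integrandE y)).
have ub : - b < complex.Re (r%:C * (1 - (c +i* y))) by rewrite ReU.
exact: (cintegral_stable b01 t0 mD D0 laplace ub).2.
Qed.

Lemma line_decay_stable : quadratic_decay (line_moment P Lam c).
Proof.
have r0' : - r != 0 by rewrite oppr_eq0.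
apply: quadratic_decay_eq (quadratic_decay_comp r0' (stable_moment_decay t b01 rc)) => y.
rewrite line_moment_stable; congr (sqn (stable_moment _ _ _)).
by apply: eq_complexP; [rewrite ReU|rewrite !complexE /=; ring].
Qed.

Lemma line_moment_stableE y : (c != 1) || (y != 0) ->
  line_moment P Lam c y = ((b * t `^ (r / b))^-1)%:C * cpow t ((r / b)%:C * (c +i* y)) *
    (Gamma ((r / b)%:C * (1 - (c +i* y))) / Gamma (r%:C * (1 - (c +i* y)))).
Proof.
move=> cy.
have u0 : r%:C * (1 - (c +i* y)) != 0.
  rewrite mulf_neq0//; first by rewrite eq_complex /= eqxx andbT.
  rewrite subr_eq0 eq_sym eq_complex /=; case/orP: cy => /negbTE ->//.
  by rewrite andbF.
have bC : b%:C != 0 :> R[i].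
  by rewrite eq_complex /= eqxx andbT gt_eqF//; case/andP: b01.
rewrite line_moment_stable stable_momentE// ?ReU//.
have -> : r%:C * (1 - (c +i* y)) / b%:C = (r / b)%:C * (1 - (c +i* y)).
  by rewrite rmorphM fmorphV; field.
have -> : - (r%:C * (1 - (c +i* y))) / b%:C = (- (r / b))%:C + (r / b)%:C * (c +i* y).
  by rewrite rmorphN rmorphM fmorphV; field.
have -> : ((b * t `^ (r / b))^-1)%:C = b%:C^-1 * cpow t (- (r / b))%:C.
  rewrite invfM (rmorphM (real_complex R)); congr (_ * _); last exact: powRV_cpow.
  exact: (fmorphV (real_complex R)).
rewrite cpowD; congr (_ * _); exact: mulrA.
Qed.

End line_stable.

Section line_sum.
Context {R : realType} d (T : measurableType d) (P : probability T R).

Lemma line_integrableDl (a : R) Lam c y : line_integrable P Lam c y ->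
  line_integrable P (fun w => a + Lam w) c y /\
  line_moment P (fun w => a + Lam w) c y =
  expC (((c - 1) +i* y) * a%:C) * line_moment P Lam c y.
Proof.
move=> iL; rewrite /line_integrable /line_moment.
have -> : (fun w => expC (((c - 1) +i* y) * (a + Lam w)%:C)) =
    (fun w => expC (((c - 1) +i* y) * a%:C) * expC (((c - 1) +i* y) * (Lam w)%:C)).
  by apply/funext => w; rewrite -expCD -mulrDr -rmorphD.
by split; [exact: cintegrableZ|exact: cintegralZ].
Qed.

Lemma line_indepD (Lam Lam' : T -> measurableTypeR R) c y :
  measurable_fun setT Lam -> measurable_fun setT Lam' ->
  (forall A B, measurable A -> measurable B ->
    P (Lam @^-1` A `&` Lam' @^-1` B) = (P (Lam @^-1` A) * P (Lam' @^-1` B))%E) ->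
  line_integrable P Lam c y -> line_integrable P Lam' c y ->
  line_integrable P (fun w => Lam w + Lam' w) c y /\
  line_moment P (fun w => Lam w + Lam' w) c y =
  line_moment P Lam c y * line_moment P Lam' c y.
Proof.
move=> mL mL' ind iL iL'; rewrite /line_integrable /line_moment.
pose f (x : R) : R[i] := expC (((c - 1) +i* y) * x%:C).
have mf : cmeasurable setT f.
  apply: cmeasurable_expC; apply: cmeasurableM; first exact: cmeasurable_cst.
  exact: cmeasurable_real.
have -> : (fun w => expC (((c - 1) +i* y) * (Lam w + Lam' w)%:C)) =
    (fun w => f (Lam w) * f (Lam' w)).
  by apply/funext => w; rewrite -expCD -mulrDr -rmorphD.
exact: (cintegral_indep mL mL' ind mf mf).
Qed.

End line_sum.

(** * Which abscissas separate the poles *)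

Section separation.
Context {R : realType}.
Implicit Types (aA bB : seq (R[i] * R)) (c : R).

(** The abscissa of [foxH] is known only through separation: a property of the selected one has to
    be proved for all, once some separating [c0] exists. *)
Lemma xget_separates m n aA bB (Q : R -> Prop) c0 : separates m n aA bB c0 ->
  (forall c, separates m n aA bB c -> Q c) ->
  Q (xget 0 [set c | separates m n aA bB c]).
Proof.
by move=> h0 hQ; apply: hQ; apply: (@xgetPex _ 0 [set c | separates m n aA bB c]); exists c0.
Qed.

Lemma Gamma_pole_line (k : R) (s : R[i]) : 0 < k ->
  Gamma_pole (k%:C * (1 - s)) -> exists j : nat, s = (1 + j%:R / k)%:C.
Proof.
move=> k0 [j e]; exists j.
have kC : k%:C != 0 :> R[i] by rewrite eq_complex /= eqxx andbT gt_eqF.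
rewrite rmorphD rmorph1 rmorphM fmorphV rmorph_nat.
apply: (mulfI kC); have -> : k%:C * s = k%:C - k%:C * (1 - s) by ring.
by rewrite e; field.
Qed.

(** All poles lie at s = 1 + j/k and to the right of the path, so 0 separates; the pole at 1,
    present since [ks] is inhabited, forces c < 1. *)
Lemma separates_right n aA bB (ks : seq R) k0 : k0 \in ks -> (forall k, k \in ks -> 0 < k) ->
  (forall s, right_args n aA s = [seq k%:C * (1 - s) | k <- ks]) ->
  xget 0 [set c | separates 0 n aA bB c] < 1.
Proof.
move=> k0s ks0 rE.
have nl s : ~ left_singularity 0 bB s by rewrite /left_singularity/left_args take0 => -[].
apply: (@xget_separates _ _ _ _ (fun c => c < 1) 0) => [s _|c hc].
  split => [/nl//|[w]]; rewrite rE => /mapP[k /ks0 k_gt0 ->].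
  move=> /(Gamma_pole_line k_gt0)[j ->] /=.
  by rewrite ltr_pwDl// divr_ge0// ltW.
suff rs : right_singularity n aA (1 : R[i]).
  by have [|_ /(_ rs)] := hc 1; first by case=> /nl.
exists (k0%:C * (1 - 1)); first by rewrite rE; apply/mapP; exists k0.
by exists 0%N; rewrite subrr mulr0 oppr0.
Qed.

(** The mirror image: s -> 2 - s carries the poles 1 - j/k to 1 + j/k, so 2 separates and the pole
    at 1 forces 1 < c. *)
Lemma separates_left m aA bB (k : R) : 0 < k ->
  (forall s, left_args m bB s = [:: - k%:C * (1 - s)]) ->
  1 < xget 0 [set c | separates m 0 aA bB c].
Proof.
move=> k0 lE.
have nr s : ~ right_singularity 0 aA s by rewrite /right_singularity/right_args take0 => -[].
apply: (@xget_separates _ _ _ _ (fun c => 1 < c) 2) => [s _|c hc].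
  split => [[w]|/nr//]; rewrite lE inE => /eqP ->.
  have -> : - k%:C * (1 - s) = k%:C * (1 - (2 - s)) by ring.
  move=> /(Gamma_pole_line k0)[j e].
  have -> : s = 2 - (1 + j%:R / k)%:C by rewrite -e; ring.
  have h : 0 <= j%:R / k by rewrite divr_ge0// ltW.
  by rewrite ReD ReN /= ; lra.
suff ls : left_singularity m bB (1 : R[i]).
  by have [|/(_ ls)] := hc 1; first by case=> _ /nr.
exists (- k%:C * (1 - 1)); first by rewrite lE inE.
by exists 0%N; rewrite subrr mulr0 oppr0.
Qed.

(* The point s = 1 is a pole of both numerator factors, cancelled by the two
   denominator factors, so the admissible strip extends beyond it on both sides. *)
Lemma separates_strip aA bB (k l : R) : 0 < k -> 0 < l ->
  (forall s, right_args 1 aA s = [:: k%:C * (1 - s)]) ->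
  (forall s, left_args 1 bB s = [:: - l%:C * (1 - s)]) ->
  (forall s, den_args 1 1 aA bB s = [:: - (1 - s); 1 - s]) ->
  1 - l^-1 < xget 0 [set c | separates 1 1 aA bB c] < 1 + k^-1.
Proof.
move=> k0 l0 rE lE dE.
have flip s : - l%:C * (1 - s) = l%:C * (1 - (2 - s)) by ring.
have rs s : right_singularity 1 aA s <-> Gamma_pole (k%:C * (1 - s)).
  split; first by case=> w; rewrite rE inE => /eqP ->.
  by move=> p; exists (k%:C * (1 - s)) => //; rewrite rE inE.
have ls s : left_singularity 1 bB s <-> Gamma_pole (- l%:C * (1 - s)).
  split; first by case=> w; rewrite lE inE => /eqP ->.
  by move=> p; exists (- l%:C * (1 - s)) => //; rewrite lE inE.
have rP s : right_singularity 1 aA s -> exists j : nat, s = (1 + j%:R / k)%:C.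
  by move/rs; exact: Gamma_pole_line.
have lP s : left_singularity 1 bB s -> exists j : nat, s = (1 - j%:R / l)%:C.
  move/ls; rewrite flip => /(Gamma_pole_line l0)[j e]; exists j.
  have -> : s = 2 - (1 + j%:R / l)%:C by rewrite -e; ring.
  by apply: eq_complexP; rewrite !complexE /=; ring.
have p0 : Gamma_pole (0 : R[i]) by exists 0%N; rewrite oppr0.
have can1 : cancelled 1 1 aA bB 1.
  split; [|by apply/rs; rewrite subrr mulr0|].
    by apply/ls; rewrite subrr mulr0.
  by rewrite rE lE dE subrr !mulr0 oppr0.
(* The witness is c = 1: index j = 0 gives the cancelled point s = 1 in both families, and all other
   poles are strictly on the correct side. *)
apply: (@xget_separates _ _ _ _ (fun c => 1 - l^-1 < c < 1 + k^-1) 1) => [s nc|c hc].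
  split.
    move=> /lP[[|j] e].
      by case: nc; rewrite e mul0r subr0.
    by rewrite e /= ltrBlDr ltrDl divr_gt0.
  move=> /rP[[|j] e].
    by case: nc; rewrite e mul0r addr0.
  by rewrite e /= ltrDl divr_gt0.
have kC : k%:C != 0 :> R[i] by rewrite eq_complex /= eqxx andbT gt_eqF.
have lC : l%:C != 0 :> R[i] by rewrite eq_complex /= eqxx andbT gt_eqF.
have jk (x : R) (j : nat) : 0 < x -> 0 <= j%:R / x by move=> x0; rewrite divr_ge0// ltW.
have iv (x : R) : 0 < x -> 0 < x^-1 by move=> x0; rewrite invr_gt0.
(* Conversely the poles of index 1 bound the strip. Neither is cancelled, as the left family lies in
   Re s <= 1 and the right one in Re s >= 1. *)
apply/andP; split.
  have l1 : left_singularity 1 bB (1 - l^-1)%:C.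
    by apply/ls; exists 1%N; rewrite rmorphB rmorph1 fmorphV; field.
  have n1 : ~ cancelled 1 1 aA bB (1 - l^-1)%:C.
    case=> _ /rP[j /(congr1 (@complex.Re R)) /= e] _.
    by have := jk k j k0; have := iv l l0; lra.
  by have [/(_ l1)] := hc _ n1.
have r1 : right_singularity 1 aA (1 + k^-1)%:C.
  by apply/rs; exists 1%N; rewrite rmorphD rmorph1 fmorphV; field.
have n1 : ~ cancelled 1 1 aA bB (1 + k^-1)%:C.
  case=> /lP[j /(congr1 (@complex.Re R)) /= e] _ _.
  by have := jk l j l0; have := iv k k0; lra.
by have [_ /(_ r1)] := hc _ n1.
Qed.

End separation.

Lemma has_pdf_pos d (T : measurableType d) (R : realType) (P : probability T R)
    (X : T -> R) (F : R -> R[i]) : has_pdf P X F -> P (X @^-1` `]-oo, 0]) = 0%E.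
Proof.
move=> [_ [f [_ _ _ ->//]]]; rewrite (_ : _ `&` _ = set0) ?integral_set0//.
by apply/seteqP; split => x //= []; rewrite !in_itv/= andbT leNgt => /negP.
Qed.

Lemma fox_arg (R : realType) (k : R) (s : R[i]) : 1 - (1 - k)%:C - k%:C * s = k%:C * (1 - s).
Proof. by rewrite rmorphB rmorph1; ring. Qed.

(** On each open half-line the inverse is an exponential of a logarithm up to sign; the value 0 of
    the inverse at 0 agrees with both indicators being 0 there. *)
Lemma measurable_invr (R : realType) : measurable_fun setT (fun x : R => x^-1).
Proof.
suff -> : (fun x : R => x^-1) = (fun x => expR (- 1 * ln x) * \1_(`]0, +oo[%classic) x -
    expR (- 1 * ln (- x)) * \1_(`]-oo, 0[%classic) x).
  apply: measurable_funB; apply: measurable_funM.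
  - exact: measurable_rpow.
  - exact: measurable_indic.
  - apply: (measurableT_comp (@measurable_expR R)); apply: measurable_funM => //.
    exact: (measurableT_comp (@measurable_ln R) (@oppr_measurable R setT)).
  - exact: measurable_indic.
apply/funext => x; rewrite !indicE !mem_setE !in_itv/= andbT !mulN1r !expRN.
have [x0|x0|<-] := ltgtP 0 x; last by rewrite invr0 !mulr0 subrr.
- by rewrite lnK// mulr1 mulr0 subr0.
- by rewrite (@lnK _ (- x)) ?posrE ?oppr_gt0// mulr0 sub0r mulr1 invrN opprK.
Qed.

(** * The densities of the transforms *)

Section transforms.
Context {R : realType} d (T : measurableType d) (P : probability T R).
Variable t : R.
Hypothesis t0 : 0 < t.

Section one.
Variables (D : T -> R) (b : R).
Hypotheses (b01 : 0 < b < 1).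
Hypotheses (mD : measurable_fun setT D) (D0 : P (D @^-1` `]-oo, 0]) = 0%E).
Hypothesis laplace : forall s, 0 < s ->
  (\int[P]_w (expR (- s * D w))%:E)%E = (expR (- t * s `^ b))%:E.

Let b0 : 0 < b. Proof. by case/andP: b01. Qed.

Let mL (r : R) : measurable_fun setT (fun w => r * ln (D w)).
Proof. by apply: measurable_funM => //; exact: (measurableT_comp (@measurable_ln R) mD). Qed.

(** Adding ln a to ln D multiplies the Mellin transform by a^(s-1): the part a^(-1) enters the
    prefactor and a^s rescales the argument. *)
Lemma scale_pdf (a : R) : 0 < a -> has_pdf P (fun w => a * D w) (fun x =>
  ((a * b * t `^ (1 / b))^-1)%:C *
  foxH 0 1 [:: ((1 - 1 / b)%:C, 1 / b)] [:: (0, 1)] (x / (a * t `^ (1 / b))) 0).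
Proof.
move=> a0; pose aA : seq (R[i] * R) := [:: ((1 - 1 / b)%:C, 1 / b)].
pose c : R := xget 0 [set c | separates 0 1 aA [:: (0, 1)] c].
have rE s : right_args 1 aA s = [seq k%:C * (1 - s) | k <- [:: 1 / b]].
  by rewrite /right_args /= fox_arg.
have c1 : c < 1.
  apply: (@separates_right _ _ _ _ _ (1 / b) _ _ rE); first by rewrite inE.
  by move=> k; rewrite inE => /eqP ->; rewrite divr_gt0.
have rc : - b < 1 * (1 - c) by move: b0 c1; lra.
have n1 : (1 : R) != 0 by exact: oner_neq0.
pose Lam w := ln a + 1 * ln (D w).
have iD y := line_integrable_stable b01 t0 mD D0 laplace rc y.
have ME y := (line_integrableDl (ln a) (iD y)).2.
have tp : 0 < t `^ (1 / b) by exact: powR_gt0.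
apply: (@fox_pdf _ _ _ _ _ _ _ _ _ Lam c).
- by apply: measurable_funM.
- by apply: measurable_funD => //; exact: mL.
- have [N [mN N0 sN]] := ae_pos mD D0.
  exists N; split => // w hw; apply: sN => w0; apply: hw.
  by rewrite /= /Lam expRD mul1r !lnK.
- by [].
- by rewrite invr_gt0 !mulr_gt0.
- by rewrite mulr_gt0.
- exact: (line_integrableDl _ (iD 0)).1.
- apply: quadratic_decay_eq (quadratic_decayZ (expR ((c - 1) * ln a))%:C
    (line_decay_stable b01 t0 mD D0 laplace n1 rc)) => y.
  by rewrite (ME y) [RHS]sqnM [LHS]sqnM sqnC sqn_expC !complexE /= mulr0 subr0.
- move=> y y0; rewrite ME (line_moment_stableE b01 t0 mD D0 laplace n1 rc);
    last by rewrite y0 orbT.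
  rewrite /chi rE /left_args take0 /den_args /= !big_cons !big_nil !mulr1.
  have -> : 1 - 0 - 1%:C * (c +i* y) = 1%:C * (1 - (c +i* y)) by rewrite subr0 !mul1r.
  rewrite (cpow_mul _ a0 tp) (cpow_powR t).
  have -> : expC (((c - 1) +i* y) * (ln a)%:C) = a%:C^-1 * cpow a (c +i* y).
    have -> : a%:C^-1 = cpow a (- 1)%:C by rewrite -powRV_cpow// powRr1 ?fmorphV// ltW.
    rewrite -cpowD; congr (cpow a _).
    by apply: eq_complexP; rewrite !complexE /= ?add0r// addrC.
  have -> : ((a * b * t `^ (1 / b))^-1)%:C = a%:C^-1 * ((b * t `^ (1 / b))^-1)%:C.
    by rewrite -mulrA invfM (rmorphM (real_complex R)) -(fmorphV (real_complex R)).
  move: (cpow a _) (cpow t _) (Gamma _) (Gamma _) (_%:C^-1) (_^-1)%:C => p q g h u v.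
  by rewrite -!mulrA; ring.
Qed.

Let powR_exp (r : R) : {ae P, forall w, D w `^ r = expR (r * ln (D w))}.
Proof.
have [N [mN N0 sN]] := ae_pos mD D0.
exists N; split => // w hw; apply: sN => w0; apply: hw.
by rewrite /= /powR gt_eqF.
Qed.

Let measurable_powR_D (r : R) : measurable_fun setT (fun w => D w `^ r).
Proof. exact: (measurableT_comp (measurable_powR r) mD). Qed.

(** With u = r (1 - s), the upper pair is Gamma(u/b) and the lower one Gamma(u). Separation gives c
    < 1, hence Re u > 0. *)
Lemma power_pdf (r : R) : 0 < r -> has_pdf P (fun w => D w `^ r) (fun x =>
  ((b * t `^ (r / b))^-1)%:C *
  foxH 0 1 [:: ((1 - r / b)%:C, r / b)] [:: ((1 - r)%:C, r)] (x / t `^ (r / b)) 0).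
Proof.
move=> r_gt0; pose aA : seq (R[i] * R) := [:: ((1 - r / b)%:C, r / b)].
pose bB : seq (R[i] * R) := [:: ((1 - r)%:C, r)].
pose c : R := xget 0 [set c | separates 0 1 aA bB c].
have rE s : right_args 1 aA s = [seq k%:C * (1 - s) | k <- [:: r / b]].
  by rewrite /right_args /= fox_arg.
have c1 : c < 1.
  apply: (@separates_right _ _ _ _ _ (r / b) _ _ rE); first by rewrite inE.
  by move=> k; rewrite inE => /eqP ->; rewrite divr_gt0.
have rc : - b < r * (1 - c).
  by rewrite (@lt_trans _ _ 0) ?oppr_lt0// mulr_gt0// subr_gt0.
have n0 : r != 0 by rewrite gt_eqF.
have tp : 0 < t `^ (r / b) by exact: powR_gt0.
apply: (@fox_pdf _ _ _ _ _ _ _ _ _ (fun w => r * ln (D w)) c) => //.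
- by rewrite invr_gt0 mulr_gt0.
- exact: (line_integrable_stable b01 t0 mD D0 laplace rc 0).
- exact: (line_decay_stable b01 t0 mD D0 laplace n0 rc).
- move=> y y0; rewrite (line_moment_stableE b01 t0 mD D0 laplace n0 rc); last by rewrite y0 orbT.
  rewrite /chi rE /left_args take0 /den_args /= !big_cons !big_nil !mulr1 fox_arg.
  by rewrite (cpow_powR t) mulrAC.
Qed.

(** For r < 0 the same argument r (1 - s) is written r + (-r) s, to have a positive coefficient of
    s. The poles thereby move to the left of the path, which changes the type from 0,1 to 1,0; now c
    > 1, and again Re u > 0. *)
Lemma neg_power_pdf (r : R) : r < 0 -> has_pdf P (fun w => D w `^ r) (fun x =>
  ((b * t `^ (r / b))^-1)%:C *
  foxH 1 0 [:: (r%:C, - r)] [:: ((r / b)%:C, - (r / b))] (x / t `^ (r / b)) 0).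
Proof.
move=> r_lt0; pose aA : seq (R[i] * R) := [:: (r%:C, - r)].
pose bB : seq (R[i] * R) := [:: ((r / b)%:C, - (r / b))].
pose c : R := xget 0 [set c | separates 1 0 aA bB c].
have argE (k : R) s : k%:C + (- k)%:C * s = k%:C * (1 - s) by rewrite rmorphN; ring.
have lE s : left_args 1 bB s = [:: - (- (r / b))%:C * (1 - s)].
  by rewrite /left_args /= argE rmorphN opprK.
have c1 : 1 < c.
  by apply: (@separates_left _ _ _ _ _ _ lE); rewrite oppr_gt0 pmulr_llt0 ?invr_gt0.
have rc : - b < r * (1 - c).
  by rewrite (@lt_trans _ _ 0) ?oppr_lt0// nmulr_rgt0// subr_lt0.
have n0 : r != 0 by rewrite lt_eqF.
have tp : 0 < t `^ (r / b) by exact: powR_gt0.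
apply: (@fox_pdf _ _ _ _ _ _ _ _ _ (fun w => r * ln (D w)) c) => //.
- by rewrite invr_gt0 mulr_gt0.
- exact: (line_integrable_stable b01 t0 mD D0 laplace rc 0).
- exact: (line_decay_stable b01 t0 mD D0 laplace n0 rc).
- move=> y y0; rewrite (line_moment_stableE b01 t0 mD D0 laplace n0 rc); last by rewrite y0 orbT.
  rewrite /chi lE /right_args take0 /den_args /= !big_cons !big_nil !mulr1 mul1r argE.
  by rewrite (cpow_powR t) rmorphN opprK mulrAC.
Qed.

End one.

(** The Mellin transform is E[D^(s-1)] E[E^(1-s)], with u = 1 - s for D and u = s - 1 for E; both
    moments exist exactly for 1 - e < c < 1 + b. The power of t is 1/b - 1/e because D scales like
    t^(1/b) and 1/E like t^(-1/e); the sum 1/b + 1/e of the opening statement would contradict this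
    scaling for t other than 1. *)
Lemma ratio_pdf (D E : T -> R) (b e : R) : 0 < b < 1 -> 0 < e < 1 ->
  measurable_fun setT D -> measurable_fun setT E ->
  P (D @^-1` `]-oo, 0]) = 0%E -> P (E @^-1` `]-oo, 0]) = 0%E ->
  (forall s, 0 < s ->
    (\int[P]_w (expR (- s * D w))%:E)%E = (expR (- t * s `^ b))%:E) ->
  (forall s, 0 < s ->
    (\int[P]_w (expR (- s * E w))%:E)%E = (expR (- t * s `^ e))%:E) ->
  (forall A B : set R, measurable A -> measurable B ->
    P (D @^-1` A `&` E @^-1` B) = (P (D @^-1` A) * P (E @^-1` B))%E) ->
  has_pdf P (fun w => D w / E w) (fun z =>
    ((b * e * t `^ (1 / b - 1 / e))^-1)%:C *
    foxH 1 1 [:: ((1 - 1 / b)%:C, 1 / b); (- 1, 1)]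
      [:: ((- (1 / e))%:C, 1 / e); (0, 1)]
      (z / t `^ (1 / b - 1 / e)) 0).
Proof.
move=> b01 e01 mD mE D0 E0 lapD lapE indep.
pose aA : seq (R[i] * R) := [:: ((1 - 1 / b)%:C, 1 / b); (- 1, 1)].
pose bB : seq (R[i] * R) := [:: ((- (1 / e))%:C, 1 / e); (0, 1)].
pose c : R := xget 0 [set c | separates 1 1 aA bB c].
have b0 : 0 < b by case/andP: b01.
have e0 : 0 < e by case/andP: e01.
have rE s : right_args 1 aA s = [:: (1 / b)%:C * (1 - s)] by rewrite /right_args /= fox_arg.
have lE s : left_args 1 bB s = [:: - (1 / e)%:C * (1 - s)].
  by rewrite /left_args /= rmorphN; congr [:: _]; ring.
have dE s : den_args 1 1 aA bB s = [:: - (1 - s); 1 - s].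
  by rewrite /den_args /= subr0 mul1r opprB addrC.
have /andP[c1 c2] : 1 - e < c < 1 + b.
  have := @separates_strip _ aA bB (1 / b) (1 / e) _ _ rE lE dE.
  by rewrite !div1r !invrK; apply; rewrite invr_gt0.
have rD : - b < 1 * (1 - c) by lra.
have rF : - e < - 1 * (1 - c) by lra.
have n1 : (1 : R) != 0 by exact: oner_neq0.
have n2 : (- 1 : R) != 0 by rewrite oppr_eq0.
pose L1 w := 1 * ln (D w); pose L2 w := - 1 * ln (E w).
have mL1 : measurable_fun setT L1.
  by apply: measurable_funM => //; exact: (measurableT_comp (@measurable_ln R) mD).
have mL2 : measurable_fun setT L2.
  by apply: measurable_funM => //; exact: (measurableT_comp (@measurable_ln R) mE).
have ind (A B : set (measurableTypeR R)) : measurable A -> measurable B ->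
    P (L1 @^-1` A `&` L2 @^-1` B) = (P (L1 @^-1` A) * P (L2 @^-1` B))%E.
  move=> mA mB.
  have ml (r : R) (C : set R) : measurable C -> measurable ((fun x => r * ln x) @^-1` C).
    move=> mC; rewrite -[X in measurable X]setTI.
    by apply: (_ : measurable_fun setT (fun x => r * ln x)) => //; exact: measurable_funM.
  exact: (indep ((fun x => 1 * ln x) @^-1` A) ((fun x => - 1 * ln x) @^-1` B) (ml _ _ mA) (ml
    _ _ mB)).
have iD y := line_integrable_stable b01 t0 mD D0 lapD rD y.
have iE y := line_integrable_stable e01 t0 mE E0 lapE rF y.
have ME y := line_indepD mL1 mL2 ind (iD y) (iE y).
have tp : 0 < t `^ (1 / b - 1 / e) by exact: powR_gt0.
apply: (@fox_pdf _ _ _ _ _ _ _ _ _ (fun w => L1 w + L2 w) c) => //.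
- apply: measurable_funM => //.
  exact: (measurableT_comp (@measurable_invr R) mE).
- exact: measurable_funD.
- have := ae_pos mE E0; have := ae_pos mD D0; apply: filterS2 => w Dw Ew.
  by rewrite expRD /L1 /L2 mul1r mulN1r expRN !lnK.
- by rewrite invr_gt0 !mulr_gt0.
- exact: (ME 0).1.
- apply: quadratic_decay_eq (quadratic_decayM
    (line_decay_stable b01 t0 mD D0 lapD n1 rD) (line_decay_stable e01 t0 mE E0 lapE n2 rF)) => y.
  by rewrite (ME y).2.
- move=> y y0; rewrite (ME y).2 (line_moment_stableE b01 t0 mD D0 lapD n1 rD);
    last by rewrite y0 orbT.
  rewrite (line_moment_stableE e01 t0 mE E0 lapE n2 rF); last by rewrite y0 orbT.
  rewrite /chi rE lE dE !big_cons !big_nil !mulr1.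
  rewrite (cpow_powR t) mulNr.
  have -> : (1 / b - 1 / e)%:C * (c +i* y) =
      (1 / b)%:C * (c +i* y) + (- (1 / e))%:C * (c +i* y).
    by rewrite -mulrDl -rmorphD.
  have -> : ((b * e * t `^ (1 / b - 1 / e))^-1)%:C =
      ((b * t `^ (1 / b))^-1)%:C * ((e * t `^ (- (1 / e)))^-1)%:C.
    by rewrite -rmorphM -invfM powRD ?(gt_eqF t0) ?implybT// mulrACA.
  have -> : (- 1)%:C * (1 - (c +i* y)) = - (1 - (c +i* y)) by rewrite rmorphN mulN1r.
  have -> : 1%:C * (1 - (c +i* y)) = 1 - (c +i* y) by rewrite mul1r.
  rewrite cpowD rmorphN.
  move: (cpow t _) (cpow t _) (_^-1)%:C (_^-1)%:C => p q u v.
  move: (Gamma _) (Gamma _) (Gamma _) (Gamma _) => g1 g2 g3 g4.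
  by rewrite invfM; ring.
Qed.

End transforms.

Section product.
Context {R : realType} d (T : measurableType d) (P : probability T R).
Variables (t : R) (n : nat) (D : 'I_n -> T -> R) (b : 'I_n -> R).
Hypotheses (t0 : 0 < t) (n_gt0 : (0 < n)%N) (b01 : forall i, 0 < b i < 1).
Hypotheses (mD : forall i, measurable_fun setT (D i))
  (D0 : forall i, P (D i @^-1` `]-oo, 0]) = 0%E).
Hypothesis laplace : forall i s, 0 < s ->
  (\int[P]_w (expR (- s * D i w))%:E)%E = (expR (- t * s `^ b i))%:E.
Hypothesis indep : forall B : 'I_n -> set R, (forall i, measurable (B i)) ->
  fine (P (\bigcap_(i in [set: 'I_n]) D i @^-1` B i)) = \prod_i fine (P (D i @^-1` B i)).

Lemma product_pdf : has_pdf P (fun w => \prod_(i < n) D i w) (fun y =>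
  (\prod_(i < n) (b i * t `^ (1 / b i))^-1)%:C *
  foxH 0 n [seq ((1 - 1 / b i)%:C, 1 / b i) | i <- enum 'I_n]
    (nseq n (0, 1)) (y / t `^ (\sum_(i < n) 1 / b i)) 0).
Proof.
pose aA : seq (R[i] * R) := [seq ((1 - 1 / b i)%:C, 1 / b i) | i <- enum 'I_n].
pose bB : seq (R[i] * R) := nseq n (0, 1).
pose c : R := xget 0 [set c | separates 0 n aA bB c].
(* [i0] serves twice: its pole at s = 1 forces c < 1, and its factor makes the product of moments
   decay. *)
pose i0 := Ordinal n_gt0.
have b0 i : 0 < b i by case/andP: (b01 i).
have sA : size aA = n by rewrite size_map size_enum_ord.
have rE s : right_args n aA s = [seq k%:C * (1 - s) | k <- [seq 1 / b i | i <- enum 'I_n]].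
  rewrite /right_args take_oversize ?sA// -!map_comp; apply: eq_map => i /=.
  exact: fox_arg.
have c1 : c < 1.
  apply: (@separates_right _ _ _ _ _ (1 / b i0) _ _ rE).
    by apply/mapP; exists i0 => //; rewrite mem_enum.
  by move=> _ /mapP[i _ ->]; rewrite divr_gt0.
have rc i : - b i < 1 * (1 - c) by move: (b0 i) c1; lra.
have n1 : (1 : R) != 0 by exact: oner_neq0.
pose L i (w : T) : measurableTypeR R := 1 * ln (D i w).
have mL i : measurable_fun setT (L i).
  by apply: measurable_funM => //; exact: (measurableT_comp (@measurable_ln R) (mD i)).
have indL (B : 'I_n -> set (measurableTypeR R)) : (forall i, measurable (B i)) ->
    fine (P (\bigcap_(i in [set: 'I_n]) L i @^-1` B i)) = \prod_i fine (P (L i @^-1` B i)).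
  move=> mB; apply: (indep (B := fun i => (fun x => 1 * ln x) @^-1` B i)) => i.
  rewrite -[X in measurable X]setTI.
  have ml : measurable_fun setT (fun x : R => 1 * ln x) by exact: measurable_funM.
  by apply: ml; [exact: measurableT|exact: mB].
have iD i y := line_integrable_stable (b01 i) t0 (mD i) (D0 i) (@laplace i) (rc i) y.
have ME y := cintegral_exp_sum mL indL (fun i => iD i y).
have tp : 0 < t `^ (\sum_(i < n) 1 / b i) by exact: powR_gt0.
apply: (@fox_pdf _ _ _ _ _ _ _ _ _ (fun w => \sum_i L i w) c) => //.
- exact: measurable_prod.
- exact: measurable_sum.
- have : {ae P, forall w, forall i, 0 < D i w}.
    by apply: filter_forall => i; exact: ae_pos (mD i) (D0 i).
  apply: filterS => w Dw; rewrite expR_sum; apply: eq_bigr => i _.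
  by rewrite /L mul1r lnK ?posrE ?Dw.
- by apply: prodr_gt0 => i _; rewrite invr_gt0 mulr_gt0// powR_gt0.
- exact: (ME 0).1.
- apply: quadratic_decay_eq (quadratic_decay_prod i0 (fun i =>
    line_decay_stable (b01 i) t0 (mD i) (D0 i) (@laplace i) n1 (rc i))) => y.
  by congr sqn; exact/esym/(ME y).2.
- move=> y y0; rewrite /line_moment (ME y).2.
  transitivity (\prod_i (((b i * t `^ (1 / b i))^-1)%:C * cpow t ((1 / b i)%:C * (c +i* y)) *
    (Gamma ((1 / b i)%:C * (1 - (c +i* y))) / Gamma (1%:C * (1 - (c +i* y)))))).
    apply: eq_bigr => i _.
    apply: (line_moment_stableE (b01 i) t0 (mD i) (D0 i) (@laplace i) n1 (rc i)).
    by rewrite y0 orbT.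
  rewrite 2!big_split/= [in RHS](cpow_powR t) mulrAC.
  congr (_ * _ * _).
  + by rewrite (rmorph_prod (real_complex R)).
    rewrite /chi rE /left_args take0 big_nil mulr1 2!big_map big_enum /=.
    rewrite prodf_div; congr (_ / _).
    rewrite /den_args drop_oversize ?sA// drop0 cat0s big_map.
    rewrite prodr_const card_ord big_nseq iter_mulr_1.
    by rewrite subr0 !mul1r.
  + rewrite rmorph_sum mulr_suml /cpow mulr_suml expC_sum; exact: eq_bigr.
Qed.

End product.

Lemma independent_processes_law d (T : measurableType d) (R : realType)
    (P : probability T R) (I : finType) (D : I -> R -> {RV P >-> R}) (t : R)
    (B : I -> set R) : 0 <= t -> independent_processes P D -> (forall i, measurable (B i)) ->
  fine (P (\bigcap_(i in [set: I]) D i t @^-1` B i)) = \prod_i fine (P (D i t @^-1` B i)).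
Proof.
move=> t0 ind mB; apply: (ind (fun i => D i t @^-1` B i)) => i.
by apply: sub_sigma_algebra; exists t => //; exists (B i).
Qed.

(** Take [setT] at all indices other than i and j; their factors are 1. *)
Lemma independent_family_pair d (T : measurableType d) (R : realType)
    (P : probability T R) (I : finType) (D : I -> T -> R) (i j : I) (A B : set R) :
  (forall k, measurable_fun setT (D k)) ->
  (forall B : I -> set R, (forall k, measurable (B k)) ->
    fine (P (\bigcap_(k in [set: I]) D k @^-1` B k)) = \prod_k fine (P (D k @^-1` B k))) ->
  i != j -> measurable A -> measurable B ->
  P (D i @^-1` A `&` D j @^-1` B) = (P (D i @^-1` A) * P (D j @^-1` B))%E.
Proof.
move=> mD ind ij mA mB.
pose C k := if k == i then A else if k == j then B else setT.
have mC k : measurable (C k) by rewrite /C; case: ifP => // _; case: ifP.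
have ji : (j == i) = false by rewrite eq_sym (negbTE ij).
have mpre k (F : set R) : measurable F -> measurable (D k @^-1` F).
  by move=> mF; rewrite -[X in measurable X]setTI; exact: mD.
have CE : \bigcap_(k in [set: I]) D k @^-1` C k = D i @^-1` A `&` D j @^-1` B.
  apply/seteqP; split => w /= h.
    split; first by have := h i Logic.I; rewrite /C /= eqxx.
    by have := h j Logic.I; rewrite /C /= ji eqxx.
  move=> k _; rewrite /C /=; case: eqP => [->|_]; first by case: h.
  by case: eqP => [->|//]; case: h.
have := ind C mC; rewrite CE (bigD1 i)//= (bigD1 j) ?ji//= big1 => [|k /andP[ki kj]]; last first.
  by rewrite /C (negbTE ki) (negbTE kj) preimage_setT probability_setT.
rewrite /C eqxx ji eqxx mulr1 => e.
rewrite -[LHS]fineK; last by apply/fin_num_measure/measurableI; exact: mpre.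
by rewrite e EFinM !fineK//; apply/fin_num_measure/mpre.
Qed.

Theorem theorem3p2 (R : realType) (d : measure_display) (T : measurableType d)
  (P : probability T R) (n : nat) (beta : 'I_n -> R)
  (D : 'I_n -> R -> {RV P >-> R})
  (n_gt0 : (0 < n)%N)
  (beta01 : forall i, 0 < beta i < 1)
  (D_stable : forall i, stable_subordinator (beta i) (D i))
  (D_indep : independent_processes P D)
  (D_pdf : forall i t, 0 < t ->
    has_pdf P (D i t) (fun x =>
      ((beta i * t `^ (1 / beta i))^-1)%:C *
      foxH 0 1 [:: ((1 - 1 / beta i)%:C, 1 / beta i)] [:: (0, 1)]
        (x / t `^ (1 / beta i)) 0)) :
  forall t : R, 0 < t ->
  [/\ (* scaling *)
      forall (a : R) (i : 'I_n), 0 < a ->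
        has_pdf P (fun w => a * D i t w) (fun x =>
          ((a * beta i * t `^ (1 / beta i))^-1)%:C *
          foxH 0 1 [:: ((1 - 1 / beta i)%:C, 1 / beta i)] [:: (0, 1)]
            (x / (a * t `^ (1 / beta i))) 0),
      (* product *)
      has_pdf P (fun w => \prod_(i < n) D i t w) (fun y =>
        (\prod_(i < n) (beta i * t `^ (1 / beta i))^-1)%:C *
        foxH 0 n [seq ((1 - 1 / beta i)%:C, 1 / beta i) | i <- enum 'I_n]
          (nseq n (0, 1))
          (y / t `^ (\sum_(i < n) 1 / beta i)) 0),
      (* positive rational power *)
      forall (r : rat) (i : 'I_n), 0 < r ->
        has_pdf P (fun w => D i t w `^ ratr r) (fun x =>
          ((beta i * t `^ (ratr r / beta i))^-1)%:C *
          foxH 0 1 [:: ((1 - ratr r / beta i)%:C, ratr r / beta i)]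
            [:: ((1 - ratr r)%:C, ratr r)]
            (x / t `^ (ratr r / beta i)) 0),
      (* negative rational power *)
      forall (r : rat) (i : 'I_n), r < 0 ->
        has_pdf P (fun w => D i t w `^ ratr r) (fun x =>
          ((beta i * t `^ (ratr r / beta i))^-1)%:C *
          foxH 1 0 [:: ((ratr r)%:C, - ratr r)]
            [:: ((ratr r / beta i)%:C, - (ratr r / beta i))]
            (x / t `^ (ratr r / beta i)) 0) &
      (* ratio *)
      forall i j : 'I_n, i != j ->
        has_pdf P (fun w => D i t w / D j t w) (fun z =>
          ((beta i * beta j * t `^ (1 / beta i - 1 / beta j))^-1)%:C *
          foxH 1 1 [:: ((1 - 1 / beta i)%:C, 1 / beta i); (- 1, 1)]
            [:: ((- (1 / beta j))%:C, 1 / beta j); (0, 1)]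
            (z / t `^ (1 / beta i - 1 / beta j)) 0)].
Proof.
move=> t t0.
have mD i : measurable_fun setT (D i t) by exact: measurable_funPT.
(* The given densities live on the positive half-line, which makes each D i t almost surely
   positive, so that its logarithm and powers are genuine. *)
have D0 i := has_pdf_pos (D_pdf i t t0).
have lap i s : 0 < s -> (\int[P]_w (expR (- s * D i t w))%:E)%E = (expR (- t * s `^ beta i))%:E.
  exact: (subordinator_laplace (D_stable i) t0).
have ind B := independent_processes_law (ltW t0) D_indep (B := B).
split.
- by move=> a i a0; exact: (scale_pdf t0 (beta01 i) (mD i) (D0 i) (lap i) a0).
- exact: (product_pdf t0 n_gt0 beta01 mD D0 lap ind).
- move=> r i r0.
  by apply: (power_pdf t0 (beta01 i) (mD i) (D0 i) (lap i)); rewrite ltr0q.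
- move=> r i r0.
  by apply: (neg_power_pdf t0 (beta01 i) (mD i) (D0 i) (lap i)); rewrite ltrq0.
- move=> i j ij.
  apply: (ratio_pdf t0 (beta01 i) (beta01 j) (mD i) (mD j) (D0 i) (D0 j) (lap i) (lap j)).
  by move=> A B mA mB; exact: (independent_family_pair mD ind ij mA mB).
Qed.
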